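(* Let $n\ge 1$ and let $A$ be an expansive real $n\times n$ matrix. Suppose that the transpose $A^{*}$ has a real eigenvalue $\lambda\in\mathbb{R}$ with an associated eigenvector $v\in\mathbb{R}^n\setminus\{0\}$. Let $\psi$ be a radial function on $\mathbb{R}^n$ satisfying the standing hypothesis with respect to $A$ (see context), with $\widehat{\psi}$ supported in $\mathcal{A}(r,R)=\{\xi\in\mathbb{R}^n : r\le|\xi|\le R\}$, $0<r<R$, and suppose $|\lambda|>R/r$. Then the frame operator $U_{\psi,\psi}$, acting on $L^2(\mathbb{R}^n)$, satisfies $$\inf_{\substack{f\in L^2(\mathbb{R}^n)\\ \|f\|_{L^2}=1}}\langle U_{\psi,\psi}f,f\rangle=0.$$ Consequently the affine system $\{\psi_{j,k}\}_{j\in\mathbb{Z},k\in\mathbb{Z}^n}$ is not a frame for $L^2(\mathbb{R}^n)$, in the sense that there is no constant $c>0$ such that $$c\,\|f\|_{L^2}^2\le\sum_{j\in\mathbb{Z}}\sum_{k\in\mathbb{Z}^n}|\langle f,\psi_{j,k}\rangle|^2\qquad\text{for every } f\in L^2(\mathbb{R}^n).$$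
   Context: Fourier transform: $\hat f(\xi)=\int_{\mathbb{R}^n} f(x)e^{-2\pi i x\cdot\xi}\,dx$. $\mathcal{S}(\mathbb{R}^n)$ denotes the Schwartz functions; $|\cdot|$ is the Euclidean norm on $\mathbb{R}^n$; $\langle\cdot,\cdot\rangle$ is the $L^2$ inner product. A real $n\times n$ matrix $A$ is expansive if every eigenvalue $\mu$ of $A$ satisfies $|\mu|>1$. Put $b:=|\det A|>1$, and let $|\lambda_-|$ be the smallest modulus of an eigenvalue of $A$. $A^*$ is the transpose of $A$. Step homogeneous quasi-norm (Bownik): there is an open ellipsoid $\Delta$ centred at $0$ with $|\Delta|=1$ and $\Delta\subset t\Delta\subset A\Delta$ for some $t>1$; fix one, put $B_k:=A^k\Delta$ ($k\in\mathbb{Z}$), and set $\rho_A(x)=b^k$ for $x\in B_{k+1}\setminus B_k$, $\rho_A(0)=0$. An anisotropic annulus is a set $\{\xi : r_A\le\rho_A(\xi)\le R_A\}$ with $0<r_A<R_A<\infty$. Standing hypothesis on $\psi$: $\psi\in\mathcal{S}(\mathbb{R}^n)$ (this is the meaning given to ''anisotropic decay adapted to $\rho_A$''); $\psi$ has vanishing moments $\int x^\alpha\psi(x)\,dx=0$ for $|\alpha|\le\mathcal{N}_p(A):=\lfloor(\tfrac1p-1)\tfrac{\ln b}{\ln|\lambda_-|}\rfloor$, for every $p\in(0,1]$; and $\hat\psi$ is supported in an anisotropic annulus contained in $[-1/2,1/2]^n\setminus\{0\}$. Affine system and frame operator: $\psi_{j,k}(x):=b^{j/2}\psi(A^jx-k)$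 for $j\in\mathbb{Z}$, $k\in\mathbb{Z}^n$, and $U_{\psi,\psi}f:=\sum_{j\in\mathbb{Z}}\sum_{k\in\mathbb{Z}^n}\langle f,\psi_{j,k}\rangle\psi_{j,k}$. The paper identifies $H^2_A(\mathbb{R}^n)$ with $L^2(\mathbb{R}^n)$. *)

(* Defs.v *)
From HB Require Import structures.
From mathcomp Require Import all_boot all_order all_algebra finmap.
From mathcomp Require Import all_classical all_reals all_analysis.
From mathcomp Require Import complex.

Set Implicit Arguments.
Unset Strict Implicit.
Unset Printing Implicit Defensive.
Import Order.TTheory GRing.Theory Num.Theory.
Import numFieldNormedType.Exports.
Import Normc.

Local Open Scope classical_set_scope.
Local Open Scope ring_scope.
Local Open Scope complex_scope.

(* n-dimensional Lebesgue measure, as the n-fold product of the Lebesgue measure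
   of R, on the Borel sigma-algebra of n.-tuple R. *)
Section LebesgueCons.
Context (R : realType) (n : nat).
Local Notation T := (measurableTypeR R).
Variable m : {sigma_finite_measure set (n.-tuple T) -> \bar R}.

Definition tcons (p : T * n.-tuple T) : n.+1.-tuple T :=
  [tuple of p.1 :: p.2].

Definition tuncons (t : n.+1.-tuple T) : T * n.-tuple T :=
  (thead t, [tuple of behead t]).

Lemma measurable_tcons : measurable_fun setT tcons.
Proof. exact: (measurable_cons measurable_fst measurable_snd). Qed.

Lemma measurable_tuncons : measurable_fun setT tuncons.
Proof.
apply/measurable_fun_pairP; split; first exact: measurable_tnth.
exact: measurable_behead.
Qed.

Lemma tconsK : cancel tcons tuncons.
Proof. by case=> x t; rewrite /tuncons /tcons /= theadE; congr pair; exact: val_inj. Qed.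

Definition lebesgue_cons : set (n.+1.-tuple T) -> \bar R :=
  pushforward ((@lebesgue_measure R) \x m)%E tcons.

Let lebesgue_cons0 : lebesgue_cons set0 = 0%E.
Proof. by rewrite /lebesgue_cons /pushforward preimage_set0 measure0. Qed.

Let lebesgue_cons_ge0 A : (0 <= lebesgue_cons A)%E.
Proof. by rewrite /lebesgue_cons /pushforward; exact: measure_ge0. Qed.

Let lebesgue_cons_sigma_additive : semi_sigma_additive lebesgue_cons.
Proof.
move=> F mF tF mUF; rewrite /lebesgue_cons /pushforward preimage_bigcup.
have mpre B : measurable B -> measurable (tcons @^-1` B).
  by move=> mB; rewrite -[X in measurable X]setTI; exact: measurable_tcons.
apply: measure_semi_sigma_additive.
- by move=> k; exact: mpre.
- apply/trivIsetP => /= i j _ _ ij; rewrite -preimage_setI.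
  by move/trivIsetP : tF => /(_ _ _ _ _ ij) ->//; rewrite preimage_set0.
- by rewrite -preimage_bigcup; exact: mpre.
Qed.

HB.instance Definition _ := isMeasure.Build _ _ _ lebesgue_cons
  lebesgue_cons0 lebesgue_cons_ge0 lebesgue_cons_sigma_additive.

Let lebesgue_cons_sigma_finite : sigma_finite setT lebesgue_cons.
Proof.
have /sigma_finiteP[F [TF ndF Foo]] := sigma_finiteT (@lebesgue_measure R).
have /sigma_finiteP[G [TG ndG Goo]] := sigma_finiteT m.
exists (fun k => tuncons @^-1` (F k `*` G k)).
  rewrite -preimage_bigcup -[LHS](preimage_setT tuncons); congr (_ @^-1` _).
  rewrite -setXTT TF TG predeqE => -[x y]; split.
    move=> [/= [i _ Fix] [k _ Gky]]; exists (maxn i k) => //; split.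
    - by move: x Fix; exact/subsetPset/ndF/leq_maxl.
    - by move: y Gky; exact/subsetPset/ndG/leq_maxr.
  by move=> [i _ []/= ? ?]; split; exists i.
move=> k; have [? ?] := Foo k; have [? ?] := Goo k; split.
  rewrite -[X in measurable X]setTI; apply: measurable_tuncons => //.
  exact: measurableX.
rewrite /lebesgue_cons /pushforward -comp_preimage.
rewrite (_ : tuncons \o tcons = id) ?preimage_id; last exact/funext/tconsK.
by rewrite product_measure1E// lte_mul_pinfty// ge0_fin_numE.
Qed.

HB.instance Definition _ := Measure_isSigmaFinite.Build _ _ _ lebesgue_cons
  lebesgue_cons_sigma_finite.

End LebesgueCons.

Fixpoint lebesgue (R : realType) (n : nat) :
    {sigma_finite_measure set (n.-tuple (measurableTypeR R)) -> \bar R} :=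
  match n with
  | 0 => \d_([tuple] : 0.-tuple (measurableTypeR R))
  | n'.+1 => lebesgue_cons (lebesgue R n')
  end.
Arguments lebesgue : clear implicits.

Section Euclidean.
Context (R : realType) (n : nat).
Implicit Types (x y : 'cV[R]_n) (f g : 'cV[R]_n -> R[i]).

(* Points of R^n are column vectors; [vec] transports them from the measure
   space of n-tuples. *)
Definition vec (t : n.-tuple (measurableTypeR R)) : 'cV[R]_n :=
  \col_i (tnth t i : R).

Definition dotv x y : R := \sum_i x i 0 * y i 0.

Definition enorm x : R := Num.sqrt (dotv x x).

Definition radial f : Prop :=
  exists g : R -> R[i], forall x, f x = g (enorm x).

Definition monom (alpha : 'I_n -> nat) x : R := \prod_i x i 0 ^+ alpha i.

Definition Cint f : R[i] :=
  (\int[lebesgue R n]_(t in setT) complex.Re (f (vec t))) +i*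
  (\int[lebesgue R n]_(t in setT) complex.Im (f (vec t))).

Definition fourier f (xi : 'cV[R]_n) : R[i] :=
  Cint (fun x => let u := 2 * pi * dotv x xi in
                 f x * (cos u +i* (- sin u))).

(* Elements of L^2 are represented by Borel functions; L^2-equality is equality
   at L^2-distance 0. *)
Definition L2norm f : \bar R :=
  ('N[lebesgue R n]_2%:E[(fun t => (normc (f (vec t)))%:E)])%E.

Definition L2 f : Prop :=
  [/\ measurable_fun setT (fun t : n.-tuple (measurableTypeR R) => complex.Re (f (vec t))),
      measurable_fun setT (fun t : n.-tuple (measurableTypeR R) => complex.Im (f (vec t))) &
      (L2norm f < +oo)%E].

Definition inner f g : R[i] := Cint (fun x => f x * conjc (g x)).

Definition partial_derivable (i : 'I_n) f x : Prop :=
  derivable (fun y => complex.Re (f y)) x (delta_mx i 0) /\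
  derivable (fun y => complex.Im (f y)) x (delta_mx i 0).

Definition partial (i : 'I_n) f x : R[i] :=
  'D_(delta_mx i 0) (fun y => complex.Re (f y)) x +i*
  'D_(delta_mx i 0) (fun y => complex.Im (f y)) x.

(* Derivatives of order |beta| are indexed by lists of |beta| coordinate
   directions, applied from right to left. *)
Definition partials (s : seq 'I_n) f : 'cV[R]_n -> R[i] := foldr partial f s.

Definition schwartz f : Prop :=
  forall s : seq 'I_n,
    [/\ continuous (fun x => complex.Re (partials s f x)) /\
        continuous (fun x => complex.Im (partials s f x)),
        forall i x, partial_derivable i (partials s f) x &
        forall alpha : 'I_n -> nat, exists M : R, forall x,
          normc ((monom alpha x)%:C * partials s f x) <= M].

(* No closure is taken: f vanishes outside E. *)
Definition supported_in f (E : set 'cV[R]_n) : Prop :=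
  forall x, f x != 0 -> E x.

Definition round_annulus (r s : R) : set 'cV[R]_n :=
  [set xi | r <= enorm xi <= s].

Definition punctured_cube : set 'cV[R]_n :=
  [set xi | (forall i, `|xi i 0| <= 2^-1) /\ xi != 0].

(* Unconditional convergence in L^2 of a family, i.e. convergence along the
   directed set of finite subfamilies. *)
Definition has_L2_sum (I : choiceType) (u : I -> 'cV[R]_n -> R[i]) g : Prop :=
  L2 g /\
  forall e : R, 0 < e -> exists F0 : {fset I}, forall F : {fset I},
    (F0 `<=` F)%fset ->
    (L2norm (fun x => (g x - \sum_(i <- F) u i x)%R) < e%:E)%E.

Definition ellipsoid (D : set 'cV[R]_n) : Prop :=
  exists2 P : 'M[R]_n, P \in unitmx & D = [set x | enorm (P *m x) < 1].

End Euclidean.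

(* The dimension is n.+1 so that integer powers A ^ j of square matrices are
   those of the ring 'M[R]_n.+1. *)
Section Dilation.
Context (R : realType) (n : nat).
Variable A : 'M[R]_n.+1.
Implicit Types (f g psi : 'cV[R]_n.+1 -> R[i]) (x : 'cV[R]_n.+1).

Definition eigenvalues : set R[i] :=
  [set mu | eigenvalue (map_mx (real_complex R) A) mu].

Definition expansive : Prop := forall mu, eigenvalues mu -> 1 < normc mu.

Definition absdet : R := `|\det A|.

(* The infimum is a minimum: the set is finite and nonempty. *)
Definition lambda_min : R := inf [set normc mu | mu in eigenvalues].

Definition moment_order (p : R) : int :=
  Num.floor ((p^-1 - 1) * (ln absdet / ln lambda_min)).

Definition dilation_ellipsoid (Delta : set 'cV[R]_n.+1) : Prop :=
  [/\ ellipsoid Delta,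
      lebesgue R n.+1 (@vec R n.+1 @^-1` Delta) = 1%E &
      exists t : R, [/\ 1 < t, Delta `<=` [set t *: y | y in Delta] &
        [set t *: y | y in Delta] `<=` [set A *m y | y in Delta]]].

Definition dball (Delta : set 'cV[R]_n.+1) (k : int) : set 'cV[R]_n.+1 :=
  [set A ^ k *m y | y in Delta].

(* For x != 0 the index k is unique, since the sets [dball Delta k] increase
   with k, shrink to 0 and exhaust the space. *)
Definition quasinorm (Delta : set 'cV[R]_n.+1) x : R :=
  if x == 0 then 0
  else absdet ^ xget 0 [set k : int | (dball Delta (k + 1) `\` dball Delta k) x].

Definition aniso_annulus (Delta : set 'cV[R]_n.+1) (r s : R) : set 'cV[R]_n.+1 :=
  [set xi | r <= quasinorm Delta xi <= s].

Definition vanishing_moments psi : Prop :=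
  forall p : R, 0 < p -> p <= 1 ->
  forall alpha : 'I_n.+1 -> nat, (\sum_i alpha i)%N%:Z <= moment_order p ->
    Cint (fun x => (monom alpha x)%:C * psi x) = 0.

Definition admissible (Delta : set 'cV[R]_n.+1) psi : Prop :=
  [/\ schwartz psi, vanishing_moments psi &
      exists rA RA : R, [/\ 0 < rA, rA < RA,
        aniso_annulus Delta rA RA `<=` @punctured_cube R n.+1 &
        supported_in (fourier psi) (aniso_annulus Delta rA RA)]].

Definition affine psi (j : int) (k : 'cV[int]_n.+1) x : R[i] :=
  (absdet `^ (j%:~R / 2))%:C * psi (A ^ j *m x - map_mx intr k).

Definition is_frame_image psi f g : Prop :=
  has_L2_sum (fun (jk : int * 'cV[int]_n.+1) x =>
    inner f (affine psi jk.1 jk.2) * affine psi jk.1 jk.2 x) g.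

(* The zero function is a dummy value, used when the series diverges. *)
Definition frame_op psi f : 'cV[R]_n.+1 -> R[i] :=
  xget (fun=> 0) [set g | is_frame_image psi f g].

End Dilation.

(* Main.v *)
Require Import Defs.
From HB Require Import structures.
From mathcomp Require Import all_boot all_order all_algebra finmap.
From mathcomp Require Import all_classical all_reals all_analysis.
From mathcomp Require Import measurable_realfun complex.
From mathcomp Require Import zify ring lra.
Import Order.TTheory GRing.Theory Num.Theory.
Import numFieldNormedType.Exports.
Import Normc.
Local Open Scope classical_set_scope.
Local Open Scope ring_scope.
Local Open Scope complex_scope.

(* Scale the eigenvector to xi with s < |xi| < r |lambda|. The points
   (A^T)^-j xi = lambda^-j xi, j in Z, all avoid the annulus r <= |.| <= s; since
   (A^T)^-1 is a contraction up to a constant, so do the images of the small cube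
   xi + delta [0, 1]^n, uniformly in j. As the Fourier transform of psi_{j,k} at
   eta is a multiple of that of psi at (A^T)^-j eta, it vanishes on this cube.
   Let D(x) be the integral of e(x . u) over u in [0, 1]^n. By Fubini the inner
   product of psi_{j,k} with the L^2 function e(x . xi) D(delta x) is an average of
   the Fourier transform of psi_{j,k} over the cube, so this function is orthogonal
   to the whole affine system.

   The frame series converges by the Schur test. Atoms at scales j, j' with
   |j - j'| large have disjoint spectra, hence are orthogonal; for the remaining
   finitely many scales the inner products are summed over the lattice, using
   |psi(x)| <= C prod_i 1 / (1 + x_i^2). *)

Set Implicit Arguments.
Unset Strict Implicit.
Unset Printing Implicit Defensive.

(** * Integration of complex-valued functions *)

(** Since [frame_op] returns a dummy value where the series has no L^2 sum, the infimum concerns the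
    actual series only once convergence is known for every f in L^2; the Schur test serves this
    purpose. The lower bound 0 then follows because <U f, f> is approximated by finite sums of |<f,
    psi_{j,k}>|^2, and the orthogonal function, normalized, attains it. Decay of psi alone does not
    make the Schur sums converge: summed over the lattice, the estimate for atoms d scales above a
    fixed one is of order b^(d/2), which grows with d. Band limitation is what cuts the sum to
    finitely many d, and the estimate depends on d only, not on the fixed scale, so the bound is
    uniform. Neither Fourier inversion nor Plancherel is invoked: Fourier integrals of integrable
    functions are the only ones evaluated, and the orthogonal function itself is never transformed.
    The kernel D is used twice, once to build that function and once, through |D|^2, to show that
    atoms with disjoint spectra are orthogonal. Constants are generous throughout, since only their
    finiteness and uniformity matter. *)

Section ComplexIntegral.
Context d (T : measurableType d) (R : realType).
Variable mu : {measure set T -> \bar R}.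
Implicit Types (f g : T -> R[i]).

Definition cmeas f := measurable_fun setT (fun t => complex.Re (f t)) /\
  measurable_fun setT (fun t => complex.Im (f t)).

Definition cintegrable f :=
  mu.-integrable setT (EFin \o (fun t => complex.Re (f t))) /\
  mu.-integrable setT (EFin \o (fun t => complex.Im (f t))).

Definition cint f : R[i] :=
  (\int[mu]_(t in setT) complex.Re (f t)) +i*
  (\int[mu]_(t in setT) complex.Im (f t)).

Lemma normcE2 (z : R[i]) : normc z ^+ 2 = complex.Re z ^+ 2 + complex.Im z ^+ 2.
Proof. by case: z => a b /=; rewrite sqr_sqrtr// addr_ge0 ?sqr_ge0. Qed.

Lemma normc_ge0 (z : R[i]) : 0 <= normc z.
Proof. by case: z => a b; exact: sqrtr_ge0. Qed.

Lemma le_Re_normc (z : R[i]) : `|complex.Re z| <= normc z.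
Proof.
rewrite -(ler_pXn2r (n := 2))// ?nnegrE ?normc_ge0// normcE2.
by rewrite real_normK ?num_real// lerDl sqr_ge0.
Qed.

Lemma le_Im_normc (z : R[i]) : `|complex.Im z| <= normc z.
Proof.
rewrite -(ler_pXn2r (n := 2))// ?nnegrE ?normc_ge0// normcE2.
by rewrite real_normK ?num_real// lerDr sqr_ge0.
Qed.

Lemma normc_le_ReIm (z : R[i]) : normc z <= `|complex.Re z| + `|complex.Im z|.
Proof.
rewrite -(ler_pXn2r (n := 2))// ?nnegrE ?normc_ge0 ?addr_ge0// normcE2.
rewrite sqrrD !real_normK ?num_real// lerD2r lerDl mulrn_wge0// mulr_ge0//.
Qed.

Lemma normc_conj (z : R[i]) : normc (conjc z) = normc z.
Proof. by case: z => a b /=; rewrite sqrrN. Qed.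

Lemma normc_real (x : R) : normc x%:C = `|x|.
Proof. by rewrite /= expr0n/= addr0 sqrtr_sqr. Qed.

Lemma Re_add (x y : R[i]) : complex.Re (x + y) = complex.Re x + complex.Re y.
Proof. by case: x y => [? ?] [? ?]. Qed.

Lemma Im_add (x y : R[i]) : complex.Im (x + y) = complex.Im x + complex.Im y.
Proof. by case: x y => [? ?] [? ?]. Qed.

Lemma Re_sub (x y : R[i]) : complex.Re (x - y) = complex.Re x - complex.Re y.
Proof. by case: x y => [? ?] [? ?]. Qed.

Lemma Im_sub (x y : R[i]) : complex.Im (x - y) = complex.Im x - complex.Im y.
Proof. by case: x y => [? ?] [? ?]. Qed.

Lemma Re_mul (x y : R[i]) : complex.Re (x * y) =
  complex.Re x * complex.Re y - complex.Im x * complex.Im y.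
Proof. by case: x y => [? ?] [? ?]. Qed.

Lemma Im_mul (x y : R[i]) : complex.Im (x * y) =
  complex.Re x * complex.Im y + complex.Im x * complex.Re y.
Proof. by case: x y => [? ?] [? ?]. Qed.

Lemma Re_conjc (x : R[i]) : complex.Re (conjc x) = complex.Re x.
Proof. by case: x. Qed.

Lemma Im_conjc (x : R[i]) : complex.Im (conjc x) = - complex.Im x.
Proof. by case: x. Qed.

Lemma complexP (x y : R[i]) : complex.Re x = complex.Re y ->
  complex.Im x = complex.Im y -> x = y.
Proof. by case: x y => [? ?] [? ?] /= -> ->. Qed.

Lemma cmeas_cst (c : R[i]) : cmeas (fun=> c).
Proof. by split; exact: measurable_cst. Qed.

Lemma cmeasD f g : cmeas f -> cmeas g -> cmeas (fun t => f t + g t).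
Proof.
move=> [f1 f2] [g1 g2]; split.
- under eq_fun do rewrite Re_add; exact: measurable_funD.
- under eq_fun do rewrite Im_add; exact: measurable_funD.
Qed.

Lemma cmeasM f g : cmeas f -> cmeas g -> cmeas (fun t => f t * g t).
Proof.
move=> [f1 f2] [g1 g2]; split.
- under eq_fun do rewrite Re_mul.
  by apply: measurable_funB; apply: measurable_funM.
- under eq_fun do rewrite Im_mul.
  by apply: measurable_funD; apply: measurable_funM.
Qed.

Lemma cmeasJ f : cmeas f -> cmeas (fun t => conjc (f t)).
Proof.
move=> [f1 f2]; split.
- by under eq_fun do rewrite Re_conjc.
- under eq_fun do rewrite Im_conjc.
  exact: measurableT_comp.
Qed.

Lemma cmeas_real (h : T -> R) : measurable_fun setT h ->
  cmeas (fun t => (h t)%:C).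
Proof. by move=> mh; split => //=; exact: measurable_cst. Qed.

Lemma cmeas_prod I (s : seq I) (F : I -> T -> R[i]) :
  (forall i, cmeas (F i)) -> cmeas (fun t => \prod_(i <- s) F i t).
Proof.
move=> mF; elim: s => [|i s ih].
  by under eq_fun do rewrite big_nil; exact: cmeas_cst.
by under eq_fun do rewrite big_cons; exact: cmeasM.
Qed.

Lemma measurable_normc f : cmeas f -> measurable_fun setT (fun t => normc (f t)).
Proof.
move=> [f1 f2].
rewrite (_ : (fun t => _) = (fun t => Num.sqrt (complex.Re (f t) ^+ 2 + complex.Im (f t) ^+ 2))).
  have ms : measurable_fun setT (@Num.sqrt R).
    by apply: continuous_measurable_fun; exact: sqrt_continuous.
  apply: (measurableT_comp ms).
  by apply: measurable_funD; apply: measurable_funX.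
by apply/funext => t; case: (f t).
Qed.

Lemma cintegrable_cmeas f : cintegrable f -> cmeas f.
Proof. by move=> [/measurable_int/measurable_EFinP ? /measurable_int/measurable_EFinP]. Qed.

Lemma cintegrable_le f (g : T -> R) : cmeas f ->
  (forall t, normc (f t) <= g t) -> mu.-integrable setT (EFin \o g) ->
  cintegrable f.
Proof.
move=> [f1 f2] fg ig; split; apply: le_integrable ig => //;
  try exact/measurable_EFinP.
- move=> t _ /=; rewrite lee_fin (le_trans (le_Re_normc _))//.
  by rewrite (le_trans (fg t))// ler_norm.
- move=> t _ /=; rewrite lee_fin (le_trans (le_Im_normc _))//.
  by rewrite (le_trans (fg t))// ler_norm.
Qed.

Lemma cintegrable_norm f : cintegrable f ->
  mu.-integrable setT (EFin \o (fun t => normc (f t))).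
Proof.
move=> fi; have [f1 f2] := fi.
have ms := integrableD measurableT (integrable_norm f1) (integrable_norm f2).
apply: le_integrable ms => //.
  exact/measurable_EFinP/measurable_normc/cintegrable_cmeas.
move=> t _ /=; rewrite lee_fin (ger0_norm (normc_ge0 _)).
by rewrite (le_trans (normc_le_ReIm _))// ler_norm.
Qed.

Lemma cintegrableP f : cmeas f ->
  (\int[mu]_t (normc (f t))%:E < +oo)%E -> cintegrable f.
Proof.
move=> mf foo; apply: (cintegrable_le (g := fun t => normc (f t))) => //.
apply/integrableP; split.
  exact/measurable_EFinP/measurable_normc.
by under eq_integral do rewrite gee0_abs ?lee_fin ?normc_ge0//.
Qed.

Lemma cintegrableD f g : cintegrable f -> cintegrable g ->
  cintegrable (fun t => f t + g t).
Proof.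
move=> [f1 f2] [g1 g2]; split.
- rewrite (_ : _ \o _ = (EFin \o (fun t => complex.Re (f t))) \+ (EFin \o (fun t => complex.Re (g t)))).
    exact: integrableD.
  by apply/funext => t /=; rewrite Re_add.
- rewrite (_ : _ \o _ = (EFin \o (fun t => complex.Im (f t))) \+ (EFin \o (fun t => complex.Im (g t)))).
    exact: integrableD.
  by apply/funext => t /=; rewrite Im_add.
Qed.

Lemma cintegrableMl f g (M : R) : cmeas f -> (forall t, normc (f t) <= M) ->
  cintegrable g -> cintegrable (fun t => f t * g t).
Proof.
move=> mf fM gi.
have := integrableZl measurableT M (cintegrable_norm gi) => /cintegrable_le; apply.
  by apply: cmeasM => //; exact: cintegrable_cmeas.
by move=> t /=; rewrite normcM ler_wpM2r ?normc_ge0.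
Qed.

Lemma cintegrableZ (c : R[i]) g : cintegrable g -> cintegrable (fun t => c * g t).
Proof.
by move=> gi; apply: (cintegrableMl (f := fun=> c) (M := normc c)) => //; exact: cmeas_cst.
Qed.

Lemma cintegrable_sum I (s : seq I) (F : I -> T -> R[i]) :
  (forall i, cintegrable (F i)) -> cintegrable (fun t => \sum_(i <- s) F i t).
Proof.
move=> iF; elim: s => [|i s ih].
  by under eq_fun do rewrite big_nil; split; exact: integrable0.
by under eq_fun do rewrite big_cons; exact: cintegrableD.
Qed.

Lemma cintD f g : cintegrable f -> cintegrable g ->
  cint (fun t => f t + g t) = cint f + cint g.
Proof.
move=> [f1 f2] [g1 g2]; apply: complexP => /=.
- under eq_Rintegral do rewrite Re_add; exact: RintegralD.
- under eq_Rintegral do rewrite Im_add; exact: RintegralD.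
Qed.

Lemma cintZ (c : R[i]) f : cintegrable f -> cint (fun t => c * f t) = c * cint f.
Proof.
have sc (h : T -> R) (a : R) : mu.-integrable setT (EFin \o h) ->
    mu.-integrable setT (EFin \o (fun t => a * h t)).
  by move=> ih; exact: (integrableZl measurableT a ih).
move=> [f1 f2]; apply: complexP; rewrite ?Re_mul ?Im_mul /=.
- under eq_Rintegral do rewrite Re_mul.
  by rewrite RintegralB// ?RintegralZl//; exact: sc.
- under eq_Rintegral do rewrite Im_mul.
  by rewrite RintegralD// ?RintegralZl//; exact: sc.
Qed.

Lemma cint0 : cint (fun=> 0) = 0.
Proof. by apply: complexP => /=; rewrite Rintegral_cst ?mul0r. Qed.

Lemma cint_sum I (s : seq I) (F : I -> T -> R[i]) :
  (forall i, cintegrable (F i)) ->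
  cint (fun t => \sum_(i <- s) F i t) = \sum_(i <- s) cint (F i).
Proof.
move=> iF; elim: s => [|i s ih].
  by under eq_fun do rewrite big_nil; rewrite cint0 big_nil.
under eq_fun do rewrite big_cons; rewrite cintD// ?ih ?big_cons//.
exact: cintegrable_sum.
Qed.

Lemma cintegrableJ f : cintegrable f -> cintegrable (fun t => conjc (f t)).
Proof.
move=> fi; apply: (cintegrable_le (g := fun t => normc (f t))) => //.
- exact/cmeasJ/cintegrable_cmeas.
- by move=> t; rewrite normc_conj.
- exact: cintegrable_norm.
Qed.

Lemma cintJ f : cintegrable f -> cint (fun t => conjc (f t)) = conjc (cint f).
Proof.
move=> [f1 f2]; apply: complexP => /=.
- by apply: eq_Rintegral => t _; case: (f t).
- rewrite -mulN1r -RintegralZl//; apply: eq_Rintegral => t _; case: (f t) => //= a b.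
  by rewrite mulN1r.
Qed.

(** The real and imaginary parts are bounded separately, which costs the factor 2. *)
Lemma normc_cint f : cintegrable f ->
  normc (cint f) <= 2 * \int[mu]_t normc (f t).
Proof.
move=> fi; have [f1 f2] := fi.
rewrite (le_trans (normc_le_ReIm _))//= mulr2n mulrDl mul1r lerD//.
- rewrite (le_trans (le_normr_Rintegral _ f1))// le_Rintegral//.
  + exact: integrable_norm f1.
  + exact: cintegrable_norm.
  + by move=> t _; exact: le_Re_normc.
- rewrite (le_trans (le_normr_Rintegral _ f2))// le_Rintegral//.
  + exact: integrable_norm f2.
  + exact: cintegrable_norm.
  + by move=> t _; exact: le_Im_normc.
Qed.

End ComplexIntegral.

Section ComplexFubini.
Context d1 d2 (T1 : measurableType d1) (T2 : measurableType d2) (R : realType).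
Variable m1 : {sigma_finite_measure set T1 -> \bar R}.
Variable m2 : {sigma_finite_measure set T2 -> \bar R}.

(** Integrability of every section, not just almost every one, makes the inner integrals finite
    everywhere. Hence [fine] loses nothing and the real-valued inner integrals coincide with
    [fubini_F] and [fubini_G]. *)
Lemma Rintegral_Fubini (f : T1 * T2 -> R) :
  (m1 \x m2)%E.-integrable setT (EFin \o f) ->
  (forall x, m2.-integrable setT (EFin \o (fun y => f (x, y)))) ->
  (forall y, m1.-integrable setT (EFin \o (fun x => f (x, y)))) ->
  [/\ m1.-integrable setT (EFin \o (fun x => \int[m2]_y f (x, y))),
      m2.-integrable setT (EFin \o (fun y => \int[m1]_x f (x, y))) &
      \int[m1]_x \int[m2]_y f (x, y) = \int[m2]_y \int[m1]_x f (x, y)].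
Proof.
move=> fi f1 f2.
have E1 : EFin \o (fun x => \int[m2]_y f (x, y)) = fubini_F m2 (EFin \o f).
  by apply/funext => x /=; rewrite /fubini_F /Rintegral fineK//; exact: (integrable_fin_num _ (f1 x)).
have E2 : EFin \o (fun y => \int[m1]_x f (x, y)) = fubini_G m1 (EFin \o f).
  by apply/funext => x /=; rewrite /fubini_G /Rintegral fineK//; exact: (integrable_fin_num _ (f2 x)).
split.
- by rewrite E1; exact: integrable_fubini_F.
- have mf := measurable_int _ fi.
  have mG := measurable_fubini_G fi.
  rewrite E2; apply/integrableP; split => //.
  have : (\int[m2]_y \int[m1]_x `|(EFin \o f) (x, y)| < +oo)%E by apply/integrable21ltyP.
  apply: le_lt_trans; apply: ge0_le_integral => //.
  + exact: measurableT_comp.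
  + apply: (@measurable_fun_fubini_tonelli_G _ _ _ _ _ m1 (abse \o (EFin \o f))) => //.
      exact: measurableT_comp.
    by move=> xy; exact: abse_ge0.
  + move=> y _; apply: le_abse_integral => //.
    exact: (measurable_int _ (f2 y)).
- rewrite /Rintegral; congr fine.
  transitivity (\int[m1]_x fubini_F m2 (EFin \o f) x)%E; first by rewrite -E1.
  transitivity (\int[m2]_x fubini_G m1 (EFin \o f) x)%E; last by rewrite -E2.
  exact: Fubini.
Qed.

Lemma cint_Fubini (F : T1 * T2 -> R[i]) : cmeas F ->
  (\int[m1]_x \int[m2]_y (normc (F (x, y)))%:E < +oo)%E ->
  (forall x, cintegrable m2 (fun y => F (x, y))) ->
  (forall y, cintegrable m1 (fun x => F (x, y))) ->
  [/\ cintegrable m1 (fun x => cint m2 (fun y => F (x, y))),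
      cintegrable m2 (fun y => cint m1 (fun x => F (x, y))) &
      cint m1 (fun x => cint m2 (fun y => F (x, y))) =
      cint m2 (fun y => cint m1 (fun x => F (x, y)))].
Proof.
move=> mF Foo F1 F2.
have Fi : cintegrable (m1 \x m2)%E F.
  apply: cintegrableP => //; rewrite fubini_tonelli1//.
  - exact/measurable_EFinP/measurable_normc.
  - by move=> xy; rewrite lee_fin normc_ge0.
have [a1 a2 a3] := Rintegral_Fubini Fi.1 (fun x => (F1 x).1) (fun x => (F2 x).1).
have [b1 b2 b3] := Rintegral_Fubini Fi.2 (fun x => (F1 x).2) (fun x => (F2 x).2).
by split => //; apply: complexP.
Qed.

End ComplexFubini.

(** * Completeness of L^2 and the Schur test *)

Section RieszFischerReal.
Context d (T : measurableType d) (R : realType).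
Variable mu : {measure set T -> \bar R}.

(** The increments are at most sqrt M / 2^k, so the telescoping series converges absolutely. *)
Lemma cvgn_sq_geometric (v : nat -> R) (M : R) :
  (forall k, 4 ^+ k * (v k.+1 - v k) ^+ 2 <= M) -> cvgn v.
Proof.
move=> vM.
have w k : `|v k.+1 - v k| <= geometric (Num.sqrt M) 2^-1 k.
  rewrite /geometric/= exprVn ler_pdivlMr ?exprn_gt0//.
  rewrite -[leLHS]ger0_norm ?mulr_ge0// -sqrtr_sqr ler_wsqrtr//.
  rewrite exprMn real_normK ?num_real// mulrC -exprM mulnC exprM.
  by rewrite (_ : 2 ^+ 2 = 4 :> R) ?vM//; ring.
have : cvgn (series (telescope v)).
  apply: normed_cvg; apply: series_le_cvg w _ => //.
    by move=> n; rewrite /geometric/= mulr_ge0// ?sqrtr_ge0// exprn_ge0.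
  by apply: is_cvg_geometric_series; rewrite ger0_norm// invf_lt1// ltr1n.
rewrite telescopeK => /(is_cvgD (is_cvg_cst (v 0%N))).
by rewrite (_ : _ + _ = v)//; apply/funext => n /=; rewrite fctE subrKC.
Qed.

Lemma riesz_fischer_real (u : nat -> T -> R) :
  (forall m, measurable_fun setT (u m)) ->
  (forall e, 0 < e -> exists N, forall m l, (N <= m)%N -> (N <= l)%N ->
    (\int[mu]_t ((u m t - u l t) ^+ 2)%:E <= e%:E)%E) ->
  exists2 g : T -> R, measurable_fun setT g &
    forall e, 0 < e -> exists N, forall m, (N <= m)%N ->
    (\int[mu]_t ((g t - u m t) ^+ 2)%:E <= e%:E)%E.
Proof.
move=> mu_ cau.
have : forall k : nat, exists N, forall m l, (N <= m)%N -> (N <= l)%N ->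
    (\int[mu]_t ((u m t - u l t) ^+ 2)%:E <= (8 ^- k)%:E)%E.
  by move=> k; apply: cau; rewrite invr_gt0 exprn_gt0.
move=> /choice[N NP].
(* Partial sums put both [phi k] and [phi k.+1] beyond [N k]; the summand k makes [phi] tend to
   infinity. *)
pose phi k := (k + \sum_(i < k.+1) N i)%N.
have phiN k : (N k <= phi k)%N.
  by rewrite /phi big_ord_recr/= addnA leq_addl.
have phiS k : (N k <= phi k.+1)%N.
  by rewrite /phi big_ord_recr/= big_ord_recr/=; lia.
have phi_ge k : (k <= phi k)%N by rewrite leq_addr.
pose v k := u (phi k).
have mv k : measurable_fun setT (v k) by exact: mu_.
have msq (f g : T -> R) : measurable_fun setT f -> measurable_fun setT g ->
    measurable_fun setT (fun t => ((f t - g t) ^+ 2)%:E).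
  by move=> mf mg; apply/measurable_EFinP/measurable_funX/measurable_funB.
(* By the choice of [N], [\int S <= \sum_k 4 ^ k / 8 ^ k]; so [S] is finite
   almost everywhere, and there [v] converges geometrically. *)
pose a k t := ((4 ^+ k)%:E * ((v k.+1 t - v k t) ^+ 2)%:E)%E.
have a0 k t : (0 <= a k t)%E by rewrite mule_ge0// lee_fin ?sqr_ge0// exprn_ge0.
have ma k : measurable_fun setT (a k) by apply: measurable_funeM; exact: msq.
pose S t := (\big[+%E/0%E]_(0 <= k <oo) a k t)%E.
have S0 t : (0 <= S t)%E by apply: nneseries_ge0 => k _ _; exact: a0.
have Sfin : mu.-integrable setT S.
  apply/integrableP; split; first exact: ge0_emeasurable_sum.
  under eq_integral do rewrite gee0_abs//.
  rewrite integral_nneseries//.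
  apply: le_lt_trans (ltry 2).
  have h2 : (0 : R) <= 2 by [].
  apply: le_trans (epsilon_trick0 xpredT h2).
  apply: lee_nneseries => [k _ _|k _].
    by apply: integral_ge0 => t _; exact: a0.
  rewrite ge0_integralZl//; [|exact: msq|by move=> t _; rewrite lee_fin sqr_ge0].
  rewrite (le_trans (lee_wpmul2l _ (NP k _ _ _ _)))//.
  rewrite -EFinM lee_fin natrX exprS invfM mulrA divff// mul1r.
  by rewrite -exprVn -exprVn -exprMn (_ : 4 / 8 = 2^-1)//; lra.
(* The upper limit is defined and measurable everywhere, including on the null set where [v] may
   diverge. *)
pose g t := fine (limn_esup (fun k => (v k t)%:E)).
have mg : measurable_fun setT g.
  apply: (measurableT_comp (fine_measurable measurableT)).
  by apply: measurable_fun_limn_esup => k; exact/measurable_EFinP.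
exists g => //.
have vg : {ae mu, forall t, (fun k => v k t) @ \oo --> g t}.
  have := integrable_ae measurableT Sfin; apply: filterS => t /(_ I) St.
  have vc : cvgn (fun k => v k t).
    apply: (@cvgn_sq_geometric _ (fine (S t))) => k.
    rewrite -lee_fin fineK//.
    apply: le_trans (nneseries_lim_ge k.+1 _); last by move=> n _ _; exact: a0.
    rewrite EFinM big_nat_recr//= leeDr//.
    by apply: sume_ge0 => i _; exact: a0.
  have : (fun k => (v k t)%:E) @ \oo --> (limn (fun k => v k t))%:E.
    by apply: cvg_EFin => //; exact: nearW.
  by rewrite /g => /cvg_limn_einf_sup[_ ->].
move=> e e0; have [K KP] := cau _ e0.
exists K => m Km.
have vm k : (\int[mu]_t ((v (k + K)%N t - u m t) ^+ 2)%:E <= e%:E)%E.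
  by apply: KP => //; rewrite (leq_trans _ (phi_ge _))// leq_addl.
(* Fatou is applied to the subsequence shifted by K: all its indices are at least K, so each
   integral is at most e by the Cauchy property. *)
have <- : (\int[mu]_t limn_einf (fun k => ((v (k + K)%N t - u m t) ^+ 2)%:E) =
   \int[mu]_t ((g t - u m t) ^+ 2)%:E)%E.
  apply: ae_eq_integral => //.
  - rewrite (_ : (fun t => _) = (fun t => - limn_esup (fun k => - ((v (k + K)%N t - u m t) ^+ 2)%:E))%E).
      apply: measurableT_comp => //; apply: measurable_fun_limn_esup => k.
      by apply: measurableT_comp => //; exact: msq.
    by apply/funext => t; rewrite limn_esupN oppeK.
  - exact: msq.
  - apply: filterS vg => t vgt _.
    have wc : (fun k => v (k + K)%N t - u m t) @ \oo --> g t - u m t.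
      by apply: cvgB; [rewrite (cvg_shiftn K (fun k => v k t))|exact: cvg_cst].
    have /cvg_limn_einf_sup[->]// :
        (fun k => ((v (k + K)%N t - u m t) ^+ 2)%:E) @ \oo --> ((g t - u m t) ^+ 2)%:E.
    by apply: cvg_EFin; [exact: nearW|exact: (cvgM wc wc)].
apply: le_trans (fatou _ _ _ _) _ => //.
- by move=> k; exact: msq.
- by move=> k t _; rewrite lee_fin sqr_ge0.
rewrite limn_einf_lim; apply: lime_le; first exact: is_cvg_einfs.
apply: nearW => k; apply: ge_ereal_inf; exists (\int[mu]_t ((v (k + K)%N t - u m t) ^+ 2)%:E)%E => //.
by exists k => /=.
Qed.

End RieszFischerReal.

Section ComplexL2.
Context d (T : measurableType d) (R : realType).
Variable mu : {measure set T -> \bar R}.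
Implicit Types (f g : T -> R[i]).

Definition cL2 f := cmeas f /\
  mu.-integrable setT (EFin \o (fun t => normc (f t) ^+ 2)).

Definition sqnorm f : R := \int[mu]_t normc (f t) ^+ 2.

Definition ip f g : R[i] := cint mu (fun t => f t * conjc (g t)).

Lemma sqnorm_ge0 f : 0 <= sqnorm f.
Proof. by apply: Rintegral_ge0 => t _; rewrite sqr_ge0. Qed.

Lemma cL2_le f (h : T -> R) : cmeas f -> (forall t, normc (f t) ^+ 2 <= h t) ->
  mu.-integrable setT (EFin \o h) -> cL2 f.
Proof.
move=> mf fh ih; split => //; apply: le_integrable ih => //.
  exact/measurable_EFinP/measurable_funX/measurable_normc.
by move=> t _ /=; rewrite lee_fin ger0_norm ?sqr_ge0// (le_trans (fh t))// ler_norm.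
Qed.

Lemma normcD_sq (a b : R[i]) :
  normc (a + b) ^+ 2 <= 2 * (normc a ^+ 2 + normc b ^+ 2).
Proof.
rewrite (@le_trans _ _ ((normc a + normc b) ^+ 2))//.
  by rewrite ler_pXn2r ?nnegrE ?addr_ge0 ?normc_ge0// le_normcD.
by have := sqr_ge0 (normc a - normc b); nra.
Qed.

Lemma integrable_sqD f g : cL2 f -> cL2 g ->
  mu.-integrable setT
    (EFin \o (fun t => 2 * (normc (f t) ^+ 2 + normc (g t) ^+ 2))).
Proof.
by move=> [_ f2] [_ g2]; exact: (integrableZl measurableT 2 (integrableD measurableT f2 g2)).
Qed.

Lemma cL2D f g : cL2 f -> cL2 g -> cL2 (fun t => f t + g t).
Proof.
move=> Lf Lg; apply: cL2_le (integrable_sqD Lf Lg).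
  by apply: cmeasD; [case: Lf|case: Lg].
by move=> t; exact: normcD_sq.
Qed.

Lemma cL2Z (c : R[i]) f : cL2 f -> cL2 (fun t => c * f t).
Proof.
move=> [mf f2]; split; first by apply: cmeasM => //; exact: cmeas_cst.
have := integrableZl measurableT (normc c ^+ 2) f2; congr (mu.-integrable _ _).
by apply/funext => t /=; rewrite normcM exprMn.
Qed.

Lemma cL20 : cL2 (fun=> 0).
Proof.
split; first exact: cmeas_cst.
rewrite (_ : _ \o _ = cst 0%E); first exact: integrable0.
by apply/funext => t; rewrite /comp normcE2 /= expr0n/= addr0.
Qed.

Lemma cL2_sum I (s : seq I) (F : I -> T -> R[i]) :
  (forall i, cL2 (F i)) -> cL2 (fun t => \sum_(i <- s) F i t).
Proof.
move=> LF; elim: s => [|i s ih].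
  by under eq_fun do rewrite big_nil; exact: cL20.
by under eq_fun do rewrite big_cons; exact: cL2D.
Qed.

Lemma cL2B f g : cL2 f -> cL2 g -> cL2 (fun t => f t - g t).
Proof.
move=> Lf Lg; under eq_fun do rewrite -mulN1r.
by apply: cL2D => //; exact: cL2Z.
Qed.

Lemma sqnormD f g : cL2 f -> cL2 g ->
  sqnorm (fun t => f t + g t) <= 2 * (sqnorm f + sqnorm g).
Proof.
move=> Lf Lg; rewrite /sqnorm.
have [_ f2] := Lf; have [_ g2] := Lg; have [_ fg2] := cL2D Lf Lg.
rewrite -RintegralD// -RintegralZl//; last exact: (integrableD measurableT f2 g2).
by apply: le_Rintegral => //; [exact: integrable_sqD|move=> t _; exact: normcD_sq].
Qed.

Lemma cL2_mulJ f g : cL2 f -> cL2 g -> cintegrable mu (fun t => f t * conjc (g t)).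
Proof.
move=> Lf Lg; apply: cintegrable_le (integrable_sqD Lf Lg).
  by apply: cmeasM; [case: Lf|apply: cmeasJ; case: Lg].
move=> t; rewrite normcM normc_conj.
by have := sqr_ge0 (normc (f t) - normc (g t)); have := normc_ge0 (f t);
  have := normc_ge0 (g t); nra.
Qed.

(** Cauchy-Schwarz in additive form, from 2 x y <= a x^2 + y^2 / a; this 2 absorbs the factor in
    [normc_cint]. The free parameter [a] replaces square roots of norms: it is tuned at each use. *)
Lemma normc_ip f g (a : R) : 0 < a -> cL2 f -> cL2 g ->
  normc (ip f g) <= a * sqnorm f + a^-1 * sqnorm g.
Proof.
move=> a0 Lf Lg; have [_ f2] := Lf; have [_ g2] := Lg.
apply: (le_trans (normc_cint (cL2_mulJ Lf Lg))).
rewrite /sqnorm -!RintegralZl//; last first.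
  exact/cintegrable_norm/cL2_mulJ.
have af := integrableZl measurableT a f2.
have ag := integrableZl measurableT a^-1 g2.
rewrite -RintegralD//; apply: le_Rintegral => //.
- by have := integrableZl measurableT 2 (cintegrable_norm (cL2_mulJ Lf Lg)).
- exact: (integrableD measurableT af ag).
move=> t _; rewrite normcM normc_conj.
have -> : a * normc (f t) ^+ 2 + a^-1 * normc (g t) ^+ 2 =
    2 * (normc (f t) * normc (g t)) + a * (normc (f t) - a^-1 * normc (g t)) ^+ 2.
  by field; rewrite gt_eqF.
by rewrite lerDl mulr_ge0 ?sqr_ge0// ltW.
Qed.

Lemma ip_sqnorm f : ip f f = (sqnorm f)%:C.
Proof.
apply: complexP => /=.
- apply: eq_Rintegral => t _; rewrite normcE2.
  by case: (f t) => x y /=; ring.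
- under eq_Rintegral => t _.
    rewrite (_ : complex.Im _ = 0); last by case: (f t) => x y /=; ring.
  over.
  by rewrite Rintegral_cst// mul0r.
Qed.

Lemma ipC f g : cL2 f -> cL2 g -> ip g f = conjc (ip f g).
Proof.
move=> Lf Lg; rewrite /ip -cintJ; last exact: cL2_mulJ.
by congr cint; apply/funext => t; rewrite rmorphM/= conjcK mulrC.
Qed.

Lemma ip_suml I (s : seq I) (c : I -> R[i]) (F : I -> T -> R[i]) g :
  (forall i, cL2 (F i)) -> cL2 g ->
  ip (fun t => \sum_(i <- s) c i * F i t) g = \sum_(i <- s) c i * ip (F i) g.
Proof.
move=> LF Lg; rewrite /ip.
rewrite (_ : (fun t => _) = fun t => \sum_(i <- s) c i * (F i t * conjc (g t))).
  rewrite cint_sum => [|i]; last exact/cintegrableZ/cL2_mulJ.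
  by apply: eq_bigr => i _; rewrite cintZ//; exact: cL2_mulJ.
by apply/funext => t; rewrite big_distrl/=; apply: eq_bigr => i _; rewrite mulrA.
Qed.

Lemma ip_sumr I (s : seq I) (c : I -> R[i]) (F : I -> T -> R[i]) g :
  (forall i, cL2 (F i)) -> cL2 g ->
  ip g (fun t => \sum_(i <- s) c i * F i t) = \sum_(i <- s) conjc (c i) * ip g (F i).
Proof.
move=> LF Lg; rewrite ipC// ?ip_suml//; last by apply: cL2_sum => i; exact: cL2Z.
by rewrite rmorph_sum/=; apply: eq_bigr => i _; rewrite rmorphM/= [ip g _]ipC.
Qed.

Lemma ipBl f g h : cL2 f -> cL2 g -> cL2 h ->
  ip (fun t => f t - g t) h = ip f h - ip g h.
Proof.
move=> Lf Lg Lh; rewrite /ip -mulN1r -cintZ; last exact: cL2_mulJ.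
rewrite -cintD; [|exact: cL2_mulJ|exact/cintegrableZ/cL2_mulJ].
by congr cint; apply/funext => t; rewrite mulrBl mulN1r.
Qed.

Lemma riesz_fischer (S : nat -> T -> R[i]) : (forall m, cL2 (S m)) ->
  (forall e, 0 < e -> exists N, forall m l, (N <= m)%N -> (N <= l)%N ->
    sqnorm (fun t => S m t - S l t) <= e) ->
  exists2 g, cL2 g & forall e, 0 < e -> exists N, forall m, (N <= m)%N ->
    sqnorm (fun t => g t - S m t) <= e.
Proof.
move=> LS cau.
have intE f : cL2 f -> (\int[mu]_t (normc (f t) ^+ 2)%:E = (sqnorm f)%:E)%E.
  by move=> [_ f2]; rewrite /sqnorm /Rintegral fineK//; exact: (integrable_fin_num _ f2).
(* Here [p] stands for the real or the imaginary part: being additive and bounded by the modulus, it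
   carries Cauchy sequences to Cauchy sequences. *)
have part (p : R[i] -> R) : (forall f, cmeas f -> measurable_fun setT (fun t => p (f t))) ->
    (forall a b, p (a - b) = p a - p b) -> (forall z, p z ^+ 2 <= normc z ^+ 2) ->
    exists2 h : T -> R, measurable_fun setT h &
      forall e, 0 < e -> exists N, forall m, (N <= m)%N ->
      (\int[mu]_t ((h t - p (S m t)) ^+ 2)%:E <= e%:E)%E.
  move=> mp pB pn; apply: (@riesz_fischer_real _ _ _ mu (fun m t => p (S m t))).
    by move=> m; apply: mp; case: (LS m).
  move=> e /cau[N NP]; exists N => m l Nm Nl.
  have LB := cL2B (LS m) (LS l).
  rewrite (@le_trans _ _ (sqnorm (fun t => S m t - S l t))%:E)//; last first.
    by rewrite lee_fin NP.
  rewrite -intE//; apply: ge0_le_integral => //.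
  - by move=> t _; rewrite lee_fin sqr_ge0.
  - apply/measurable_EFinP; under eq_fun do rewrite -pB.
    by apply: measurable_funX; apply: mp; case: LB.
  - by case: LB => _ /measurable_int.
  - by move=> t _; rewrite lee_fin -pB pn.
have [a ma aS] := part (@complex.Re R) (fun f mf => mf.1) (@Re_sub R)
  (fun z => ltac:(by rewrite normcE2 lerDl sqr_ge0)).
have [b mb bS] := part (@complex.Im R) (fun f mf => mf.2) (@Im_sub R)
  (fun z => ltac:(by rewrite normcE2 lerDr sqr_ge0)).
pose g t := (a t +i* b t).
have mg : cmeas g by [].
have gS e : 0 < e -> exists N, forall m, (N <= m)%N ->
    (\int[mu]_t (normc (g t - S m t) ^+ 2)%:E <= e%:E)%E.
  move=> e0; have e20 : 0 < e / 2 by rewrite divr_gt0.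
  have [N1 N1P] := aS _ e20; have [N2 N2P] := bS _ e20.
  exists (maxn N1 N2) => m; rewrite geq_max => /andP[/N1P h1 /N2P h2].
  have [mS1 mS2] := (LS m).1.
  rewrite [X in X%:E]splitr EFinD; apply: le_trans (leeD h1 h2).
  rewrite -ge0_integralD//.
  - rewrite le_eqVlt; apply/orP; left; apply/eqP; apply: eq_integral => t _.
    by rewrite normcE2 -EFinD; case: (S m t).
  - by move=> t _; rewrite lee_fin sqr_ge0.
  - exact/measurable_EFinP/measurable_funX/measurable_funB.
  - by move=> t _; rewrite lee_fin sqr_ge0.
  - exact/measurable_EFinP/measurable_funX/measurable_funB.
have gSL m e : (\int[mu]_t (normc (g t - S m t) ^+ 2)%:E <= e%:E)%E ->
    cL2 (fun t => g t - S m t).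
  move=> le; have mgS : cmeas (fun t => g t - S m t).
    under eq_fun do rewrite -mulN1r.
    by apply: cmeasD => //; apply: cmeasM; [exact: cmeas_cst|case: (LS m)].
  split => //; apply/integrableP; split.
    exact/measurable_EFinP/measurable_funX/measurable_normc.
  by under eq_integral do rewrite gee0_abs ?lee_fin ?sqr_ge0//;
    rewrite (le_lt_trans le)// ltry.
exists g.
  have [N /(_ N (leqnn N)) /gSL L] := gS 1 ltr01.
  by have := cL2D L (LS N); under eq_fun do rewrite subrK.
move=> e /gS[N NP]; exists N => m /NP h; rewrite -lee_fin -intE//.
exact: gSL h.
Qed.

End ComplexL2.

Lemma normc_sum (R : realType) I (s : seq I) (F : I -> R[i]) :
  normc (\sum_(i <- s) F i) <= \sum_(i <- s) normc (F i).
Proof.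
elim: s => [|i s ih]; first by rewrite !big_nil normc0.
by rewrite !big_cons (le_trans (le_normcD _ _))// lerD2l.
Qed.

Lemma mulJ_normc (R : realType) (z : R[i]) : conjc z * z = (normc z ^+ 2)%:C.
Proof. by rewrite normcE2; apply: complexP; case: z => x y /=; ring. Qed.

Section SchurTest.
Context d (T : measurableType d) (R : realType).
Variable mu : {measure set T -> \bar R}.
Context (I : choiceType) (u : I -> T -> R[i]) (C : R).
Hypothesis C0 : 0 < C.
Hypothesis uL : forall i, cL2 mu (u i).
Hypothesis schur : forall i (F : seq I), uniq F ->
  \sum_(k <- F) normc (ip mu (u k) (u i)) <= C.
Implicit Types (F : seq I) (f : T -> R[i]).

Let synth F (c : I -> R[i]) t := \sum_(i <- F) c i * u i t.

Let LS F c : cL2 mu (synth F c).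
Proof. by apply: cL2_sum => i; exact: cL2Z. Qed.

(** Each term c_i c_k G_ik of the Gram form is at most (|c_i|^2 + |c_k|^2) |G_ik| / 2 in modulus.
    Since |G_ik| = |G_ki|, the row bound [schur] controls both halves. *)
Lemma sqnorm_synthesis F (c : I -> R[i]) : uniq F ->
  sqnorm mu (fun t => \sum_(i <- F) c i * u i t) <=
  C * \sum_(i <- F) normc (c i) ^+ 2.
Proof.
move=> uF; set S := (X in sqnorm _ X).
have -> : sqnorm mu S = normc (ip mu S S).
  by rewrite ip_sqnorm normc_real ger0_norm// sqnorm_ge0.
have symi i k : normc (ip mu (u i) (u k)) = normc (ip mu (u k) (u i)).
  by rewrite (ipC (uL i))// normc_conj.
rewrite ip_suml//; last exact: LS.
rewrite (@le_trans _ _ (\sum_(i <- F) \sum_(k <- F)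
    (2^-1 * (normc (c i) ^+ 2 * normc (ip mu (u k) (u i))) +
     2^-1 * (normc (c k) ^+ 2 * normc (ip mu (u i) (u k))))))//.
  rewrite (le_trans (normc_sum _ _))//; apply: ler_sum => i _.
  rewrite ip_sumr// mulr_sumr (le_trans (normc_sum _ _))//; apply: ler_sum => k _.
  rewrite !normcM normc_conj (symi k).
  have := sqr_ge0 (normc (c i) - normc (c k)).
  by have := normc_ge0 (ip mu (u i) (u k)); nra.
have half : \sum_(i <- F) \sum_(k <- F)
    2^-1 * (normc (c i) ^+ 2 * normc (ip mu (u k) (u i))) <=
    2^-1 * (C * \sum_(i <- F) normc (c i) ^+ 2).
  rewrite !mulr_sumr; apply: ler_sum => i _.
  rewrite -!mulr_sumr ler_wpM2l// mulrC ler_wpM2r ?sqr_ge0//.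
  exact: schur.
under eq_bigr do rewrite big_split/=.
rewrite big_split/= [X in _ + X]exchange_big/=.
by rewrite [leRHS]splitr (mulrC _ 2^-1) lerD.
Qed.

(** Duality: the sum s equals the inner product of f with its own synthesis, which is at most 2 C
    |f|^2 + s / 2 by [normc_ip] with parameter 2 C and [sqnorm_synthesis]. Absorbing s / 2 gives the
    constant 4 C. *)
Lemma bessel f F : cL2 mu f -> uniq F ->
  \sum_(i <- F) normc (ip mu f (u i)) ^+ 2 <= 4 * C * sqnorm mu f.
Proof.
move=> Lf uF; pose c i := ip mu f (u i).
set s := \sum_(i <- F) _.
have s0 : 0 <= s by apply: sumr_ge0 => i _; rewrite sqr_ge0.
have E : ip mu f (synth F c) = s%:C.
  rewrite /synth ip_sumr// /s rmorph_sum; apply: eq_bigr => i _.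
  exact: mulJ_normc.
have C20 : 0 < 2 * C by rewrite mulr_gt0.
have := normc_ip C20 Lf (LS F c).
rewrite E normc_real ger0_norm//.
have := sqnorm_synthesis c uF; rewrite -/s.
rewrite -(ler_pM2l (x := (2 * C)^-1)) ?invr_gt0//.
have -> : (2 * C)^-1 * (C * s) = s / 2 by field; rewrite gt_eqF.
rewrite -/(synth F c); lra.
Qed.

(** By [bessel] the sums [s F] have a finite supremum B. If [Fm m] comes within 1 / (m + 1) of B,
    any larger family adds at most C / (m + 1) to the synthesis in squared norm. This makes the
    sequence along [Fm] Cauchy and its limit a limit along all finite families. *)
Lemma frame_series_cvg f : cL2 mu f -> exists2 g, cL2 mu g &
  forall e, 0 < e -> exists F0 : {fset I}, forall F : {fset I},
    (F0 `<=` F)%fset ->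
    sqnorm mu (fun t => g t - \sum_(i <- F) ip mu f (u i) * u i t) <= e.
Proof.
move=> Lf; pose c i := ip mu f (u i).
pose s (F : {fset I}) := \sum_(i <- F) normc (c i) ^+ 2.
have splitF (V : nmodType) (h : I -> V) (F0 F : {fset I}) : (F0 `<=` F)%fset ->
    \sum_(i <- F) h i = \sum_(i <- F0) h i + \sum_(i <- (F `\` F0)%fset) h i.
  move=> F0F; rewrite -big_cat; apply/perm_big/uniq_perm => //=.
    rewrite cat_uniq !fset_uniq/= andbT; apply/hasPn => x.
    by rewrite inE => /andP[].
  move=> x; rewrite mem_cat inE; have [xF0|]//= := boolP (x \in F0).
  by rewrite (fsubsetP F0F).
have stepS (F0 F : {fset I}) : (F0 `<=` F)%fset ->
    sqnorm mu (fun t => synth F c t - synth F0 c t) <= C * (s F - s F0).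
  move=> F0F.
  rewrite /s (splitF _ _ _ _ F0F) addrC addKr.
  rewrite (_ : (fun t => _) = synth (F `\` F0)%fset c); first exact: sqnorm_synthesis.
  by apply/funext => t; rewrite /synth (splitF _ _ _ _ F0F) addrC addKr.
pose E := [set s F | F in [set: {fset I}]].
have supE : has_sup E.
  split; first by exists (s fset0), fset0.
  exists (4 * C * sqnorm mu f) => _ [F _ <-]; exact: bessel.
pose B := sup E.
have sB (F : {fset I}) : s F <= B by apply: ub_le_sup; [case: supE|exists F].
have /choice[Fm FmP] : forall m : nat, exists F : {fset I}, B - m.+1%:R^-1 < s F.
  move=> m; have m0 : 0 < m.+1%:R^-1 :> R by rewrite invr_gt0.
  by have [_ [F _ <-]] := sup_adherent m0 supE; exists F.
(* Introduced through an existential, [q] stays opaque and [q m] is an atom for [lra]. *)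
have [q qE] : exists q : nat -> R, forall m, q m = C / m.+1%:R by eexists.
have dist m (F : {fset I}) : (Fm m `<=` F)%fset ->
    sqnorm mu (fun t => synth F c t - synth (Fm m) c t) <= q m.
  move=> /stepS/le_trans; apply; rewrite qE ler_pM2l//.
  by rewrite lerBlDl (le_trans (sB F))// -lerBlDr ltW.
have distC m (F : {fset I}) : (Fm m `<=` F)%fset ->
    sqnorm mu (fun t => synth (Fm m) c t - synth F c t) <= q m.
  move=> /dist; congr (_ <= _); apply: eq_Rintegral => t _.
  by rewrite -normcN opprB.
have tri f1 f2 f3 : cL2 mu f1 -> cL2 mu f2 -> cL2 mu f3 ->
    sqnorm mu (fun t => f1 t - f3 t) <=
    2 * (sqnorm mu (fun t => f1 t - f2 t) + sqnorm mu (fun t => f2 t - f3 t)).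
  move=> L1 L2 L3; have := sqnormD (cL2B L1 L2) (cL2B L2 L3).
  by under [X in sqnorm mu X <= _ -> _]eq_fun do rewrite addrA subrK.
have small e : 0 < e -> exists N, forall m, (N <= m)%N -> 4 * q m <= e.
  move=> e0; have e4 : 0 < e / (4 * C) by rewrite divr_gt0// mulr_gt0.
  have [N NP] := ltr_add_invr (y := 0) e4.
  exists N => m Nm; rewrite qE -lter_pdivlMl//.
  have : m.+1%:R^-1 <= N.+1%:R^-1 :> R by rewrite lef_pV2 ?posrE// ler_nat.
  move: NP; rewrite add0r => NP /le_lt_trans /(_ NP) /ltW.
  rewrite -(ler_pM2l C0) => /le_trans; apply.
  by rewrite le_eqVlt; apply/orP; left; apply/eqP; field; rewrite gt_eqF.
have [g Lg gS] : exists2 g, cL2 mu g & forall e, 0 < e -> exists N, forall m, (N <= m)%N ->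
    sqnorm mu (fun t => g t - synth (Fm m) c t) <= e.
  apply: riesz_fischer => [m|e /small[N NP]]; first exact: LS.
  exists N => m l Nm Nl.
  (* The families [Fm m] and [Fm l] need not be nested, so both are compared with their union. *)
  have := tri _ _ _ (LS (Fm m) c) (LS (Fm m `|` Fm l)%fset c) (LS (Fm l) c).
  have := distC m (Fm m `|` Fm l)%fset (fsubsetUl _ _).
  have := dist l (Fm m `|` Fm l)%fset (fsubsetUr _ _).
  by have := NP m Nm; have := NP l Nl; lra.
exists g => // e e0; have [N1 N1P] := small _ e0.
have e4 : 0 < e / 4 by rewrite divr_gt0.
have [N2 N2P] := gS _ e4.
exists (Fm (maxn N1 N2)) => F /distC h.
have := tri _ _ _ Lg (LS (Fm (maxn N1 N2)) c) (LS F c).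
have := N1P _ (leq_maxl N1 N2); have := N2P _ (leq_maxr N1 N2).
by move: h; rewrite /synth/c; lra.
Qed.

End SchurTest.

(** * Affine changes of variables *)

Section Scaling.
Context d (T : measurableType d) (R : realType).
Variable mu : {measure set T -> \bar R}.

(** Change of variables, phrased by integrals of nonnegative functions instead of measures of
    preimages: in this form it composes and combines with Tonelli directly. *)
Definition scales_by (phi : T -> T) (k : R) := measurable_fun setT phi /\
  forall F : T -> \bar R, measurable_fun setT F -> (forall t, (0 <= F t)%E) ->
    (\int[mu]_t F (phi t) = k%:E * \int[mu]_t F t)%E.

Lemma scales_by_comp phi1 phi2 k1 k2 :
  scales_by phi1 k1 -> scales_by phi2 k2 -> scales_by (phi1 \o phi2) (k1 * k2).
Proof.
move=> [m1 h1] [m2 h2]; split; first exact: measurableT_comp.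
move=> F mF F0; rewrite /= (h2 (F \o phi1)); [|exact: (measurableT_comp mF m1)|by move=> t; exact: F0].
by rewrite (h1 F)// muleA -EFinM mulrC.
Qed.

Lemma scales_by_integrable phi k (f : T -> R) : scales_by phi k ->
  mu.-integrable setT (EFin \o f) -> mu.-integrable setT (EFin \o (f \o phi)).
Proof.
move=> [mphi h] /integrableP[mf foo]; apply/integrableP; split.
  exact: (measurableT_comp mf).
rewrite (h (fun t => `|(f t)%:E|)%E)//; last exact: measurableT_comp.
move: foo; rewrite -ge0_fin_numE ?integral_ge0// => ffin.
rewrite -(fineK ffin) -EFinM; exact: ltry.
Qed.

Lemma scales_by_Rintegral phi k (f : T -> R) : scales_by phi k ->
  mu.-integrable setT (EFin \o f) ->
  \int[mu]_t f (phi t) = k * \int[mu]_t f t.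
Proof.
move=> sc fi; have [mphi h] := sc.
have mf := measurable_int _ fi.
rewrite /Rintegral [X in fine X = _]integralE [X in _ = _ * fine X]integralE.
have fp := integrable_pos_fin_num measurableT fi.
have fn := integrable_neg_fin_num measurableT fi.
have hp : (\int[mu]_x (fun x0 : T => (f (phi x0))%:E)^\+ x =
    k%:E * \int[mu]_x (fun x0 : T => (f x0)%:E)^\+ x)%E.
  rewrite -h; last by move=> t; exact: funepos_ge0.
  - by apply: eq_integral => t _; rewrite !funeposE.
  - exact: measurable_funepos.
have hn : (\int[mu]_x (fun x0 : T => (f (phi x0))%:E)^\- x =
    k%:E * \int[mu]_x (fun x0 : T => (f x0)%:E)^\- x)%E.
  rewrite -h; last by move=> t; exact: funeneg_ge0.
  - by apply: eq_integral => t _; rewrite !funenegE.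
  - exact: measurable_funeneg.
rewrite hp hn; move: fp fn; rewrite /comp => fp fn.
by rewrite -(fineK fp) -(fineK fn) -!EFinM /= mulrBr.
Qed.

Lemma scales_by_cintegrable phi k (f : T -> R[i]) : scales_by phi k ->
  cintegrable mu f -> cintegrable mu (f \o phi).
Proof.
move=> sc [f1 f2]; split; [have := scales_by_integrable sc f1|
  have := scales_by_integrable sc f2] => //.
Qed.

Lemma scales_by_cint phi k (f : T -> R[i]) : scales_by phi k ->
  cintegrable mu f -> cint mu (f \o phi) = k%:C * cint mu f.
Proof.
move=> sc [f1 f2]; apply: complexP; rewrite ?Re_mul ?Im_mul /= mul0r ?subr0 ?addr0.
- exact: (scales_by_Rintegral sc f1).
- exact: (scales_by_Rintegral sc f2).
Qed.

Lemma scales_by_cmeas phi k (f : T -> R[i]) : scales_by phi k ->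
  cmeas f -> cmeas (f \o phi).
Proof. by move=> [mphi _] [f1 f2]; split; [have := measurableT_comp f1 mphi|have := measurableT_comp f2 mphi]. Qed.

End Scaling.

Section LebesgueR.
Context (R : realType).
Local Notation T := (measurableTypeR R).

(** Uniqueness of Lebesgue measure: the pushforward rescaled by |a| gives half-open intervals their
    length. A negative [a] reverses the interval and moves its closed end, which leaves the length
    unchanged. *)
Lemma scales_by_affine_R (a b : R) : a != 0 ->
  scales_by (@lebesgue_measure R) (fun x : T => a * x + b : T) `|a|^-1.
Proof.
move=> a0; set phi := (X in scales_by _ X).
have mphi : measurable_fun setT phi.
  by apply: measurable_funD => //; apply: measurable_funM.
split => // F mF F0.
pose k := NngNum (normr_ge0 a).
pose nu := measure_function_pushforward__canonical__measure_function_Measure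
  (@lebesgue_measure R) mphi.
have E : forall A, measurable A -> lebesgue_measure A = mscale k nu A.
  move=> A mA; apply: lebesgue_measure_unique => // _ [[x y]] _ <-.
  transitivity (`|a|%:E * lebesgue_measure (phi @^-1` `]x, y]))%E; last by [].
  rewrite lebesgue_measure_itv/= lte_fin.
  have [a_gt0|a_lt0|/eqP] := ltgtP 0 a; last by rewrite eq_sym (negbTE a0).
  - rewrite (_ : _ @^-1` _ = `](x - b) / a, (y - b) / a]%classic).
      rewrite lebesgue_measure_itv/= lte_fin ltr_pM2r ?invr_gt0// ltrD2r.
      case: ifPn => _; rewrite ?mule0// -EFinM; congr EFin.
      by rewrite gtr0_norm//; field.
    apply/seteqP; split => z; rewrite /phi/= !in_itv/=;
      by rewrite ltr_pdivrMr// ler_pdivlMr// (mulrC z) ltrBlDr lerBrDr.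
  - rewrite (_ : _ @^-1` _ = `[(y - b) / a, (x - b) / a[%classic).
      rewrite lebesgue_measure_itv/= lte_fin ltr_nM2r ?invr_lt0// ltrD2r.
      case: ifPn => _; rewrite ?mule0// -EFinM; congr EFin.
      by rewrite ltr0_norm//; field.
    apply/seteqP; split => z; rewrite /phi/= !in_itv/=;
      by rewrite ler_ndivrMr// ltr_ndivlMr// (mulrC z) ltrBlDr lerBrDr andbC.
have := @ge0_integral_pushforward _ _ _ _ _ _ mphi (@lebesgue_measure R) setT F measurableT mF.
rewrite preimage_setT => <-; last by move=> y _; exact: F0.
transitivity (`|a|^-1%:E * (`|a|%:E * \int[pushforward lebesgue_measure phi]_y F y))%E.
  by rewrite muleA -EFinM mulVf ?normr_eq0// mul1e.
congr (_ * _)%E; rewrite (eq_measure_integral (mscale k nu)).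
  by rewrite ge0_integral_mscale.
by move=> A mA _; exact: E.
Qed.

End LebesgueR.

Section AffineMaps.
Context (R : realType).
Local Notation T := (measurableTypeR R).
Local Notation leb := (lebesgue R).

Lemma vec_inj n : injective (@vec R n).
Proof.
move=> s t /colP st; apply: eq_from_tnth => i.
by have := st i; rewrite !mxE.
Qed.

Lemma vec_tcons n (p : T * n.-tuple T) :
  vec (tcons p) = col_mx (p.1)%:M (vec p.2) :> 'cV[R]_(1 + n).
Proof.
apply/colP => i; rewrite -(fintype.splitK i); case: (fintype.split i) => j /=.
  by rewrite col_mxEu !mxE !ord1 eqxx mulr1n (tnth_nth 0).
by rewrite col_mxEd !mxE !(tnth_nth 0).
Qed.

Definition affm n (M : 'M[R]_n) (c : 'cV[R]_n) (t : n.-tuple T) : n.-tuple T :=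
  [tuple ((M *m vec t + c) i 0 : T) | i < n].

Lemma vec_affm n (M : 'M[R]_n) c t : vec (affm M c t) = M *m vec t + c.
Proof. by apply/colP => i; rewrite mxE tnth_mktuple. Qed.

Lemma vec_affm_tcons n (M : 'M[R]_(1 + n)) (c : 'cV[R]_(1 + n)) p :
  vec (affm (M : 'M[R]_n.+1) c (tcons p)) =
  M *m col_mx (p.1)%:M (vec p.2) + c :> 'cV[R]_(1 + n).
Proof. by rewrite -vec_tcons; exact: vec_affm. Qed.

Lemma affm_comp n (M N : 'M[R]_n) c d :
  affm M c \o affm N d = affm (M *m N) (M *m d + c).
Proof.
apply/funext => t /=; apply: vec_inj.
by rewrite !vec_affm mulmxDr mulmxA addrA.
Qed.

Lemma measurable_affm n (M : 'M[R]_n) c : measurable_fun setT (affm M c).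
Proof.
apply/measurable_fun_tnthP => i.
rewrite (_ : _ \o _ = fun t => \sum_j M i j * tnth t j + c i 0).
  apply: measurable_funD => //; apply: measurable_sum => j.
  by apply: measurable_funM => //; exact: measurable_tnth.
apply/funext => t /=; rewrite tnth_mktuple !mxE; congr (_ + _).
by apply: eq_bigr => j _; rewrite mxE.
Qed.

Lemma integral_lebesgueS n (F : n.+1.-tuple T -> \bar R) :
  measurable_fun setT F -> (forall t, (0 <= F t)%E) ->
  (\int[leb n.+1]_t F t =
   \int[@lebesgue_measure R]_x \int[leb n]_t F (tcons (x, t)))%E.
Proof.
move=> mF F0.
rewrite -(fubini_tonelli1 (F \o @tcons R n)); last 2 first.
- exact: (measurableT_comp mF (@measurable_tcons R n)).
- by move=> p; exact: F0.
have := @ge0_integral_pushforward _ _ _ _ _ _ (@measurable_tcons R n)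
  (product_measure1 (@lebesgue_measure R) (leb n)) setT F measurableT mF.
rewrite preimage_setT => <-; last by move=> y _; exact: F0.
apply: eq_measure_integral => [|mT A mA _] //.
exact: measurable_tcons.
Qed.

Lemma integral_lebesgueS2 n (F : n.+1.-tuple T -> \bar R) :
  measurable_fun setT F -> (forall t, (0 <= F t)%E) ->
  (\int[leb n.+1]_t F t =
   \int[leb n]_t \int[@lebesgue_measure R]_x F (tcons (x, t)))%E.
Proof.
move=> mF F0; rewrite integral_lebesgueS//.
apply: (@fubini_tonelli _ _ _ _ _ _ _ (F \o @tcons R n)).
- exact: (measurableT_comp mF (@measurable_tcons R n)).
- by move=> p; exact: F0.
Qed.

Lemma measurable_tcons1 n (x : T) (F : n.+1.-tuple T -> \bar R) :
  measurable_fun setT F -> measurable_fun setT (fun t => F (tcons (x, t))).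
Proof.
move=> mF; apply: (measurableT_comp mF).
apply: (measurableT_comp (@measurable_tcons R n)).
exact: measurable_fun_pair.
Qed.

Lemma measurable_tcons2 n (t : n.-tuple T) (F : n.+1.-tuple T -> \bar R) :
  measurable_fun setT F -> measurable_fun setT (fun x => F (tcons (x, t))).
Proof.
move=> mF; apply: (measurableT_comp mF).
apply: (measurableT_comp (@measurable_tcons R n)).
exact: measurable_fun_pair.
Qed.

(** With the tail t fixed, the map is an affine map of the line in the first coordinate, so that
    coordinate is integrated innermost. *)
Lemma scales_by_upper n (a : R) (l : 'rV[R]_n) (c : 'cV[R]_1) : a != 0 ->
  scales_by (leb n.+1)
    (affm (block_mx a%:M l 0 1%:M : 'M[R]_(1 + n)) (col_mx c 0)) `|a|^-1.
Proof.
move=> a0; split=> [|F mF F0]; first exact: measurable_affm.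
rewrite (integral_lebesgueS2 (F := F \o _)) => [|| t]; last exact: F0; last first.
  exact: (measurableT_comp mF (measurable_affm _ _)).
rewrite integral_lebesgueS2// -ge0_integralZl//; last 2 first.
- apply: (@measurable_fun_fubini_tonelli_G _ _ _ _ _ (@lebesgue_measure R) (F \o @tcons R n)).
    exact: (measurableT_comp mF (@measurable_tcons R n)).
  by move=> p; exact: F0.
- by move=> t _; apply: integral_ge0.
apply: eq_integral => t _ /=.
have [_ h] := scales_by_affine_R ((l *m vec t + c) 0 0) a0.
rewrite -(h (fun x => F (tcons (x, t)))) => [||x]; last exact: F0; last first.
  exact: measurable_tcons2.
apply: eq_integral => x _; congr F; apply: vec_inj.
rewrite vec_affm_tcons vec_tcons mul_block_col add_col_mx mul0mx mul1mx add0r addr0.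
rewrite /= (_ : _ + c = (a * x + (l *m vec t + c) 0 0)%:M)//.
by apply/colP => i; rewrite -scalar_mxM -addrA !ord1 mxE [RHS]mxE eqxx mulr1n mxE eqxx mulr1n.
Qed.

(** With the first coordinate x fixed, the tail undergoes [N] followed by the translation x w + c.
    As this varies with x, the hypothesis is required for all translations. *)
Lemma scales_by_lower n (N : 'M[R]_n) (k : R) (w : 'cV[R]_n) (c : 'cV[R]_n) :
  0 <= k -> (forall d, scales_by (leb n) (affm N d) k) ->
  scales_by (leb n.+1)
    (affm (block_mx 1%:M 0 w N : 'M[R]_(1 + n)) (col_mx 0 c)) k.
Proof.
move=> k0 hN; split=> [|F mF F0]; first exact: measurable_affm.
rewrite (integral_lebesgueS (F := F \o _)) => [|| t]; last exact: F0; last first.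
  exact: (measurableT_comp mF (measurable_affm _ _)).
rewrite integral_lebesgueS//.
transitivity (\int[@lebesgue_measure R]_x (k%:E * \int[leb n]_t F (tcons (x, t))))%E.
  apply: eq_integral => x _ /=.
  have [_ h] := hN (x *: w + c).
  rewrite -(h (fun t => F (tcons (x, t)))) => [||t]; last exact: F0; last first.
    exact: measurable_tcons1.
  apply: eq_integral => t _; congr F; apply: vec_inj.
  rewrite vec_affm_tcons vec_tcons vec_affm mul_block_col add_col_mx mul0mx mul1mx !addr0.
  by rewrite /= mul_mx_scalar [in RHS]addrA (addrC (x *: w)).
rewrite ge0_integralZl//; last by move=> x _; apply: integral_ge0.
apply: (@measurable_fun_fubini_tonelli_F _ _ _ _ _ (leb n) (F \o @tcons R n)).
  exact: (measurableT_comp mF (@measurable_tcons R n)).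
by move=> p; exact: F0.
Qed.

(* Block LU factorization with pivot [M 0 0]; when the pivot vanishes, the
   transvection [E 1] first adds to row 0 a row with nonzero first entry. *)
Lemma scales_by_affm n (M : 'M[R]_n) (c : 'cV[R]_n) : M \in unitmx ->
  scales_by (leb n) (affm M c) `|\det M|^-1.
Proof.
elim: n M c => [M c _|n ih M c uM].
  rewrite (_ : affm M c = id); last by apply/funext => t; rewrite [LHS]tuple0 [RHS]tuple0.
  by rewrite det_mx00 normr1 invr1; split => // F mF F0; rewrite mul1e.
have pivot (M' : 'M[R]_(1 + n)) (c' : 'cV[R]_(1 + n)) : M' 0 0 != 0 ->
    M' \in unitmx -> scales_by (leb n.+1) (affm (M' : 'M[R]_n.+1) c') `|\det M'|^-1.
  set a := M' 0 0 => a0 uM'.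
  pose N := drsubmx M' - a^-1 *: (dlsubmx M' *m ursubmx M').
  pose L : 'M[R]_(1 + n) := block_mx 1%:M 0 (a^-1 *: dlsubmx M') N.
  pose U : 'M[R]_(1 + n) := block_mx a%:M (ursubmx M') 0 1%:M.
  have MLU : M' = L *m U.
    rewrite mulmx_block !mul1mx !mulmx0 !mul0mx !mulmx1 !addr0 mul_mx_scalar.
    rewrite scalerA divff// scale1r -scalemxAl addrC subrK.
    rewrite -[LHS]submxK; congr block_mx.
    apply/matrixP => i j; rewrite !ord1 !mxE eqxx mulr1n /a.
    by congr (M' _ _); exact/val_inj.
  have detM : \det M' = \det N * a.
    by rewrite MLU det_mulmx det_lblock det_ublock !det1 det_scalar1 mul1r mulr1.
  have uN : N \in unitmx.
    move: uM'; rewrite !unitmxE detM unitrM => /andP[//].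
  have Ec : L *m col_mx (usubmx c') 0 +
      col_mx 0 (dsubmx c' - a^-1 *: dlsubmx M' *m usubmx c') = c'.
    rewrite mul_block_col add_col_mx !mulmx0 mul1mx !addr0.
    by rewrite [_ + (_ - _)]addrC subrK vsubmxK.
  have k0 : 0 <= `|\det N|^-1 by rewrite invr_ge0.
  have /scales_by_comp/(_ (scales_by_upper (ursubmx M') (usubmx c') a0)) :=
    scales_by_lower (a^-1 *: dlsubmx M')
      (dsubmx c' - a^-1 *: dlsubmx M' *m usubmx c') k0 (fun d => ih N d uN).
  rewrite detM normrM invfM; congr scales_by.
  by rewrite affm_comp [in RHS]MLU -[in RHS]Ec.
have [M00|/pivot] := eqVneq (M 0 0) 0; last exact.
pose M1 : 'M[R]_(1 + n) := M.
have [k Mk] : exists k, M1 (rshift 1 k) 0 != 0.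
  apply: contrapT => /forallNP M0.
  have : M1 *m delta_mx 0 0 = 0 :> 'cV[R]_(1 + n).
    rewrite -colE; apply/colP => i; rewrite !mxE.
    rewrite -(fintype.splitK i); case: (fintype.split i) => j /=.
      by rewrite ord1 -[RHS]M00; congr (M1 _ _); exact/val_inj.
    by have /negP/negPn/eqP := M0 j.
  move=> /(congr1 (mulmx (invmx M))); rewrite mulKmx// mulmx0.
  by move=> /matrixP /(_ 0 0) /eqP; rewrite !mxE !eqxx oner_eq0.
pose E (x : R) : 'M[R]_(1 + n) := block_mx 1%:M (x *: delta_mx 0 k) 0 1%:M.
have EK : E (-1) *m E 1 = 1%:M.
  rewrite mulmx_block !mul1mx !mulmx0 !mul0mx !mulmx1 !addr0 add0r.
  by rewrite scaleN1r scale1r subrr -scalar_mx_block.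
have detE x : \det (E x) = 1 by rewrite det_ublock !det1 mul1r.
have E00 : (E 1 *m M1) 0 0 != 0.
  rewrite -[M1]vsubmxK mul_block_col mul1mx scale1r -rowE.
  have -> : (0 : 'I_(1 + n)) = lshift n 0 by exact/val_inj.
  rewrite col_mxEu !mxE.
  suff -> : M1 (lshift n 0) (lshift n 0) = 0.
    rewrite add0r; move: Mk; congr (_ != _); congr (M1 _ _); exact/val_inj.
  by rewrite -[RHS]M00; congr (M1 _ _); exact/val_inj.
have uE : E 1 *m M1 \in unitmx.
  by rewrite unitmx_mul uM andbT unitmxE detE unitr1.
have /scales_by_comp/(_ (pivot _ (E 1 *m c) E00 uE)) :=
  scales_by_upper (-1 *: delta_mx 0 k) 0 (oner_neq0 R).
rewrite det_mulmx detE mul1r normr1 invr1 mul1r; congr scales_by.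
rewrite affm_comp mulmxA EK mul1mx; congr affm.
rewrite mulmxA EK mul1mx (_ : col_mx 0 0 = 0) ?addr0//.
exact: col_mx0.
Qed.

End AffineMaps.

(** * Lattice sums of a product weight *)

Section CauchyWeight.
Context (R : realType).
Local Notation T := (measurableTypeR R).
Local Notation leb := (lebesgue R).

Lemma integral_prod n (phi : R -> R) : measurable_fun setT (phi : T -> R) ->
  (forall x, 0 <= phi x) ->
  (\int[leb n]_t (\prod_i phi (tnth t i))%:E =
   (\int[@lebesgue_measure R]_x (phi x)%:E) ^+ n)%E.
Proof.
move=> mphi phi0; elim: n => [|n ih].
  rewrite integral_dirac//.
    by rewrite diracT mul1e big_ord0 expe0.
  apply/measurable_EFinP; under eq_fun do rewrite big_ord0.
  exact: measurable_cst.
have mprod m : measurable_fun setT (fun t : m.-tuple T => (\prod_i phi (tnth t i))%:E).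
  apply/measurable_EFinP; apply: measurable_prod => i _.
  exact: (measurableT_comp mphi (measurable_tnth i)).
have p0 m (t : m.-tuple T) : (0 <= (\prod_i phi (tnth t i))%:E)%E.
  by rewrite lee_fin prodr_ge0.
rewrite integral_lebesgueS//.
transitivity (\int[@lebesgue_measure R]_x ((phi x)%:E * \int[leb n]_t (\prod_i phi (tnth t i))%:E))%E.
  apply: eq_integral => x _; rewrite -ge0_integralZl//; last 2 first.
  - exact: mprod.
  - by rewrite lee_fin.
  apply: eq_integral => t _; rewrite big_ord_recl EFinM; congr (_ * _)%E.
  by congr EFin; apply: eq_bigr => i _; rewrite !(tnth_nth 0).
rewrite ge0_integralZr//; last 3 first.
- exact/measurable_EFinP.
- by move=> x _; rewrite lee_fin.
- by apply: integral_ge0.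
by rewrite ih expeS.
Qed.

Definition cauchy (x : R) : R := (1 + x ^+ 2)^-1.

Lemma cauchy_gt0 x : 0 < cauchy x.
Proof. by rewrite invr_gt0 ltr_wpDr// sqr_ge0. Qed.

Lemma measurable_cauchy : measurable_fun setT (cauchy : T -> R).
Proof. by apply: continuous_measurable_fun; exact: continuous_oneDsqrV. Qed.

Lemma integral_cauchy_lty : (\int[@lebesgue_measure R]_x (cauchy x)%:E < +oo)%E.
Proof.
rewrite ge0_symfun_integralT//.
- rewrite (_ : [set x | (0 <= x)%R] = `[0, +oo[%classic).
    by rewrite (integral0y_oneDsqr R) -EFinM ltry.
  by apply/seteqP; split => x /=; rewrite in_itv/= andbT.
- by move=> x; exact/ltW/cauchy_gt0.
- exact: continuous_oneDsqrV.
- by move=> x /=; rewrite /cauchy sqrrN.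
Qed.

(** The product form reduces integrals and lattice sums to dimension one, and the inverse of the
    weight is a polynomial, so finitely many Schwartz bounds dominate it. *)
Definition weight n (x : 'cV[R]_n) : R := \prod_i cauchy (x i 0).

Lemma weight_gt0 n (x : 'cV[R]_n) : 0 < weight x.
Proof. by apply: prodr_gt0 => i _; exact: cauchy_gt0. Qed.

Lemma measurable_prod_coord n (phi : R -> R) : measurable_fun setT (phi : T -> R) ->
  measurable_fun setT (fun t : n.-tuple T => \prod_i phi (vec t i 0)).
Proof.
move=> mphi; apply: measurable_prod => i _.
under eq_fun do rewrite mxE.
exact: (measurableT_comp mphi (measurable_tnth i)).
Qed.

Lemma integrable_weight n : (leb n).-integrable setT (EFin \o (@weight n \o @vec R n)).
Proof.
apply/integrableP; split.
  apply/measurable_EFinP.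
  exact: (measurable_prod_coord measurable_cauchy).
under eq_integral do rewrite /= ger0_norm ?(ltW (weight_gt0 _))//.
rewrite (_ : (\int[_]_x _)%E = (\int[leb n]_t (\prod_i cauchy (tnth t i))%:E)%E).
  rewrite integral_prod; last 2 first.
  - exact: measurable_cauchy.
  - by move=> x; exact/ltW/cauchy_gt0.
  have := integral_cauchy_lty; rewrite -ge0_fin_numE; last first.
    by apply: integral_ge0 => x _; rewrite lee_fin ltW// cauchy_gt0.
  by move=> /fineK <-; rewrite -EFin_expe ltry.
by apply: eq_integral => t _; congr EFin; apply: eq_bigr => i _; rewrite mxE.
Qed.

(** An algebraic stand-in for a primitive of [cauchy]: it stays in [-1, 1] and its unit increments
    dominate [cauchy] / 4, so a sum over integer translates telescopes to at most 4 * 2 = 8. *)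
Let theta (t : R) := t / (1 + `|t|).

Let theta_norm t : `|theta t| <= 1.
Proof.
rewrite normrM normfV [X in _ / X]gtr0_norm ?ltr_wpDr//.
by rewrite ler_pdivrMr ?ltr_wpDr// mul1r lerDr.
Qed.

(** When t and t + 1 lie on the same side of 0, the increment is 1 / ((1 + |t|) (1 + |t + 1|)) and
    the excess has a quadratic numerator of negative discriminant. When 0 lies between them, the
    increment is at least 1/2. *)
Let cauchy_theta t : cauchy t <= 4 * (theta (t + 1) - theta t).
Proof.
rewrite /cauchy /theta.
have D0 : 0 < 1 + t ^+ 2 by rewrite ltr_wpDr// sqr_ge0.
rewrite -[leLHS]mul1r ler_pdivrMr//.
have [t0|t0] := lerP 0 t.
  rewrite !ger0_norm ?addr_ge0//.
  have -> : 4 * ((t + 1) / (1 + (t + 1)) - t / (1 + t)) * (1 + t ^+ 2) =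
      1 + (3 * t ^+ 2 - 3 * t + 2) / ((1 + (t + 1)) * (1 + t)).
    by field; apply/andP; split; rewrite gt_eqF//; lra.
  rewrite lerDl divr_ge0//; first by nra.
  by rewrite mulr_ge0 ?addr_ge0.
rewrite (ltr0_norm t0).
have [t1|t1] := lerP 0 (t + 1).
  rewrite (ger0_norm t1).
  have -> : 4 * ((t + 1) / (1 + (t + 1)) - t / (1 - t)) * (1 + t ^+ 2) =
      1 + 4 * (((t + 1) / (1 + (t + 1)) - t / (1 - t)) * (1 + t ^+ 2) - 1/4).
    by field; apply/andP; split; rewrite gt_eqF//; lra.
  have h1 : (t + 1) / 2 <= (t + 1) / (1 + (t + 1)).
    by rewrite ler_wpM2l// lef_pV2 ?posrE; lra.
  have h2 : (- t) / 2 <= (- t) / (1 - t).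
    by rewrite ler_wpM2l ?lef_pV2 ?posrE; lra.
  have : 1/2 <= (t + 1) / (1 + (t + 1)) - t / (1 - t).
    by rewrite -mulNr; lra.
  set z := (X in _ <= X) => hz.
  by have := sqr_ge0 t; nra.
rewrite (ltr0_norm t1).
have -> : 4 * ((t + 1) / (1 - (t + 1)) - t / (1 - t)) * (1 + t ^+ 2) =
    1 + (3 * t ^+ 2 + t + 4) / ((- t) * (1 - t)).
  by field; apply/and3P; split; apply/eqP => ?; lra.
rewrite lerDl divr_ge0//; first by nra.
by rewrite mulr_ge0//; lra.
Qed.

Lemma sum_cauchy_le (y : R) M : \sum_(j < M) cauchy (y - j%:R) <= 8.
Proof.
have : \sum_(j < M) cauchy (y - j%:R) <= 4 * (theta (y + 1) - theta (y + 1 - M%:R)).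
  elim: M => [|M ih]; first by rewrite big_ord0 subr0 subrr mulr0.
  rewrite big_ord_recr/=.
  have := cauchy_theta (y - M%:R).
  rewrite (_ : y - M%:R + 1 = y + 1 - M%:R); last by rewrite addrAC.
  rewrite (_ : y + 1 - M.+1%:R = y - M%:R).
    by move=> h; rewrite (le_trans (lerD ih h))// -mulrDr addrA subrK.
  by rewrite -natr1 opprD addrA addrAC addrK.
move=> /le_trans; apply.
have := theta_norm (y + 1); have := theta_norm (y + 1 - M%:R).
by rewrite !ler_norml => /andP[? ?] /andP[? ?]; lra.
Qed.

(** As the terms are positive, F may be enlarged to a box of vectors with entries in [-N, N). Over a
    box the sum of products is a product of one-dimensional sums, each at most 8. *)
Lemma sum_weight_le n (F : seq 'cV[int]_n) (x : 'cV[R]_n) : uniq F ->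
  \sum_(k <- F) weight (x - map_mx intr k) <= 8 ^+ n.
Proof.
move=> uF.
have [N FN] : exists N, forall (k : 'cV[int]_n) i, k \in F -> (absz (k i 0%R) < N)%N.
  exists (\max_(k <- F) \max_i absz (k i 0%R)).+1 => k i kF.
  rewrite ltnS (leq_trans (leq_bigmax (F := fun i => absz (k i 0%R)) i))//.
  by apply: (leq_bigmax_seq (F := fun k : 'cV[int]_n => \max_i absz (k i 0%R))).
have shiftN (z : int) : (absz z < N)%N -> (absz (z + N%:Z)%R < N.*2)%N /\
    z = (absz (z + N%:Z)%R)%:Z - N%:Z by lia.
pose kap (f : {ffun 'I_n -> 'I_N.*2}) : 'cV[int]_n := \col_i ((f i)%:Z - N%:Z).
have kap_inj : injective kap.
  move=> f g /colP fg; apply/ffunP => i; have := fg i; rewrite !mxE.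
  by move=> /addIr [] /val_inj.
pose G := [seq kap f | f : {ffun 'I_n -> 'I_N.*2}].
have uG : uniq G by rewrite map_inj_uniq ?enum_uniq.
have FG : {subset F <= G}.
  move=> k kF; apply/mapP.
  have lt i : (absz (k i 0%R + N%:Z)%R < N.*2)%N by case: (shiftN _ (FN k i kF)).
  exists [ffun i => Ordinal (lt i)]; first by rewrite mem_enum.
  by apply/colP => i; rewrite !mxE ffunE /=; case: (shiftN _ (FN k i kF)).
rewrite (@le_trans _ _ (\sum_(k <- G) weight (x - map_mx intr k)))//.
  rewrite [leRHS](bigID (mem F))/= -[X in _ <= X + _]big_filter.
  have pF : perm_eq F [seq k <- G | k \in F].
    apply: uniq_perm => //; first exact: filter_uniq.
    by move=> k; rewrite mem_filter; case: (boolP (k \in F)) => //= /FG ->.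
  by rewrite -(perm_big _ pF)/= lerDl sumr_ge0// => k _; exact/ltW/weight_gt0.
rewrite big_image/= /weight.
under eq_bigr do under eq_bigr do rewrite !mxE rmorphB/= opprB addrA.
rewrite -(bigA_distr_bigA (fun i (j : 'I_N.*2) => cauchy (x i 0 + N%:~R - j%:~R)))/=.
rewrite -[n in leRHS]card_ord -prodr_const; apply: ler_prod => i _.
by rewrite sumr_ge0/= ?sum_cauchy_le// => j _; exact/ltW/cauchy_gt0.
Qed.

End CauchyWeight.

(** * Measurability of continuous functions on R^n *)

Section ContinuousMeasurable.
Context (R : realType) (n : nat).
Local Notation T := (measurableTypeR R).

Lemma cvg_col (u : nat -> 'cV[R]_n) (x : 'cV[R]_n) :
  (forall i, (fun m => u m i 0) @ \oo --> x i 0) -> u @ \oo --> x.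
Proof.
move=> ux; apply/cvg_ballP => e e0.
have : \forall m \near \oo, forall i, ball (x i 0) e (u m i 0).
  by apply: filter_forall => i; have /cvg_ballP/(_ e e0) := ux i.
by apply: filterS => m h; split => // i j; rewrite ord1.
Qed.

Let grid m (t : n.-tuple T) : 'cV[int]_n :=
  \col_i Num.floor (m.+1%:R * (tnth t i : R)).

Let measurable_grid m k : measurable [set t | grid m t = k].
Proof.
rewrite (_ : [set t | _] = \bigcap_(i in [set: 'I_n])
    ((fun t : n.-tuple T => m.+1%:R * tnth t i : T) @^-1` `[(k i 0)%:~R, (k i 0 + 1)%:~R[)).
  apply: fin_bigcap_measurable => // i _; rewrite -[X in measurable X]setTI.
  apply: measurable_funM => //; exact: measurable_tnth.
apply/seteqP; split => t /=.
  by move=> <- i _ /=; rewrite in_itv/= !mxE floor_itv.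
move=> h; apply/colP => i; rewrite mxE; apply/floor_def.
by have := h i I; rewrite /= in_itv/=.
Qed.

(** [g] is the pointwise limit of its values at the lower corners of the cubes of side 1 / (m + 1)
    containing the point. Each approximant is constant on each of countably many measurable
    cells. *)
Lemma measurable_continuous_vec (g : 'cV[R]_n -> R) : continuous g ->
  measurable_fun setT (fun t : n.-tuple T => g (vec t)).
Proof.
move=> cg.
apply: (measurable_fun_cvg (h := fun m t => g (m.+1%:R^-1 *: map_mx intr (grid m t)))).
  move=> m _ Y mY; rewrite setTI.
  rewrite (_ : _ @^-1` _ = \bigcup_(k : 'cV[int]_n)
    ([set t | grid m t = k] `&` [set _ | Y (g (m.+1%:R^-1 *: map_mx intr k))])).
    apply: countable_bigcupT_measurable => [|k]; first exact: countableP.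
    apply: measurableI; first exact: measurable_grid.
    by have [Yk|Yk] := pselect (Y (g (m.+1%:R^-1 *: map_mx intr k)));
      [rewrite (_ : mkset _ = setT)|rewrite (_ : mkset _ = set0)] => //;
      apply/seteqP; split.
  apply/seteqP; split => t /=; first by move=> Yt; exists (grid m t).
  by move=> [k _ [/= <-]].
move=> t _.
suff uc : (fun m => m.+1%:R^-1 *: map_mx intr (grid m t) : 'cV[R]_n) @ \oo --> vec t.
  exact: (cvg_comp _ _ uc (cg (vec t))).
apply: cvg_col => i; apply/cvgrPdist_lt => e e0.
have := near_infty_natSinv_lt (PosNum e0); apply: filterS => m /= me.
apply: le_lt_trans me; rewrite !mxE.
set x := tnth t i.
have m0 : 0 < m.+1%:R :> R by [].
have -> : x - m.+1%:R^-1 * (Num.floor (m.+1%:R * x))%:~R =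
    m.+1%:R^-1 * (m.+1%:R * x - (Num.floor (m.+1%:R * x))%:~R).
  by rewrite mulrBr mulKf// gt_eqF.
rewrite normrM ger0_norm ?invr_ge0// ger0_norm ?subr_ge0 ?ge_floor//.
rewrite ler_piMr ?invr_ge0// lerBlDl ltW//.
by have := floorD1_gt (m.+1%:R * x); rewrite intrD.
Qed.

End ContinuousMeasurable.

(** * The Fourier kernel of the unit cube *)

Section Kernel.
Context (R : realType).
Local Notation T := (measurableTypeR R).
Local Notation mu := (@lebesgue_measure R).

Definition cis (u : R) : R[i] := cos u +i* sin u.

Lemma cisD a b : cis (a + b) = cis a * cis b.
Proof. by apply: complexP; rewrite /= ?cosD ?sinD//; ring. Qed.

Lemma cis0 : cis 0 = 1.
Proof. by rewrite /cis cos0 sin0. Qed.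

Lemma cisN u : cis (- u) = conjc (cis u).
Proof. by rewrite /cis cosN sinN. Qed.

Lemma normc_cis u : normc (cis u) = 1.
Proof. by rewrite /= cos2Dsin2 sqrtr1. Qed.

Lemma cmeas_cis d (X : measurableType d) (h : X -> R) :
  measurable_fun setT (h : X -> T) -> cmeas (fun t => cis (h t)).
Proof.
move=> mh; split.
- apply: (measurableT_comp (f := @cos R : T -> T)) => //.
  by apply: continuous_measurable_fun; exact: continuous_cos.
- apply: (measurableT_comp (f := @sin R : T -> T)) => //.
  by apply: continuous_measurable_fun; exact: continuous_sin.
Qed.

(* The integral of [cis (y * t)] over t in [0, 1]. *)
Definition dker (y : R) : R[i] :=
  if y == 0 then 1 else (sin y / y) +i* ((1 - cos y) / y).

Definition unit_ind (t : R) : R := \1_(`[0, 1]%classic : set R) t.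

Lemma unit_ind_ge0 t : 0 <= unit_ind t.
Proof. by rewrite /unit_ind indicE ler0n. Qed.

Lemma measurable_unit_ind : measurable_fun setT (unit_ind : T -> R).
Proof. exact: measurable_indic. Qed.

Lemma integral_unit_ind : (\int[mu]_t (unit_ind t)%:E = 1)%E.
Proof.
rewrite integral_indic// setIT.
have := @lebesgue_measure_itv R `[0, 1].
by rewrite /= lte_fin ltr01 oppr0 adde0.
Qed.

Lemma integrable_unit_ind : mu.-integrable setT (EFin \o unit_ind).
Proof.
apply/integrableP; split.
  by apply/measurable_EFinP; exact: measurable_unit_ind.
under eq_integral do rewrite gee0_abs ?lee_fin ?unit_ind_ge0//.
by rewrite integral_unit_ind ltry.
Qed.

Lemma Rintegral_unit (f F : R -> R) : continuous f ->
  (forall x : R, is_derive x (1 : R) F (f x)) ->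
  \int[mu]_t (unit_ind t * f t) = F 1 - F 0.
Proof.
move=> cf dF.
have cF : continuous F.
  move=> x; apply: differentiable_continuous; apply/derivable1_diffP.
  by case: (dF x).
have := @continuous_FTC2 R f F 0 1 ltr01.
rewrite /Rintegral.
rewrite (_ : (\int[_]_t _)%E = (\int[mu]_(x in `[0%R, 1%R]) (f x)%:E)%E).
  move=> ->.
  - by [].
  - exact: continuous_subspaceT.
  - split=> [x _||]; first by case: (dF x).
    + by apply: cvg_at_right_filter; exact: cF.
    + by apply: cvg_at_left_filter; exact: cF.
  - by move=> x _; rewrite derive1E; have [_] := dF x.
rewrite [RHS]integral_mkcond; apply: eq_integral => t _.
rewrite /unit_ind indicE patchE; case: ifPn => _; first by rewrite mul1r.
by rewrite mul0r.
Qed.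

Lemma dkerE y : dker y = cint mu (fun t => (unit_ind t)%:C * cis (y * t)).
Proof.
rewrite /dker; case: eqP => [->|/eqP y0].
  apply: complexP => /=.
  - under eq_Rintegral do rewrite !mul0r cos0 subr0.
    rewrite (@Rintegral_unit (cst 1) id); first by rewrite subr0.
    by move=> x; exact: cvg_cst.
  - under eq_Rintegral do rewrite !mul0r sin0 mulr0 addr0.
    by rewrite Rintegral_cst// mul0r.
have dy (x : R) : is_derive x (1 : R) ( *%R y) y.
  by apply: is_derive_eq; rewrite ?scaler0 ?add0r; exact: mulr1.
have cy : continuous ( *%R y) by exact: mulrl_continuous.
have dS (x : R) : is_derive x (1 : R) (fun t => y^-1 * sin (y * t)) (cos (y * x)).
  have dc : is_derive x (1 : R) (@sin R \o *%R y) (cos (y * x) * y).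
    by apply: is_derive1_comp.
  apply: (is_derive_eq (is_deriveZ (y^-1) dc)).
  by rewrite /GRing.scale/= mulrC -mulrA divff// mulr1.
have dC (x : R) : is_derive x (1 : R) (fun t => - y^-1 * cos (y * t)) (sin (y * x)).
  have dc : is_derive x (1 : R) (@cos R \o *%R y) (- sin (y * x) * y).
    by apply: is_derive1_comp.
  apply: (is_derive_eq (is_deriveZ (- y^-1) dc)).
  by rewrite /GRing.scale/=; field.
have cc : continuous (fun x => cos (y * x)).
  by move=> x; apply: continuous_comp; [exact: cy|exact: continuous_cos].
have cs : continuous (fun x => sin (y * x)).
  by move=> x; apply: continuous_comp; [exact: cy|exact: continuous_sin].
apply: complexP => /=.
- under eq_Rintegral do rewrite mul0r subr0.
  by rewrite (Rintegral_unit cc dS) mulr1 mulr0 sin0 mulr0 subr0 mulrC.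
- under eq_Rintegral do rewrite mul0r addr0.
  by rewrite (Rintegral_unit cs dC) mulr1 mulr0 cos0 mulr1; field.
Qed.

Lemma measurable_invr : measurable_fun setT (fun x : T => x^-1 : T).
Proof.
rewrite (_ : setT = [set x : R | x != 0] `|` [set 0]); last first.
  by apply/seteqP; split => // x _ /=; have [->|x0] := eqVneq x 0; [right|left].
have o0 : open [set x : R | x != 0] by exact: open_neq.
apply/measurable_funU => //; first exact: open_measurable.
split; last exact: measurable_fun_set1.
apply: open_continuous_measurable_fun => // x; rewrite inE /= => x0.
exact: inv_continuous.
Qed.

Lemma cmeas_dker : cmeas (dker : T -> R[i]).
Proof.
have mi := measurable_invr.
have mif (a b : T -> R) : measurable_fun setT a -> measurable_fun setT b ->
    measurable_fun setT (fun y : T => if (y : R) == 0 then a y else b y).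
  by move=> ma mb; apply: measurable_fun_ifT => //; exact: measurable_fun_eqr.
have ms : measurable_fun setT (@sin R : T -> T).
  by apply: continuous_measurable_fun; exact: continuous_sin.
have mc : measurable_fun setT (@cos R : T -> T).
  by apply: continuous_measurable_fun; exact: continuous_cos.
split.
- rewrite (_ : (fun t => _) = fun y : T => if (y : R) == 0 then 1 else sin y / y).
    by apply: mif => //; apply: measurable_funM.
  by apply/funext => y; rewrite /dker; case: ifP.
- rewrite (_ : (fun t => _) = fun y : T => if (y : R) == 0 then 0 else (1 - cos y) / y).
    by apply: mif => //; apply: measurable_funM => //; apply: measurable_funB.
  by apply/funext => y; rewrite /dker; case: ifP.
Qed.

(** 13 = 2^2 + 3^2: the integral form gives |dker y| <= 2, and the closed form gives |y dker y| <=
    |sin y| + |1 - cos y| <= 3. *)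
Lemma dker_bound y : normc (dker y) ^+ 2 <= 13 * cauchy y.
Proof.
have D0 : 0 < 1 + y ^+ 2 by rewrite ltr_wpDr// sqr_ge0.
rewrite /cauchy ler_pdivlMr//.
have i0 : cintegrable mu (fun t : T => (unit_ind t)%:C * cis (y * t)).
  apply: cintegrable_le integrable_unit_ind.
    apply: cmeasM; first by apply: cmeas_real; exact: measurable_unit_ind.
    by apply: cmeas_cis; exact: measurable_funM.
  by move=> t; rewrite normcM normc_cis mulr1 normc_real ger0_norm// unit_ind_ge0.
have n1 : normc (dker y) <= 2.
  rewrite dkerE (le_trans (normc_cint i0))//.
  under eq_Rintegral do rewrite normcM normc_cis mulr1 normc_real ger0_norm ?unit_ind_ge0//.
  by rewrite /Rintegral integral_unit_ind mulr1.
have n2 : y ^+ 2 * normc (dker y) ^+ 2 <= 9.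
  have [->|y0] := eqVneq y 0; first by rewrite expr0n mul0r.
  rewrite -[y ^+ 2]real_normK ?num_real// -exprMn.
  rewrite (_ : 9 = 3 ^+ 2); last by ring.
  rewrite ler_pXn2r ?nnegrE ?mulr_ge0 ?normc_ge0//.
  rewrite /dker (negbTE y0) (le_trans (ler_wpM2l _ (normc_le_ReIm _)))//=.
  rewrite mulrDr -!normrM mulrC divfK// mulrC divfK//.
  have := sin_max y; have := cos_max y.
  by have := ler_normB 1 (cos y); rewrite normr1; lra.
have := sqr_ge0 (normc (dker y)); have := normc_ge0 (dker y).
by nra.
Qed.

(** An interval of positive length without zeros is enough to make the L^2 norm of the kernel
    positive. *)
Lemma dker_neq0 y : 0 < y < pi -> dker y != 0.
Proof.
move=> y0pi; have /andP[y0 _] := y0pi; rewrite /dker (gt_eqF y0).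
apply/eqP => -[/eqP]; rewrite mulf_eq0 invr_eq0 (gt_eqF y0) orbF.
by rewrite (gt_eqF (sin_gt0_pi y0pi)).
Qed.

End Kernel.

Section Averaging.
Context (R : realType).
Local Notation T := (measurableTypeR R).
Local Notation leb := (lebesgue R).

(** [dker (phi t)] is the average over tau in [0, 1] of the phases [cis (phi t * tau)], and Fubini
    moves this average outside the integral over X. *)
Lemma cint_dker_eq0 d (X : measurableType d)
    (m : {sigma_finite_measure set X -> \bar R}) (G : X -> R[i]) (phi : X -> R) :
  cintegrable m G -> measurable_fun setT (phi : X -> T) ->
  (forall tau, 0 <= tau <= 1 -> cint m (fun t => G t * cis (phi t * tau)) = 0) ->
  cint m (fun t => G t * dker (phi t)) = 0.
Proof.
move=> Gi mphi Gcis.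
pose F (p : X * T) := G p.1 * ((unit_ind p.2)%:C * cis (phi p.1 * p.2)).
have [mG1 mG2] := cintegrable_cmeas Gi.
have mind := @measurable_unit_ind R.
have mF : cmeas F.
  apply: cmeasM; first by split; [exact: (measurableT_comp mG1 measurable_fst)|
    exact: (measurableT_comp mG2 measurable_fst)].
  apply: cmeasM.
    by apply: cmeas_real; exact: (measurableT_comp mind measurable_snd).
  apply: cmeas_cis; apply: measurable_funM; last exact: measurable_snd.
  exact: (measurableT_comp mphi measurable_fst).
have nF p : normc (F p) = normc (G p.1) * unit_ind p.2.
  by rewrite /F !normcM normc_cis mulr1 normc_real ger0_norm// unit_ind_ge0.
have Foo : (\int[m]_x \int[@lebesgue_measure R]_y (normc (F (x, y)))%:E < +oo)%E.
  have inner x : (\int[@lebesgue_measure R]_y (normc (F (x, y)))%:E = (normc (G x))%:E)%E.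
    transitivity (\int[@lebesgue_measure R]_y ((normc (G x))%:E * (unit_ind y)%:E))%E.
      by apply: eq_integral => y _; rewrite nF.
    rewrite ge0_integralZl//; last 3 first.
    - by apply/measurable_EFinP; exact: mind.
    - by move=> y _; rewrite lee_fin unit_ind_ge0.
    - by rewrite lee_fin normc_ge0.
    by rewrite integral_unit_ind mule1.
  under eq_integral do rewrite inner.
  have /integrableP[_] := cintegrable_norm Gi.
  by under eq_integral do rewrite gee0_abs ?lee_fin ?normc_ge0//.
have F1 x : cintegrable (@lebesgue_measure R) (fun y => F (x, y)).
  rewrite /F/=; apply: cintegrableZ.
  apply: cintegrable_le (@integrable_unit_ind R).
    apply: cmeasM; first by apply: cmeas_real; exact: mind.
    by apply: cmeas_cis; exact: measurable_funM.
  by move=> t; rewrite normcM normc_cis mulr1 normc_real ger0_norm// unit_ind_ge0.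
have F2 y : cintegrable m (fun x => F (x, y)).
  rewrite /F/=; under eq_fun do rewrite mulrC.
  apply: (cintegrableMl (M := unit_ind y)) => //.
    apply: cmeasM; first exact: cmeas_cst.
    by apply: cmeas_cis; exact: measurable_funM.
  by move=> t; rewrite normcM normc_cis mulr1 normc_real ger0_norm// unit_ind_ge0.
have [_ _] := cint_Fubini mF Foo F1 F2.
rewrite (_ : (fun x => cint _ _) = fun t => G t * dker (phi t)); last first.
  apply/funext => t; rewrite /F/= cintZ ?dkerE//.
  apply: cintegrable_le (@integrable_unit_ind R).
    apply: cmeasM; first by apply: cmeas_real; exact: mind.
    by apply: cmeas_cis; exact: measurable_funM.
  by move=> y; rewrite normcM normc_cis mulr1 normc_real ger0_norm// unit_ind_ge0.
move=> ->.
rewrite (_ : (fun y => cint _ _) = fun=> 0) ?cint0//.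
apply/funext => y; rewrite /F/=.
have [y01|y01] := boolP (y \in `[0, 1]%classic).
  have := Gcis y; rewrite inE/= in_itv/= in y01; move=> /(_ y01) E.
  under eq_fun do rewrite mulrCA.
  rewrite cintZ ?E ?mulr0//.
  under eq_fun do rewrite mulrC.
  apply: (cintegrableMl (M := 1)) => //; last by move=> t; rewrite normc_cis.
  by apply: cmeas_cis; exact: measurable_funM.
rewrite (_ : (fun x => _) = fun=> 0) ?cint0//.
by apply/funext => x; rewrite /unit_ind indicE (negbTE y01) mul0r mulr0.
Qed.

Lemma cis_sum I (r : seq I) (F : I -> R) :
  cis (\sum_(i <- r) F i) = \prod_(i <- r) cis (F i).
Proof.
elim: r => [|i r ih]; first by rewrite !big_nil cis0.
by rewrite !big_cons cisD ih.
Qed.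

Lemma measurable_coord n (i : 'I_n) :
  measurable_fun setT (fun t : n.-tuple T => vec t i 0 : T).
Proof. by under eq_fun do rewrite mxE; exact: measurable_tnth. Qed.

Lemma normc_dker_le (y : R) : normc (dker y) <= 4.
Proof.
rewrite -(ler_pXn2r (n := 2))// ?nnegrE ?normc_ge0//.
rewrite (le_trans (dker_bound _))//.
have : cauchy y <= 1.
  by rewrite /cauchy invf_le1 ?lerDl ?sqr_ge0// ltr_wpDr ?sqr_ge0.
lra.
Qed.

Lemma dkerN (y : R) : dker (- y) = conjc (dker y).
Proof.
rewrite /dker oppr_eq0; case: eqP => // _; first by rewrite conjc1.
by apply: complexP; rewrite /= ?sinN ?cosN invrN ?mulrNN ?mulrN.
Qed.

Lemma normc_prod I (r : seq I) (F : I -> R[i]) :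
  normc (\prod_(i <- r) F i) = \prod_(i <- r) normc (F i).
Proof.
elim: r => [|i r ih]; first by rewrite !big_nil normc1.
by rewrite !big_cons normcM ih.
Qed.

(** The integral of [cis (dotv x u)] over u in the unit cube. The phase carries no factor 2 pi; that
    factor enters later through the dilation of the argument. *)
Definition dkern n (x : 'cV[R]_n) : R[i] := \prod_i dker (x i 0).

Lemma cmeas_dkern n : cmeas (fun t : n.-tuple T => dkern (vec t)).
Proof.
apply: cmeas_prod => i; have [m1 m2] := @cmeas_dker R.
split; [exact: (measurableT_comp m1 (measurable_coord i))|
  exact: (measurableT_comp m2 (measurable_coord i))].
Qed.

Lemma dkernN n (x : 'cV[R]_n) : dkern (- x) = conjc (dkern x).
Proof.
rewrite /dkern rmorph_prod; apply: eq_bigr => i _.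
by rewrite mxE dkerN.
Qed.

Lemma normc_dkern_le n (x : 'cV[R]_n) : normc (dkern x) <= 4 ^+ n.
Proof.
rewrite normc_prod -[n in leRHS]card_ord -prodr_const; apply: ler_prod => i _.
by rewrite normc_ge0 normc_dker_le.
Qed.

Lemma cint_dkern_eq0 n (H : n.-tuple T -> R[i]) (delta : R) :
  cintegrable (leb n) H ->
  (forall u : 'cV[R]_n, (forall i, 0 <= u i 0 <= 1) ->
    cint (leb n) (fun t => H t * cis (delta * dotv (vec t) u)) = 0) ->
  cint (leb n) (fun t => H t * dkern (delta *: vec t)) = 0.
Proof.
move=> Hi Hcis.
(* The phase is averaged over the unit cube one coordinate at a time. *)
pose g (k : nat) (u : 'cV[R]_n) (i : 'I_n) (t : n.-tuple T) :=
  if (i < k)%N then dker (delta * vec t i 0) else cis (delta * vec t i 0 * u i 0).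
have mcoord i : measurable_fun setT (fun t : n.-tuple T => delta * vec t i 0 : T).
  by apply: measurable_funM => //; exact: measurable_coord.
have mg k u i : cmeas (g k u i).
  rewrite /g; case: (i < k)%N.
    have [m1 m2] := @cmeas_dker R.
    by split; [exact: (measurableT_comp m1 (mcoord i))|exact: (measurableT_comp m2 (mcoord i))].
  by apply: cmeas_cis; exact: (measurable_funM (mcoord i) (measurable_cst _)).
have ng k u i t : normc (g k u i t) <= 4.
  rewrite /g; case: ifP => _; last by rewrite normc_cis ler1n.
  exact: normc_dker_le.
have gi k u (r : seq 'I_n) (P : pred 'I_n) : cintegrable (leb n)
    (fun t => H t * \prod_(i <- r | P i) g k u i t).
  elim: r => [|i r ih]; first by under eq_fun do rewrite big_nil mulr1.
  under eq_fun do rewrite big_cons; case: (P i) => //.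
  by under eq_fun do rewrite mulrCA; exact: (cintegrableMl (mg k u i) (ng k u i)).
suff claim k : (k <= n)%N -> forall u : 'cV[R]_n, (forall i, 0 <= u i 0 <= 1) ->
    cint (leb n) (fun t => H t * \prod_i g k u i t) = 0.
  have u0 (i : 'I_n) : 0 <= (0 : 'cV[R]_n) i 0 <= 1 by rewrite mxE lexx ler01.
  rewrite -[RHS](claim n (leqnn n) 0 u0); congr cint; apply/funext => t.
  congr (_ * _); apply: eq_bigr => i _; rewrite /g ltn_ord; congr dker.
  by rewrite mxE.
elim: k => [_ u u01|k ih kn u u01].
  rewrite -[RHS](Hcis u u01); congr cint; apply/funext => t; congr (_ * _).
  rewrite /dotv mulr_sumr cis_sum; apply: eq_bigr => i _.
  by rewrite /g ltn0 mulrA.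
pose j := Ordinal kn.
have -> : (fun t => H t * \prod_i g k.+1 u i t) =
    (fun t => (H t * \prod_(i | i != j) g k u i t) * dker (delta * vec t j 0)).
  apply/funext => t; rewrite -mulrA; congr (_ * _).
  rewrite (bigD1 j)//= mulrC; congr (_ * _).
    apply: eq_bigr => i ij; rewrite /g ltnS leq_eqVlt.
    by move: ij; rewrite -val_eqE /= => /negbTE ->.
  by rewrite /g /= ltnSn.
apply: cint_dker_eq0 => // tau tau01.
pose u' : 'cV[R]_n := \col_i (if i == j then tau else u i 0).
have u'E i : u' i 0 = if i == j then tau else u i 0 by rewrite mxE.
have u'01 i : 0 <= u' i 0 <= 1 by rewrite u'E; case: ifP.
rewrite -[RHS](ih (ltnW kn) u' u'01); congr cint; apply/funext => t.
rewrite -mulrA; congr (_ * _); rewrite [RHS](bigD1 j)//= mulrC; congr (_ * _).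
  by rewrite /g ltnn u'E eqxx.
by apply: eq_bigr => i ij; rewrite /g u'E (negbTE ij).
Qed.

Definition sqdker (y : R) : R := normc (dker y) ^+ 2.

Lemma measurable_sqdker : measurable_fun setT (sqdker : T -> R).
Proof. by apply: measurable_funX; exact: measurable_normc (@cmeas_dker R). Qed.

Lemma integral_sqdker_lty : (\int[@lebesgue_measure R]_y (sqdker y)%:E < +oo)%E.
Proof.
apply: (@le_lt_trans _ _ (\int[@lebesgue_measure R]_y (13%:E * (cauchy y)%:E))%E).
  apply: ge0_le_integral => //.
  - by move=> y _; rewrite lee_fin sqr_ge0.
  - by apply/measurable_EFinP; exact: measurable_sqdker.
  - by apply: measurable_funeM; apply/measurable_EFinP; exact: measurable_cauchy.
  - by move=> y _; rewrite -EFinM lee_fin dker_bound.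
rewrite ge0_integralZl//; last 2 first.
- by apply/measurable_EFinP; exact: measurable_cauchy.
- by move=> y _; rewrite lee_fin ltW// cauchy_gt0.
have := integral_cauchy_lty R; rewrite -ge0_fin_numE; last first.
  by apply: integral_ge0 => x _; rewrite lee_fin ltW// cauchy_gt0.
by move=> /fineK <-; rewrite -EFinM ltry.
Qed.

Lemma integral_sqdker_gt0 : (0 < \int[@lebesgue_measure R]_y (sqdker y)%:E)%E.
Proof.
rewrite lt_neqAle eq_sym integral_ge0 ?andbT; last first.
  by move=> y _; rewrite lee_fin sqr_ge0.
apply/negP => /eqP E0.
have ms : measurable_fun setT (fun y : T => (sqdker y)%:E).
  by apply/measurable_EFinP; exact: measurable_sqdker.
have [/(_ _)] := @ae_eq_integral_abs _ _ _ (@lebesgue_measure R) setT measurableT _ ms.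
under eq_integral do rewrite gee0_abs ?lee_fin ?sqr_ge0//.
move=> /(_ E0) [N [mN N0 sN]] _.
have : (lebesgue_measure (`]0%R, pi[%classic : set R) <= lebesgue_measure N)%E.
  apply: le_measure; rewrite ?inE//.
  apply: subset_trans sN => y /=; rewrite in_itv/= => y0pi /(_ I) [/eqP].
  by rewrite expf_eq0/= => /eqP/eq0_normc/eqP; rewrite (negbTE (dker_neq0 y0pi)).
have := @lebesgue_measure_itv R `]0%R, pi[; rewrite /= lte_fin pi_gt0 oppr0 adde0.
by move=> ->; rewrite N0 lee_fin leNgt pi_gt0.
Qed.

Let integral_sqdkern n :
  (\int[leb n]_t (normc (dkern (vec t)) ^+ 2)%:E =
   (\int[@lebesgue_measure R]_y (sqdker y)%:E) ^+ n)%E.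
Proof.
rewrite -integral_prod; last 2 first.
- exact: measurable_sqdker.
- by move=> y; exact: sqr_ge0.
apply: eq_integral => t _; rewrite normc_prod -prodrXl; congr EFin.
by apply: eq_bigr => i _; rewrite mxE.
Qed.

Let sqdker_fin : (\int[@lebesgue_measure R]_y (sqdker y)%:E)%E \is a fin_num.
Proof. by rewrite ge0_fin_numE ?integral_sqdker_lty// ltW// integral_sqdker_gt0. Qed.

Lemma integrable_sqdkern n :
  (leb n).-integrable setT (EFin \o (fun t => normc (dkern (vec t)) ^+ 2)).
Proof.
apply/integrableP; split.
  by apply/measurable_EFinP; apply: measurable_funX; exact: measurable_normc (@cmeas_dkern n).
under eq_integral do rewrite gee0_abs ?lee_fin ?sqr_ge0//.
by rewrite integral_sqdkern -(fineK sqdker_fin) -EFin_expe ltry.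
Qed.

Lemma Rintegral_sqdkern_gt0 n : 0 < \int[leb n]_t (normc (dkern (vec t)) ^+ 2).
Proof.
rewrite /Rintegral integral_sqdkern -(fineK sqdker_fin) -EFin_expe /= exprn_gt0//.
by rewrite -lte_fin fineK// integral_sqdker_gt0.
Qed.

End Averaging.

(** * Orthogonality of functions with disjoint spectra *)

Section ComplexDominatedConvergence.
Context d (X : measurableType d) (R : realType).
Variable mu : {measure set X -> \bar R}.

Definition ccvg (u : nat -> R[i]) (l : R[i]) :=
  ((fun m => complex.Re (u m)) @ \oo --> complex.Re l) /\
  ((fun m => complex.Im (u m)) @ \oo --> complex.Im l).

Lemma ccvgM u v a b : ccvg u a -> ccvg v b -> ccvg (fun m => u m * v m) (a * b).
Proof.
move=> [u1 u2] [v1 v2]; split.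
- under eq_fun do rewrite Re_mul; rewrite Re_mul.
  by apply: cvgB; apply: cvgM.
- under eq_fun do rewrite Im_mul; rewrite Im_mul.
  by apply: cvgD; apply: cvgM.
Qed.

Lemma ccvg_cst a : ccvg (fun=> a) a.
Proof. by split; exact: cvg_cst. Qed.

Lemma ccvgJ u a : ccvg u a -> ccvg (fun m => conjc (u m)) (conjc a).
Proof.
move=> [u1 u2]; split.
- by under eq_fun do rewrite Re_conjc; rewrite Re_conjc.
- by under eq_fun do rewrite Im_conjc; rewrite Im_conjc; exact: cvgN.
Qed.

Lemma ccvg_unique u a b : ccvg u a -> ccvg u b -> a = b.
Proof.
by move=> [u1 u2] [v1 v2]; apply: complexP;
  [exact: (cvg_unique _ u1 v1)|exact: (cvg_unique _ u2 v2)].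
Qed.

Let Rintegral_dct (f_ : nat -> X -> R) (f g : X -> R) :
  (forall m, measurable_fun setT (f_ m)) ->
  (forall x, (fun m => f_ m x) @ \oo --> f x) ->
  (forall m x, `|f_ m x| <= g x) -> mu.-integrable setT (EFin \o g) ->
  (fun m => \int[mu]_x f_ m x) @ \oo --> \int[mu]_x f x.
Proof.
move=> mf ff fg ig.
have mfl : measurable_fun setT f by apply: (measurable_fun_cvg mf) => x _; exact: ff.
have [|||//||i0 _ c] := @dominated_convergence _ _ _ mu setT measurableT
  (fun m x => (f_ m x)%:E) (EFin \o f) (EFin \o g).
- by move=> m; exact/measurable_EFinP.
- exact/measurable_EFinP.
- by apply: aeW => x _; apply: cvg_EFin; [exact: nearW|exact: ff].
- by apply: aeW => x m _; rewrite /= lee_fin.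
apply: fine_cvg; rewrite fineK//.
exact: (integrable_fin_num measurableT i0).
Qed.

Lemma cint_dct (f_ : nat -> X -> R[i]) (f : X -> R[i]) (g : X -> R) :
  (forall m, cmeas (f_ m)) -> (forall x, ccvg (fun m => f_ m x) (f x)) ->
  (forall m x, normc (f_ m x) <= g x) -> mu.-integrable setT (EFin \o g) ->
  ccvg (fun m => cint mu (f_ m)) (cint mu f).
Proof.
move=> mf ff fg ig; split.
- apply: (Rintegral_dct (g := g)) => // [m|x|m x].
  + by case: (mf m).
  + by case: (ff x).
  + exact: le_trans (le_Re_normc _) _.
- apply: (Rintegral_dct (g := g)) => // [m|x|m x].
  + by case: (mf m).
  + by case: (ff x).
  + exact: le_trans (le_Im_normc _) _.
Qed.

End ComplexDominatedConvergence.

Lemma conjcM (R : realType) (x y : R[i]) : conjc (x * y) = conjc x * conjc y.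
Proof. exact: rmorphM. Qed.

Section DotProduct.
Context (R : realType) (n : nat).
Implicit Types x y z : 'cV[R]_n.

Lemma dotvC x y : dotv x y = dotv y x.
Proof. by apply: eq_bigr => i _; rewrite mulrC. Qed.

Lemma dotvDl x y z : dotv (x + y) z = dotv x z + dotv y z.
Proof. by rewrite -big_split/=; apply: eq_bigr => i _; rewrite mxE mulrDl. Qed.

Lemma dotvZl a x y : dotv (a *: x) y = a * dotv x y.
Proof. by rewrite mulr_sumr; apply: eq_bigr => i _; rewrite mxE mulrA. Qed.

Lemma dotvZr a x y : dotv x (a *: y) = a * dotv x y.
Proof. by rewrite dotvC dotvZl dotvC. Qed.

Lemma dotvDr x y z : dotv x (y + z) = dotv x y + dotv x z.
Proof. by rewrite dotvC dotvDl !(dotvC _ x). Qed.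

Lemma dotvBr x y z : dotv x (y - z) = dotv x y - dotv x z.
Proof. by rewrite -scaleN1r dotvDr dotvZr mulN1r. Qed.

Lemma dotvBl x y z : dotv (x - y) z = dotv x z - dotv y z.
Proof. by rewrite dotvC dotvBr !(dotvC z). Qed.

Lemma measurable_dotv (xi : 'cV[R]_n) : measurable_fun setT
  (fun t : n.-tuple (measurableTypeR R) => dotv (vec t) xi : measurableTypeR R).
Proof.
apply: measurable_sum => i; apply: measurable_funM => //.
exact: measurable_coord.
Qed.

Lemma cint_cis_fourier (phi : 'cV[R]_n -> R[i]) eta :
  cint (lebesgue R n) (fun t => phi (vec t) * cis (dotv (vec t) eta)) =
  fourier phi (- (2 * pi)^-1 *: eta).
Proof.
rewrite /fourier; congr cint; apply/funext => t.
rewrite dotvZr mulrA mulrN divff ?mulN1r; last first.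
  by rewrite mulf_neq0 ?gt_eqF ?pi_gt0.
by rewrite cosN sinN opprK.
Qed.

End DotProduct.

(* A substitute for Plancherel: the Fourier transform of the correlation of
   [phi1] and [phi2] vanishes, hence so does the integral of the correlation at
   scale [eps] against the positive kernel [normc (dkern z) ^+ 2]; the latter
   integral tends to a positive multiple of the inner product as [eps] -> 0. *)
Section DisjointSpectra.
Context (R : realType) (n : nat).
Local Notation T := (measurableTypeR R).
Local Notation leb := (lebesgue R n).
Variables (phi1 phi2 : 'cV[R]_n -> R[i]) (M : R).
Hypothesis i1 : cintegrable leb (phi1 \o @vec R n).
Hypothesis i2 : cintegrable leb (phi2 \o @vec R n).
Hypothesis b2 : forall x, normc (phi2 x) <= M.
Hypothesis c2 : forall x z,
  ccvg (fun m => phi2 (x - m.+1%:R^-1 *: z)) (phi2 x).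
Hypothesis disj : forall xi, fourier phi1 xi = 0 \/ fourier phi2 xi = 0.

Section Correlation.
Variable eps : R.
Hypothesis eps_neq0 : eps != 0.

Let comb (p : n.-tuple T * n.-tuple T) : n.-tuple T :=
  [tuple (tnth p.1 i - eps * tnth p.2 i : T) | i < n].

Let vec_comb p : vec (comb p) = vec p.1 - eps *: vec p.2.
Proof. by apply/colP => i; rewrite !mxE tnth_mktuple. Qed.

Let measurable_comb : measurable_fun setT comb.
Proof.
apply/measurable_fun_tnthP => i.
rewrite (_ : _ \o _ = fun p => tnth p.1 i - eps * tnth p.2 i).
  apply: measurable_funB.
    exact: (measurableT_comp (measurable_tnth i) measurable_fst).
  apply: measurable_funM => //.
  exact: (measurableT_comp (measurable_tnth i) measurable_snd).
by apply/funext => p /=; rewrite tnth_mktuple.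
Qed.

Let unit_eps : (- eps)%:M \in @unitmx R n.
Proof. by rewrite unitmxE det_scalar unitrX// unitfE oppr_eq0. Qed.

Let combE t z : comb (t, z) = affm (- eps)%:M (vec t) z.
Proof.
by apply: vec_inj; rewrite vec_comb vec_affm mul_scalar_mx scaleNr addrC.
Qed.

Definition corr (z : n.-tuple T) : R[i] :=
  cint leb (fun t => phi1 (vec t) * conjc (phi2 (vec t - eps *: vec z))).

Let F xi (p : n.-tuple T * n.-tuple T) :=
  phi1 (vec p.1) * (conjc (phi2 (vec p.1 - eps *: vec p.2)) * cis (dotv (vec p.2) xi)).

Let cmF xi : cmeas (F xi).
Proof.
have [m1 m1'] := cintegrable_cmeas i1; have [m2 m2'] := cintegrable_cmeas i2.
apply: cmeasM; first by split; [exact: (measurableT_comp m1 measurable_fst)|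
  exact: (measurableT_comp m1' measurable_fst)].
apply: cmeasM; last first.
  by apply: cmeas_cis; exact: (measurableT_comp (measurable_dotv xi) measurable_snd).
under eq_fun do rewrite -vec_comb.
by apply: cmeasJ; split; [exact: (measurableT_comp m2 measurable_comb)|
  exact: (measurableT_comp m2' measurable_comb)].
Qed.

Let i2t t : cintegrable leb (fun z => conjc (phi2 (vec t - eps *: vec z))).
Proof.
have := scales_by_cintegrable (scales_by_affm (vec t) unit_eps) (cintegrableJ i2).
by congr cintegrable; apply/funext => z /=; rewrite -combE vec_comb.
Qed.

Let i2tc t xi : cintegrable leb
  (fun z => conjc (phi2 (vec t - eps *: vec z)) * cis (dotv (vec z) xi)).
Proof.
under eq_fun do rewrite mulrC.
apply: (cintegrableMl (M := 1)) => //.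
  by apply: cmeas_cis; exact: measurable_dotv.
by move=> z; rewrite normc_cis.
Qed.

Let Foo xi : (\int[leb]_t \int[leb]_z (normc (F xi (t, z)))%:E < +oo)%E.
Proof.
pose k : R := `|\det ((- eps)%:M : 'M[R]_n)|^-1.
have [_ n1] := integrableP _ _ _ (cintegrable_norm i1).
have mn2' := measurable_normc (cintegrable_cmeas i2).
have [mn2 n2] := integrableP _ _ _ (cintegrable_norm i2).
have inner t : (\int[leb]_z (normc (F xi (t, z)))%:E =
    (normc (phi1 (vec t)))%:E * (k%:E * \int[leb]_z `|(normc (phi2 (vec z)))%:E|))%E.
  have [_ <-] := scales_by_affm (vec t) unit_eps; last 2 first.
  - by apply: measurableT_comp.
  - by move=> z; exact: abse_ge0.
  rewrite -ge0_integralZl//; last 2 first.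
  - do 2 apply: measurableT_comp => //.
    exact: (measurableT_comp mn2' (measurable_affm (- eps)%:M (vec t))).
  - by rewrite lee_fin normc_ge0.
  apply: eq_integral => z _.
  rewrite /F !normcM normc_conj normc_cis mulr1 -combE vec_comb EFinM.
  by rewrite gee0_abs// lee_fin normc_ge0.
under eq_integral do rewrite inner.
have ffin : (k%:E * \int[leb]_z `|(normc (phi2 (vec z)))%:E|)%E \is a fin_num.
  by rewrite fin_numM// ge0_fin_numE// integral_ge0.
rewrite -(fineK ffin) ge0_integralZr//.
- under eq_integral do rewrite -[(_%:E)%E]gee0_abs ?lee_fin ?normc_ge0//.
  have n1f : (\int[leb]_x `|(normc (phi1 (vec x)))%:E|)%E \is a fin_num.
    by rewrite ge0_fin_numE// integral_ge0.
  by rewrite -(fineK n1f) -EFinM ltry.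
- by apply/measurable_EFinP/measurable_normc; exact: (cintegrable_cmeas i1).
- by move=> x _; rewrite lee_fin normc_ge0.
- rewrite lee_fin fine_ge0// mule_ge0 ?integral_ge0//.
  by rewrite lee_fin invr_ge0.
Qed.

Let F2 xi z : cintegrable leb (fun t => F xi (t, z)).
Proof.
rewrite /F/=; under eq_fun do rewrite mulrC.
apply: (cintegrableMl (M := M)) => //; last first.
  by move=> t; rewrite normcM normc_cis mulr1 normc_conj.
apply: cmeasM; last exact: cmeas_cst.
have [m2 m2'] := cintegrable_cmeas i2.
have mc : measurable_fun setT (fun t => comb (t, z)).
  by apply: (measurableT_comp measurable_comb); exact: measurable_fun_pair.
apply: cmeasJ; split.
- by under eq_fun do rewrite -(vec_comb (_, z)); exact: (measurableT_comp m2 mc).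
- by under eq_fun do rewrite -(vec_comb (_, z)); exact: (measurableT_comp m2' mc).
Qed.

Let F1 xi t : cintegrable leb (fun z => F xi (t, z)).
Proof. by rewrite /F/=; apply: cintegrableZ; exact: i2tc. Qed.

Lemma cintegrable_corr_section z : cintegrable leb
  (fun t => phi1 (vec t) * conjc (phi2 (vec t - eps *: vec z))).
Proof.
have := F2 0 z; rewrite /F/=; congr cintegrable; apply/funext => t.
by rewrite -[0](scale0r 0) dotvZr mul0r cis0 mulr1.
Qed.

Let corrE xi : (fun z => cint leb (fun t => F xi (t, z))) =
  (fun z => corr z * cis (dotv (vec z) xi)).
Proof.
apply/funext => z; rewrite /corr/F/= mulrC -cintZ.
  by congr cint; apply/funext => t; ring.
exact: cintegrable_corr_section.
Qed.

Lemma cintegrable_corr : cintegrable leb corr.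
Proof.
have [_ + _] := cint_Fubini (cmF 0) (Foo 0) (F1 0) (F2 0).
rewrite corrE; congr cintegrable; apply/funext => z.
by rewrite -[0](scale0r 0) dotvZr mul0r cis0 mulr1.
Qed.

Lemma normc_corr z : normc (corr z) <= 2 * (M * \int[leb]_t normc (phi1 (vec t))).
Proof.
have ic := cintegrable_corr_section z.
rewrite (le_trans (normc_cint ic))// ler_wpM2l//.
rewrite -RintegralZl//; last exact: cintegrable_norm i1.
apply: le_Rintegral => //.
- exact: cintegrable_norm.
- exact: (integrableZl measurableT M (cintegrable_norm i1)).
- by move=> t _; rewrite normcM normc_conj mulrC ler_wpM2r ?normc_ge0.
Qed.

(** Integrating over z first and substituting y = t - eps z turns the phase into that of t at eta =
    xi / eps times the conjugate phase of y at eta. The double integral thus factors into the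
    transform of [phi1] and the conjugate transform of [phi2] at one and the same frequency, where
    one of them vanishes. *)
Lemma corr_fourier0 xi :
  cint leb (fun z => corr z * cis (dotv (vec z) xi)) = 0.
Proof.
have [_ _ ] := cint_Fubini (cmF xi) (Foo xi) (F1 xi) (F2 xi).
rewrite corrE => <-.
pose eta := eps^-1 *: xi.
pose k : R := `|\det ((- eps)%:M : 'M[R]_n)|^-1.
have inner t : cint leb (fun z => F xi (t, z)) =
    phi1 (vec t) * cis (dotv (vec t) eta) *
    (k%:C * conjc (cint leb (fun y => phi2 (vec y) * cis (dotv (vec y) eta)))).
  have i2c : cintegrable leb (fun y => phi2 (vec y) * cis (dotv (vec y) eta)).
    under eq_fun do rewrite mulrC; apply: (cintegrableMl (M := 1)) => //.
      by apply: cmeas_cis; exact: measurable_dotv.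
    by move=> z; rewrite normc_cis.
  rewrite -cintJ// -(scales_by_cint (scales_by_affm (vec t) unit_eps)); last first.
    exact: cintegrableJ.
  rewrite /F/= -cintZ; last first.
    exact/(scales_by_cintegrable (scales_by_affm (vec t) unit_eps))/cintegrableJ.
  congr cint; apply/funext => z /=; rewrite -mulrA; congr (_ * _).
  rewrite -combE vec_comb conjcM mulrCA; congr (_ * _).
  rewrite -cisN -cisD; congr cis.
  by rewrite /eta dotvBl !dotvZr dotvZl; field.
under eq_fun do rewrite inner mulrC.
rewrite cintZ; last first.
  under eq_fun do rewrite mulrC; apply: (cintegrableMl (M := 1)) => //.
    by apply: cmeas_cis; exact: measurable_dotv.
  by move=> z; rewrite normc_cis.
rewrite !cint_cis_fourier.
by case: (disj (- (2 * pi)^-1 *: eta)) => ->; rewrite ?conjc0 ?mulr0 ?mul0r.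
Qed.

(** The squared modulus is [dkern] times its conjugate, the kernel at -z, so averaging the phases
    twice, with dilations -1 and 1, reduces to [corr_fourier0]. Squaring yields an integrable kernel
    with positive integral. *)
Lemma corr_dkern0 : cint leb (fun z => corr z * (normc (dkern (vec z)) ^+ 2)%:C) = 0.
Proof.
have icis u : cintegrable leb (fun z => corr z * cis (dotv (vec z) u)).
  under eq_fun do rewrite mulrC; apply: (cintegrableMl (M := 1)).
  - by apply: cmeas_cis; exact: measurable_dotv.
  - by move=> z; rewrite normc_cis.
  - exact: cintegrable_corr.
have H1 u : cint leb
    (fun z => corr z * cis (dotv (vec z) u) * dkern (-1 *: vec z)) = 0.
  apply: cint_dkern_eq0 => // w _.
  rewrite -[RHS](corr_fourier0 (u - w)); congr cint; apply/funext => z.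
  by rewrite -mulrA -cisD dotvBr mulN1r.
have : cint leb (fun z => corr z * conjc (dkern (vec z)) * dkern (1 *: vec z)) = 0.
  apply: cint_dkern_eq0.
    under eq_fun do rewrite mulrC; apply: (cintegrableMl (M := 4 ^+ n)).
    - by apply: cmeasJ; exact: cmeas_dkern.
    - by move=> z; rewrite normc_conj normc_dkern_le.
    - exact: cintegrable_corr.
  move=> u _; rewrite -[RHS](H1 u); congr cint; apply/funext => z.
  by rewrite mul1r scaleN1r dkernN mulrAC.
move=> E; rewrite -[RHS]E; congr cint; apply/funext => z.
by rewrite -mulrA scale1r mulJ_normc.
Qed.

End Correlation.

Lemma cint_disjoint_spectra :
  cint leb (fun t => phi1 (vec t) * conjc (phi2 (vec t))) = 0.
Proof.
set h0 := cint _ _; pose eps m : R := m.+1%:R^-1.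
have e0 m : eps m != 0 by rewrite invr_eq0 pnatr_eq0.
have corr_cvg z : ccvg (fun m => corr (eps m) z) h0.
  apply: (cint_dct (g := fun t => M * normc (phi1 (vec t)))).
  - by move=> m; exact: (cintegrable_cmeas (cintegrable_corr_section (eps m) z)).
  - by move=> t; apply: ccvgM; [exact: ccvg_cst|exact/ccvgJ/c2].
  - by move=> m t; rewrite normcM normc_conj mulrC ler_wpM2r ?normc_ge0.
  - exact: (integrableZl measurableT M (cintegrable_norm i1)).
pose K (z : n.-tuple T) := normc (dkern (vec z)) ^+ 2.
have iK : leb.-integrable setT (EFin \o K) by exact: integrable_sqdkern.
have cK : cintegrable leb (fun z => (K z)%:C).
  apply: (cintegrable_le _ _ iK).
    by apply: cmeas_real; have /measurable_int/measurable_EFinP := iK.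
  by move=> z; rewrite normc_real ger0_norm// sqr_ge0.
have : ccvg (fun m => cint leb (fun z => corr (eps m) z * (K z)%:C))
    (cint leb (fun z => h0 * (K z)%:C)).
  pose B := 2 * (M * \int[leb]_t normc (phi1 (vec t))).
  apply: (cint_dct (g := fun z => B * K z)).
  - move=> m; apply: cmeasM; first exact: (cintegrable_cmeas (cintegrable_corr (e0 m))).
    exact: (cintegrable_cmeas cK).
  - by move=> z; apply: ccvgM => //; exact: ccvg_cst.
  - move=> m z; rewrite normcM normc_real ger0_norm ?sqr_ge0//.
    by rewrite ler_wpM2r ?sqr_ge0// normc_corr.
  - exact: (integrableZl measurableT B iK).
have -> : (fun m => cint leb (fun z => corr (eps m) z * (K z)%:C)) = fun=> 0.
  by apply/funext => m; exact: corr_dkern0.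
move=> /(ccvg_unique (ccvg_cst 0)); rewrite cintZ// => /esym/eqP.
rewrite mulf_eq0 => /orP[/eqP //|/eqP /(congr1 (@complex.Re R))/= K0].
by have := Rintegral_sqdkern_gt0 R n; rewrite -/(K) K0 ltxx.
Qed.

End DisjointSpectra.

(** * Annuli under the dilation *)

Section EuclideanNorm.
Context (R : realType) (n : nat).
Implicit Types x y : 'cV[R]_n.

Lemma dotv_ge0 x : 0 <= dotv x x.
Proof. by apply: sumr_ge0 => i _; rewrite -expr2 sqr_ge0. Qed.

Lemma enorm_ge0 x : 0 <= enorm x.
Proof. exact: sqrtr_ge0. Qed.

Lemma enorm_sqr x : enorm x ^+ 2 = dotv x x.
Proof. by rewrite sqr_sqrtr ?dotv_ge0. Qed.

Lemma enormZ a x : enorm (a *: x) = `|a| * enorm x.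
Proof. by rewrite /enorm dotvZl dotvZr mulrA -expr2 sqrtrM ?sqr_ge0// sqrtr_sqr. Qed.

Lemma enorm_eq0 x : enorm x = 0 -> x = 0.
Proof.
move=> x0; apply/colP => i; rewrite mxE.
have := enorm_sqr x; rewrite x0 expr0n/= => /esym/eqP.
rewrite psumr_eq0 => [/allP/(_ i)|j _]; last by rewrite -expr2 sqr_ge0.
by rewrite mem_index_enum => /(_ isT); rewrite /= mulf_eq0 orbb => /eqP.
Qed.

Lemma dotv_le_enorm x y : dotv x y <= enorm x * enorm y.
Proof.
have [/enorm_eq0 ->|x0] := eqVneq (enorm x) 0.
  by rewrite /dotv big1 ?mulr_ge0 ?enorm_ge0// => i _; rewrite mxE mul0r.
have [/enorm_eq0 ->|y0] := eqVneq (enorm y) 0.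
  by rewrite /dotv big1 ?mulr_ge0 ?enorm_ge0// => i _; rewrite mxE mulr0.
have xy0 : 0 < enorm x * enorm y.
  by rewrite mulr_gt0// lt_neqAle eq_sym ?x0 ?y0 enorm_ge0.
have := dotv_ge0 (enorm y *: x - enorm x *: y).
rewrite dotvBl !dotvBr !dotvZl !dotvZr -!enorm_sqr (dotvC y x) => h.
by rewrite -(ler_pM2l xy0); nra.
Qed.

Lemma enormD x y : enorm (x + y) <= enorm x + enorm y.
Proof.
rewrite -(ler_pXn2r (n := 2))// ?nnegrE ?addr_ge0 ?enorm_ge0//.
rewrite enorm_sqr dotvDl !dotvDr (dotvC y x) sqrrD !enorm_sqr.
by have := dotv_le_enorm x y; lra.
Qed.

(** The constant is the Frobenius norm, by Cauchy-Schwarz on each row. *)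
Lemma enorm_mulmx (M : 'M[R]_n) :
  exists2 c, 0 <= c & forall x, enorm (M *m x) <= c * enorm x.
Proof.
pose c := Num.sqrt (\sum_i dotv (row i M)^T (row i M)^T).
exists c => [|x]; first exact: sqrtr_ge0.
rewrite -(ler_pXn2r (n := 2))// ?nnegrE ?mulr_ge0 ?enorm_ge0 ?sqrtr_ge0//.
have c2 : c ^+ 2 = \sum_i dotv (row i M)^T (row i M)^T.
  by rewrite sqr_sqrtr// sumr_ge0// => i _; exact: dotv_ge0.
rewrite exprMn c2 {1}enorm_sqr mulr_suml; apply: ler_sum => i _.
have -> : (M *m x) i 0 = dotv (row i M)^T x.
  by rewrite mxE; apply: eq_bigr => j _; rewrite !mxE.
set w := (row i M)^T.
have h1 := dotv_le_enorm w x.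
have := dotv_le_enorm (- w) x.
rewrite -[- w]scaleN1r dotvZl mulN1r enormZ normrN1 mul1r => h2.
rewrite -enorm_sqr -exprMn -expr2.
rewrite -[leLHS]real_normK ?num_real// ler_pXn2r// ?nnegrE ?mulr_ge0 ?enorm_ge0//.
by rewrite ler_norml h1 andbT; lra.
Qed.

Lemma dotv_mulmx (M : 'M[R]_n) x y : dotv (M *m x) y = dotv x (M^T *m y).
Proof.
rewrite /dotv; under eq_bigr do rewrite mxE big_distrl/=.
rewrite exchange_big/=; apply: eq_bigr => j _.
rewrite mxE big_distrr/=; apply: eq_bigr => i _; rewrite mxE; ring.
Qed.

Lemma enorm_unit_cube x : (forall i, 0 <= x i 0 <= 1) -> enorm x <= n%:R + 1.
Proof.
move=> x01; rewrite -(ler_pXn2r (n := 2))// ?nnegrE ?addr_ge0 ?enorm_ge0//.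
rewrite enorm_sqr (@le_trans _ _ (\sum_(i < n) 1))//.
  by apply: ler_sum => i _; have /andP[? ?] := x01 i; rewrite mulr_ile1.
rewrite sumr_const card_ord; have := ler0n R n; nra.
Qed.

End EuclideanNorm.

(** Bernoulli's inequality gives at least linear growth. *)
Lemma expr_unbounded (R : realType) (c t : R) : 1 < t ->
  exists N, forall m, (N <= m)%N -> c < t ^+ m.
Proof.
move=> t1; have bern m : 1 + (t - 1) * m%:R <= t ^+ m.
  elim: m => [|m ih]; first by rewrite mulr0 addr0.
  rewrite exprS; have := ler_wpM2l (ltW (lt_trans ltr01 t1)) ih.
  have : 0 <= (t - 1) ^+ 2 * m%:R by rewrite mulr_ge0 ?sqr_ge0.
  by rewrite -natr1; nra.
have t10 : 0 < t - 1 by rewrite subr_gt0.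
exists (Num.bound `|c / (t - 1)|) => m Nm; apply: lt_le_trans (bern m).
have : c / (t - 1) < m%:R.
  rewrite (le_lt_trans (ler_norm _))// (lt_le_trans (archi_boundP _))//.
  by rewrite ler_nat.
by rewrite ltr_pdivrMr// mulrC; lra.
Qed.

Section Contraction.
Context (R : realType) (n : nat).
Variables (A : 'M[R]_n.+1) (Delta : set 'cV[R]_n.+1).
Hypothesis AD : dilation_ellipsoid A Delta.

(** The image of [A] contains t Delta, a neighbourhood of 0, and is a linear subspace; so [A] is
    surjective. *)
Lemma dilation_unitmx : A \in unitmx.
Proof.
have [[P _ ->] _ [t [t1 _ tA]]] := AD.
have t0 : 0 < t by rewrite (lt_trans ltr01).
have surj (x : 'cV_n.+1) : exists y, A *m y = x.
  pose c := (enorm (P *m x) + 1)^-1.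
  have c0 : 0 < c by rewrite invr_gt0 ltr_wpDl ?enorm_ge0.
  have /tA[y _ yE] : [set t *: y | y in [set x | enorm (P *m x) < 1]] (t *: (c *: x)).
    exists (c *: x) => //=; rewrite -scalemxAr enormZ gtr0_norm//.
    by rewrite mulrC ltr_pdivrMr ?mul1r ?ltrDl// ltr_wpDl ?enorm_ge0.
  exists ((t * c)^-1 *: y); rewrite -scalemxAr yE !scalerA -mulrA mulVf ?scale1r//.
  by rewrite mulf_neq0 ?gt_eqF.
have /choice[f fE] := fun i : 'I_n.+1 => surj (delta_mx i 0).
have : A *m (\matrix_(i, j) f j i 0) = 1%:M.
  apply/matrixP => i j; have /matrixP/(_ i 0) := fE j.
  rewrite !mxE eqxx andbT => <-; apply: eq_bigr => k _; by rewrite mxE.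
by move=> /mulmx1_unit[].
Qed.

Lemma trmx_exprzB (j k : int) : (A ^ (j + k))^T = (A ^ k)^T *m (A ^ j)^T.
Proof. by rewrite exprzDr ?dilation_unitmx// -mulmxE trmx_mul. Qed.

(** The inclusion of t Delta in A Delta says that A^-1 shrinks the gauge [q] of Delta by the factor
    1 / t. Iterating and comparing [q] with the Euclidean norm through P and its inverse gives the
    bound for A^-m; duality transfers it to the transpose. *)
Lemma dilation_contraction : exists K t : R, [/\ 0 < K, 1 < t &
  forall (m : nat) x, enorm ((A ^- m)^T *m x) <= K * t ^- m * enorm x].
Proof.
have uA := dilation_unitmx.
have [[P uP D] _ [t [t1 _ tA]]] := AD.
have t0 : 0 < t by rewrite (lt_trans ltr01).
pose q (x : 'cV_n.+1) := enorm (P *m x).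
have q1 x : q (A^-1 *m x) <= t^-1 * q x.
  apply/ler_addgt0Pr => e e0.
  (* Delta is open, so x must be divided by slightly more than its gauge to land inside; the excess
     becomes e after division by t. *)
  pose c := q x + e * t.
  have c0 : 0 < c by rewrite ltr_wpDl ?enorm_ge0// mulr_gt0.
  have /tA[y yD yE] : [set t *: y | y in Delta] (t *: (c^-1 *: x)).
    exists (c^-1 *: x) => //; rewrite D/= -scalemxAr enormZ gtr0_norm ?invr_gt0//.
    by rewrite mulrC ltr_pdivrMr// mul1r ltrDl mulr_gt0.
  have -> : A^-1 *m x = (c / t) *: y.
    have -> : y = A^-1 *m (t *: (c^-1 *: x)) by rewrite -yE mulKmx.
    rewrite -!scalemxAr !scalerA -[LHS]scale1r; congr (_ *: _).
    by field; rewrite !gt_eqF.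
  rewrite /q -scalemxAr enormZ gtr0_norm ?divr_gt0//.
  move: yD; rewrite D/= => /ltW yq.
  rewrite (@le_trans _ _ (c / t))//; first by rewrite ler_piMr// ltW// divr_gt0.
  by rewrite /c mulrDl mulfK ?gt_eqF// mulrC.
have qm m x : q (A ^- m *m x) <= t ^- m * q x.
  elim: m x => [|m ih] x; first by rewrite !expr0 !invr1 mul1mx mul1r.
  rewrite exprS invrM ?unitrX// -mulmxE -mulmxA.
  rewrite (le_trans (ih _))// [in leRHS]exprSr invfM -mulrA.
  by apply: ler_wpM2l; [rewrite invr_ge0 exprn_ge0 ?ltW|exact: q1].
have [c1 c10 hc1] := enorm_mulmx P.
have [c2 c20 hc2] := enorm_mulmx (invmx P).
exists (c1 * c2 + 1), t; split => //; first by rewrite ltr_wpDl// mulr_ge0.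
move=> m x; set w := _ *m x.
have [w0|w0] := eqVneq (enorm w) 0.
  by rewrite w0 !mulr_ge0 ?enorm_ge0 ?addr_ge0 ?mulr_ge0// invr_ge0 exprn_ge0 ?ltW.
have w_gt0 : 0 < enorm w by rewrite lt_neqAle eq_sym w0 enorm_ge0.
(* |w|^2 = <(A^-m)^T x, w> = <x, A^-m w>, which brings in the untransposed bound. *)
rewrite -(ler_pM2r w_gt0) -expr2 enorm_sqr /w dotv_mulmx trmxK -/w.
rewrite (le_trans (dotv_le_enorm _ _))//.
have h : enorm (A ^- m *m w) <= c2 * (t ^- m * (c1 * enorm w)).
  rewrite -[A ^- m *m w](mulKmx uP) (le_trans (hc2 _))// ler_wpM2l//.
  rewrite (le_trans (qm m w))// ler_wpM2l ?hc1//.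
  by rewrite invr_ge0 exprn_ge0 ?ltW.
rewrite (le_trans (ler_wpM2l (enorm_ge0 _) h))//.
have tm0 : 0 <= t ^- m by rewrite invr_ge0 exprn_ge0 ?ltW.
have xw : 0 <= enorm x * enorm w by rewrite mulr_ge0 ?enorm_ge0.
have : 0 <= t ^- m * (enorm x * enorm w) by rewrite mulr_ge0.
nra.
Qed.

(** J is chosen so that K s / t^d < r for d > J: that many further contractions carry the ball of
    radius s strictly inside radius r. *)
Lemma dilation_annulus_disjoint (r s : R) : 0 < r -> exists J : nat,
  forall (j : int) (d : nat) x, (J < d)%N ->
    enorm ((A ^ (- j))^T *m x) <= s -> enorm ((A ^ (- (j + d%:Z)))^T *m x) < r.
Proof.
move=> r0; have [K [t [K0 t1 Kt]]] := dilation_contraction.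
have [J HJ] := expr_unbounded (K * s / r) t1.
exists J => j d x Jd xs; rewrite opprD trmx_exprzB -mulmxA -exprnN.
have t0 : 0 < t by rewrite (lt_trans ltr01).
apply: (le_lt_trans (Kt _ _)); set y := enorm _ in xs *.
have td : 0 < t ^+ d by rewrite exprn_gt0.
apply: (@le_lt_trans _ _ (K * t ^- d * s)).
  by rewrite ler_wpM2l// mulr_ge0 ?ltW ?invr_gt0.
rewrite mulrAC ltr_pdivrMr// [r * _]mulrC -ltr_pdivrMr//.
exact/HJ/ltnW.
Qed.

(** On the eigenline one step multiplies the norm by |lambda| > s / r, enough to jump over the
    annulus. Off the line, the perturbation shrinks up to the factor K under negative powers but may
    grow under positive ones. From some power N on, however, the contraction bound read backwards
    shows that the norm of the whole vector does not decrease, so only the powers below N call for a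
    smallness condition. *)
Lemma eigen_annulus_gap (lambda : R) (v : 'cV_n.+1) (r s : R) : v != 0 ->
  A^T *m v = lambda *: v -> 0 < r -> r < s -> s / r < `|lambda| ->
  exists xi (delta : R), 0 < delta /\ forall (j : int) (u : 'cV_n.+1),
    (forall i, 0 <= u i 0 <= 1) ->
    let y := enorm ((A ^ (- j))^T *m (xi + delta *: u)) in y < r \/ s < y.
Proof.
move=> v0 Av r0 rs sr; have [K [t [K0 t1 Kt]]] := dilation_contraction.
have s0 : 0 < s by rewrite (lt_trans r0).
have l0 : lambda != 0 by rewrite -normr_gt0 (lt_trans _ sr)// divr_gt0.
have l1 : 1 < `|lambda| by rewrite (lt_trans _ sr)// ltr_pdivlMr// mul1r.
have srl : s < r * `|lambda| by move: sr; rewrite ltr_pdivrMr// mulrC.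
(* The midpoint of the interval from s to r |lambda|: the eigenvector is scaled to this norm. *)
pose rho := (s + r * `|lambda|) / 2.
have srho : s < rho by rewrite /rho; lra.
have rhor : rho / `|lambda| < r.
  by rewrite ltr_pdivrMr ?normr_gt0// /rho; lra.
have t0 : 0 < t by rewrite (lt_trans ltr01).
have [N HN] := expr_unbounded K t1.
have /choice[c cP] m : exists c : R, 0 <= c /\
    forall x, enorm ((A ^+ m)^T *m x) <= c * enorm x.
  by have [c c0 cP] := enorm_mulmx (A ^+ m)^T; exists c.
pose C := \sum_(m < N) c m.
have C0 : 0 <= C by apply: sumr_ge0 => m _; have [] := cP m.
have cC m : (m < N)%N -> c m <= C.
  move=> mN; rewrite /C (bigD1 (Ordinal mN))//= lerDl.
  by apply: sumr_ge0 => k _; have [] := cP k.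
pose D : R := n.+1%:R + 1.
have D0 : 0 < D by rewrite ltr_wpDl.
pose g := Num.min (r - rho / `|lambda|) (rho - s).
have g0 : 0 < g by rewrite lt_min !subr_gt0 rhor.
(* D bounds the norm on the unit cube. In K + C + 1, the term K covers the negative powers, C the
   positive powers below N, and 1 the unmoved vector; each error is then at most half the margin
   g. *)
pose delta := g / 2 / (D * (K + C + 1)).
have KC0 : 0 < K + C + 1 by rewrite ltr_wpDl// addr_ge0// ltW.
have delta0 : 0 < delta by rewrite !divr_gt0// mulr_gt0.
have dD : delta * D * (K + C + 1) = g / 2.
  by rewrite /delta -mulrA divfK// gt_eqF// mulr_gt0.
have dD0 : 0 < delta * D by rewrite mulr_gt0.
have g1 : g <= r - rho / `|lambda| by rewrite ge_min lexx.
have g2 : g <= rho - s by rewrite ge_min lexx orbT.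
have ev : 0 < enorm v.
  rewrite lt_neqAle enorm_ge0 andbT eq_sym; apply: contra_neq v0.
  exact: enorm_eq0.
pose xi := (rho / enorm v) *: v.
have exi : enorm xi = rho.
  rewrite enormZ ger0_norm; first by rewrite divfK ?gt_eqF.
  by rewrite divr_ge0 ?ltW// (lt_trans s0).
have Ax1 : A^T *m xi = lambda *: xi.
  by rewrite -scalemxAr Av !scalerA mulrC.
have Axi m : (A ^+ m)^T *m xi = lambda ^+ m *: xi.
  elim: m => [|m ih]; first by rewrite !expr0 trmx1 mul1mx scale1r.
  rewrite exprS -mulmxE trmx_mul -mulmxA Ax1 -scalemxAr ih scalerA.
  by rewrite -exprS.
have uA := dilation_unitmx.
have Axi' m : (A ^- m)^T *m xi = lambda ^- m *: xi.
  have : (A ^- m)^T *m ((A ^+ m)^T *m xi) = xi.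
    by rewrite mulmxA -trmx_mul mulmxE divrr ?unitrX// trmx1 mul1mx.
  rewrite Axi -scalemxAr => {2}<-.
  by rewrite scalerA mulVf ?scale1r// expf_neq0.
exists xi, delta; split => // j u u01 y.
have uD : enorm (delta *: u) <= delta * D.
  by rewrite enormZ gtr0_norm// ler_pM2l//; exact: enorm_unit_cube.
have big : s < enorm (xi + delta *: u).
  have : enorm xi <= enorm (xi + delta *: u) + enorm (- (delta *: u)).
    by rewrite (le_trans _ (enormD _ _))// addrK.
  rewrite exi -scaleN1r enormZ normrN1 mul1r => h.
  have : delta * D * 1 <= delta * D * (K + C + 1) by rewrite ler_pM2l//; lra.
  lra.
have pos (m : nat) : s < enorm ((A ^+ m)^T *m (xi + delta *: u)).
  (* For m >= N one has K / t^m < 1, so applying the inverse power to z cannot increase its norm,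
     and [big] passes from the original vector to z. *)
  have [Nm|mN] := leqP N m.
    set z := (A ^+ m)^T *m _.
    have zE : xi + delta *: u = (A ^- m)^T *m z.
      by rewrite /z mulmxA -trmx_mul mulmxE divrr ?unitrX// trmx1 mul1mx.
    rewrite zE in big; rewrite (lt_le_trans big)// (le_trans (Kt _ _))//.
    rewrite ler_piMl ?enorm_ge0// ler_pdivrMr ?exprn_gt0// mul1r ltW//.
    exact: HN.
  have : enorm ((A ^+ m)^T *m xi) <= enorm ((A ^+ m)^T *m (xi + delta *: u)) +
      enorm (- ((A ^+ m)^T *m (delta *: u))).
    by rewrite (le_trans _ (enormD _ _))// mulmxDr addrK.
  rewrite -scaleN1r [enorm (-1 *: _)]enormZ normrN1 mul1r Axi enormZ exi => h.
  have [cm0 /(_ (delta *: u)) h1] := cP m.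
  have h2 : c m * enorm (delta *: u) <= C * (delta * D).
    by rewrite ler_pM ?enorm_ge0// cC.
  have h3 : rho <= `|lambda ^+ m| * rho.
    rewrite ler_peMl ?(ltW (lt_trans s0 srho))// normrX.
    by rewrite exprn_ege1// ltW.
  have : delta * D * C <= delta * D * (K + C + 1) by rewrite ler_pM2l//; lra.
  lra.
have neg (m : nat) : enorm ((A ^- m.+1)^T *m (xi + delta *: u)) < r.
  rewrite mulmxDr (le_lt_trans (enormD _ _))// Axi' enormZ exi.
  have h1 : `|lambda ^- m.+1| * rho <= rho / `|lambda|.
    rewrite mulrC ler_wpM2l ?(ltW (lt_trans s0 srho))// normrV ?unitfE ?expf_neq0//.
    rewrite normrX lef_pV2 ?posrE ?exprn_gt0 ?normr_gt0//.
    by rewrite exprS ler_peMr ?normr_ge0// exprn_ege1// ltW.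
  have h2 := Kt m.+1 (delta *: u).
  have h3 : K * t ^- m.+1 * enorm (delta *: u) <= K * (delta * D).
    have tm1 : 1 <= t ^+ m.+1 by rewrite exprn_ege1// ltW.
    have tm0 : 0 < t ^+ m.+1 by rewrite (lt_le_trans ltr01).
    apply: ler_pM => //; [by rewrite divr_ge0 ?(ltW K0) ?(ltW tm0)|exact: enorm_ge0|].
    by rewrite ler_pdivrMr// ler_peMr// ltW.
  have : delta * D * K <= delta * D * (K + C + 1) by rewrite ler_pM2l//; lra.
  lra.
rewrite /y; case: j {y} => m; last by right; rewrite NegzE opprK; exact: (pos m.+1).
case: m => [|m]; first by right; rewrite oppr0; exact: (pos 0%N).
by left; rewrite -exprnN; exact: neg.
Qed.

End Contraction.

(** * The affine system *)

Lemma Rintegral_sum d (T : measurableType d) (R : realType)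
    (mu : {measure set T -> \bar R}) I (s : seq I) (f : I -> T -> R) :
  (forall i, mu.-integrable setT (EFin \o f i)) ->
  mu.-integrable setT (EFin \o (fun t => \sum_(i <- s) f i t)) /\
  \sum_(i <- s) \int[mu]_t f i t = \int[mu]_t \sum_(i <- s) f i t.
Proof.
move=> fi; elim: s => [|i s [ih1 ih2]].
  under eq_fun do rewrite big_nil.
  by rewrite big_nil Rintegral_cst ?mul0r//; split => //; exact: integrable0.
under eq_fun do rewrite big_cons.
rewrite big_cons ih2 RintegralD//; split => //.
exact: (integrableD measurableT (fi i) ih1).
Qed.

Section SchwartzDecay.
Context (R : realType) (n : nat).
Variable psi : 'cV[R]_n -> R[i].
Hypothesis spsi : schwartz psi.

Lemma schwartz_continuous :
  continuous (fun x => complex.Re (psi x)) /\ continuous (fun x => complex.Im (psi x)).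
Proof. by have [] := spsi [::]. Qed.

(** Expanding the product of the factors 1 + x_i^2 over subsets of coordinates gives 2^n even
    monomials, and the Schwartz property bounds psi times each of them. *)
Lemma schwartz_decay : exists C : R, 0 < C /\
  forall x, normc (psi x) <= C * weight x.
Proof.
pose alpha (f : {ffun 'I_n -> bool}) i := ((f i).*2)%N.
have /choice[M MP] f : exists M : R, forall x,
    normc ((monom (alpha f) x)%:C * psi x) <= M.
  by have [_ _ /(_ (alpha f))] := spsi [::].
have M0 f : 0 <= M f by rewrite (le_trans _ (MP f 0))// normc_ge0.
exists (1 + \sum_f M f); split; first by rewrite ltr_pwDl// sumr_ge0.
move=> x.
have E : \prod_i (1 + x i 0 ^+ 2) = \sum_f monom (alpha f) x.
  rewrite (eq_bigr (fun i => \sum_(b : bool) x i 0 ^+ b.*2)) => [|i _]; last first.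
    by rewrite big_bool/= expr0 addrC.
  by rewrite bigA_distr_bigA.
rewrite /weight prodfV ler_pdivlMr; last first.
  by apply: prodr_gt0 => i _; rewrite ltr_wpDr// sqr_ge0.
rewrite mulrC E mulr_suml (@le_trans _ _ (\sum_f M f))//; last by rewrite lerDr.
apply: ler_sum => f _; rewrite (le_trans _ (MP f x))// normcM normc_real.
by rewrite ler_wpM2r ?normc_ge0// ler_norm.
Qed.

End SchwartzDecay.

Lemma det_exprz (F : fieldType) n (A : 'M[F]_n.+1) (j : int) : A \in unitmx ->
  \det (A ^ j) = \det A ^ j.
Proof.
move=> uA; have detX (m : nat) : \det (A ^+ m) = \det A ^+ m.
  by elim: m => [|m ih]; rewrite ?det1// !exprS -mulmxE det_mulmx ih.
case: j => m; first exact: detX.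
by rewrite NegzE -!exprnN -[_ ^- _]/(invmx (A ^+ m.+1)) det_inv detX.
Qed.

Section AffineSystem.
Context (R : realType) (n : nat).
Variables (A : 'M[R]_n.+1) (psi : 'cV[R]_n.+1 -> R[i]) (C : R).
Hypothesis uA : A \in unitmx.
Hypothesis cRe : continuous (fun x => complex.Re (psi x)).
Hypothesis cIm : continuous (fun x => complex.Im (psi x)).
Hypothesis C0 : 0 < C.
Hypothesis psiC : forall x, normc (psi x) <= C * weight x.

Local Notation T := (measurableTypeR R).
Local Notation leb := (lebesgue R n.+1).
Local Notation atom := (affine A psi).

Let uAj j : A ^ j \in unitmx. Proof. exact: unitrXz. Qed.

Let a (j : int) : R := absdet A `^ (j%:~R / 2).

Let det_gt0 : 0 < absdet A.
Proof. by rewrite normr_gt0 -unitfE -unitmxE. Qed.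

Let a_gt0 j : 0 < a j. Proof. exact: powR_gt0. Qed.

Let aD (j d : int) : a (j + d) = a j * a d.
Proof.
rewrite /a -powRD; last by rewrite (gt_eqF det_gt0) implybT.
by rewrite -mulrDl -intrD.
Qed.

Let a_sqr j : a j * `|\det (A ^ j)|^-1 = (a j)^-1.
Proof.
have -> : `|\det (A ^ j)| = a j * a j.
  rewrite det_exprz// /a -powRD; last by rewrite (gt_eqF det_gt0) implybT.
  rewrite -splitr powR_intmul ?ltW// /absdet; case: j => m; first exact: normrX.
  by rewrite NegzE -!exprnN normfV normrX.
by field; rewrite gt_eqF.
Qed.

Let psi_bound x : normc (psi x) <= C.
Proof.
rewrite (le_trans (psiC x))//; apply: ler_piMr; first exact: ltW.
apply: prodr_ile1 => i _; rewrite (ltW (cauchy_gt0 _))/=.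
by rewrite invf_le1 ?lerDl ?sqr_ge0// ltr_wpDr// sqr_ge0.
Qed.

Let cmpsi : cmeas (fun t : n.+1.-tuple T => psi (vec t)).
Proof. by split; [exact: (measurable_continuous_vec cRe)|exact: (measurable_continuous_vec cIm)]. Qed.

Let cipsi : cintegrable leb (fun t => psi (vec t)).
Proof.
have := integrableZl measurableT C (@integrable_weight R n.+1).
by move=> /cintegrable_le; apply.
Qed.

Let shift j (k : 'cV[int]_n.+1) : n.+1.-tuple T -> n.+1.-tuple T :=
  affm (A ^ j) (- map_mx intr k).

Let scshift j k := scales_by_affm (- map_mx intr k) (uAj j).

Let atomE j k : (fun t : n.+1.-tuple T => atom j k (vec t)) =
  (fun t => (a j)%:C * ((fun t => psi (vec t)) \o shift j k) t).
Proof. by apply/funext => t; rewrite /= vec_affm. Qed.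

Lemma cmeas_affine j k : cmeas (fun t : n.+1.-tuple T => atom j k (vec t)).
Proof.
rewrite atomE; apply: cmeasM; first exact: cmeas_cst.
exact: (scales_by_cmeas (scshift j k)).
Qed.

Lemma cintegrable_affine j k : cintegrable leb (fun t => atom j k (vec t)).
Proof.
rewrite atomE; apply: cintegrableZ.
exact: (scales_by_cintegrable (scshift j k)).
Qed.

Let normc_atom j k x :
  normc (atom j k x) = a j * normc (psi (A ^ j *m x - map_mx intr k)).
Proof. by rewrite normcM normc_real (gtr0_norm (a_gt0 j)). Qed.

Lemma normc_affine_le j k x : normc (atom j k x) <= a j * C.
Proof. by rewrite normc_atom ler_pM2l. Qed.

Lemma cL2_affine j k : cL2 leb (fun t => atom j k (vec t)).
Proof.
have := integrableZl measurableT (a j * C)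
  (cintegrable_norm (cintegrable_affine j k)).
apply: cL2_le; first exact: cmeas_affine.
by move=> t; rewrite expr2 ler_wpM2r ?normc_ge0// normc_affine_le.
Qed.

Lemma Rintegral_normc_affine j k :
  \int[leb]_t normc (atom j k (vec t)) = (a j)^-1 * \int[leb]_t normc (psi (vec t)).
Proof.
rewrite -a_sqr -mulrA -(scales_by_Rintegral (scshift j k)); last exact: cintegrable_norm.
rewrite -RintegralZl//; last first.
  exact: (scales_by_integrable (scshift j k) (cintegrable_norm cipsi)).
by apply: eq_Rintegral => t _; rewrite normc_atom vec_affm.
Qed.

Lemma affine_line_cvg j k x z :
  ccvg (fun m => atom j k (x - m.+1%:R^-1 *: z)) (atom j k x).
Proof.
apply: ccvgM; first exact: ccvg_cst.
pose y m : 'cV[R]_n.+1 := A ^ j *m (x - m.+1%:R^-1 *: z) - map_mx intr k.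
pose y0 : 'cV[R]_n.+1 := A ^ j *m x - map_mx intr k.
have cv : y @ \oo --> y0.
  apply: cvg_col => i; set w := A ^ j *m z.
  rewrite (_ : (fun m => _) = fun m => y0 i 0 - m.+1%:R^-1 * w i 0).
    rewrite -[X in _ --> X]subr0 -[X in _ --> _ - X](mul0r (w i 0)).
    apply: cvgB; first exact: cvg_cst.
    by apply: cvgMl; exact: cvg_harmonic.
  apply/funext => m; rewrite /y mulmxBr -scalemxAr -/w /y0 !mxE; ring.
by split; [exact: (cvg_comp _ _ cv (@cRe y0))|exact: (cvg_comp _ _ cv (@cIm y0))].
Qed.

Lemma fourier_affine_eq0 j k xi :
  fourier psi ((A ^ (- j))^T *m xi) = 0 -> fourier (atom j k) xi = 0.
Proof.
set eta := _ *m xi => psi0.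
pose F x := psi x * cis (- (2 * pi * dotv x eta)).
have E : fourier psi eta = cint leb (fun t => F (vec t)).
  rewrite /fourier; congr cint; apply/funext => t.
  by rewrite /F /cis cosN sinN.
pose c := dotv (map_mx intr k) eta.
have -> : fourier (atom j k) xi = cint leb (fun t =>
    (a j)%:C * cis (- (2 * pi * c)) * ((fun t => F (vec t)) \o shift j k) t).
  rewrite /fourier; congr cint; apply/funext => t /=.
  rewrite /F vec_affm /affine -/(a j).
  set y := A ^ j *m vec t - _.
  have -> : dotv (vec t) xi = c + dotv y eta.
    rewrite /c /eta -dotvDl -dotv_mulmx addrC subrK mulmxA mulmxE.
    by rewrite -exprzDr// addNr expr0z mul1mx.
  have -> : cos (2 * pi * (c + dotv y eta)) +i* - sin (2 * pi * (c + dotv y eta)) =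
      cis (- (2 * pi * c)) * cis (- (2 * pi * dotv y eta)).
    by rewrite -cisD -opprD -mulrDr /cis cosN sinN.
  ring.
have ciF : cintegrable leb (fun t => F (vec t)).
  rewrite /F; under eq_fun do rewrite mulrC; apply: (cintegrableMl (M := 1)) => //.
  - apply: cmeas_cis; apply: measurableT_comp => //.
    by apply: measurable_funM => //; exact: measurable_dotv.
  - by move=> t; rewrite normc_cis.
rewrite cintZ; last exact: (scales_by_cintegrable (scshift j k)).
by rewrite (scales_by_cint (scshift j k))// -E psi0 !mulr0.
Qed.

(** The sum over k is taken pointwise under the integral, where [sum_weight_le] bounds it by [a j] *
    C * 8^(n+1); the fixed atom contributes its L^1 norm, of order 1 / [a j0]. The resulting
    quotient depends on j - j0 only. *)
Lemma sum_normc_ip_affine_le j j0 k0 (F : seq 'cV[int]_n.+1) : uniq F ->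
  \sum_(k <- F) normc (ip leb (fun t => atom j k (vec t)) (fun t => atom j0 k0 (vec t)))
  <= a j / a j0 * (2 * (C * 8 ^+ n.+1 * \int[leb]_t normc (psi (vec t)))).
Proof.
move=> uF; set v := fun t => atom j0 k0 (vec t).
pose G k t := normc (atom j k (vec t)) * normc (v t).
have iG k : leb.-integrable setT (EFin \o G k).
  have := cintegrable_norm (cL2_mulJ (cL2_affine j k) (cL2_affine j0 k0)).
  by congr integrable; apply/funext => t /=; rewrite normcM normc_conj.
rewrite (@le_trans _ _ (\sum_(k <- F) 2 * \int[leb]_t G k t))//.
  apply: ler_sum => k _; rewrite (le_trans (normc_cint _))//.
    exact: cL2_mulJ (cL2_affine _ _) (cL2_affine _ _).
  rewrite ler_pM2l//; under eq_Rintegral do rewrite normcM normc_conj.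
  by [].
rewrite -mulr_sumr.
have [iGF ->] := Rintegral_sum F iG.
rewrite [leRHS]mulrCA ler_pM2l//.
rewrite (@le_trans _ _ (\int[leb]_t (a j * C * 8 ^+ n.+1 * normc (v t))))//.
  apply: le_Rintegral => //.
  - exact: (integrableZl measurableT _ (cintegrable_norm (cintegrable_affine j0 k0))).
  - move=> t _; rewrite -mulr_suml ler_wpM2r ?normc_ge0//.
    rewrite (@le_trans _ _ (\sum_(k <- F) a j * C * weight (A ^ j *m vec t - map_mx intr k)))//.
      apply: ler_sum => k _; rewrite normc_atom -mulrA ler_pM2l; [exact: psiC|exact: a_gt0].
    by rewrite -mulr_sumr ler_pM2l ?mulr_gt0// sum_weight_le.
rewrite RintegralZl//; last exact/cintegrable_norm/cintegrable_affine.
rewrite Rintegral_normc_affine le_eqVlt; apply/orP; left; apply/eqP; ring.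
Qed.

Variables (r s : R).
Hypothesis r0 : 0 < r.
Hypothesis psi_supp : supported_in (fourier psi) (@round_annulus R n.+1 r s).
Variable Delta : set 'cV[R]_n.+1.
Hypothesis AD : dilation_ellipsoid A Delta.

Let fourier_atom j k xi :
  let y := enorm ((A ^ (- j))^T *m xi) in y < r \/ s < y -> fourier (atom j k) xi = 0.
Proof.
move=> y yrs; apply: fourier_affine_eq0; apply/eqP; apply: contraT => /psi_supp/andP[].
by rewrite -/y; case: yrs => ? ? ?; lra.
Qed.

(** At any frequency, a scale whose pulled-back norm exceeds s has vanishing transform. If neither
    does, the larger of the two indices has pulled-back norm below r, and its transform vanishes. *)
Lemma ip_affine_eq0 : exists J : nat, forall j j' k k', (J < absz (j - j'))%N ->
  ip leb (fun t => atom j k (vec t)) (fun t => atom j' k' (vec t)) = 0.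
Proof.
have [J JP] := dilation_annulus_disjoint AD s r0.
exists J => j j' k k' Jj.
apply: (cint_disjoint_spectra (M := a j' * C)).
- exact: cintegrable_affine.
- exact: cintegrable_affine.
- exact: normc_affine_le.
- exact: affine_line_cvg.
move=> xi; pose y i := enorm ((A ^ (- i))^T *m xi).
have out (i : int) : s < y i -> forall k, fourier (atom i k) xi = 0.
  by move=> si k1; apply: fourier_atom; right.
have inn (i : int) : y i < r -> forall k, fourier (atom i k) xi = 0.
  by move=> si k1; apply: fourier_atom; left.
case: (lerP (y j') s) => [yj'|/out->]; last by right.
case: (lerP (y j) s) => [yj|/out->]; last by left.
have [jj'|jj'] := lerP j j'.
  right; apply: inn; rewrite /y (_ : j' = j + `|j - j'|%N%:Z); last by lia.
  exact: JP.
left; apply: inn; rewrite /y (_ : j = j' + `|j - j'|%N%:Z); last by lia.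
exact: JP.
Qed.

Lemma schur_affine : exists D : R, 0 < D /\
  forall (i : int * 'cV[int]_n.+1) (F : seq (int * 'cV[int]_n.+1)), uniq F ->
  \sum_(p <- F) normc (ip leb (fun t => atom p.1 p.2 (vec t))
                             (fun t => atom i.1 i.2 (vec t))) <= D.
Proof.
have [J JP] := ip_affine_eq0.
pose B : R := 2 * (C * 8 ^+ n.+1 * \int[leb]_t normc (psi (vec t))).
have B0 : 0 <= B.
  rewrite !mulr_ge0 ?(ltW C0)// Rintegral_ge0// => t _; exact: normc_ge0.
(* The offsets from -J to J, indexed by d < 2 J + 1. *)
pose e (d : nat) : int := d%:Z - J%:Z.
exists (1 + \sum_(d < J.*2.+1) a (e d) * B); split.
  by rewrite ltr_pwDl// sumr_ge0// => d _; rewrite mulr_ge0// ltW.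
move=> [j0 k0] F uF /=.
pose t (p : int * 'cV[int]_n.+1) := normc (ip leb
  (fun t => atom p.1 p.2 (vec t)) (fun t => atom j0 k0 (vec t))).
have t0 p : 0 <= t p by exact: normc_ge0.
rewrite (eq_bigr t)//.
rewrite (@le_trans _ _ (\sum_(d < J.*2.+1) a (e d) * B))//; last by rewrite lerDr.
(* Terms more than J scales away from [j0] vanish; every other term is charged to its own offset d.
   Exchanging the sums leaves one lattice sum per offset. *)
rewrite (@le_trans _ _ (\sum_(p <- F) \sum_(d < J.*2.+1 | p.1 == j0 + e d) t p))//.
  apply: ler_sum => p _; have [pJ|Jp] := leqP (absz (p.1 - j0)) J; last first.
    by rewrite {1}/t JP// normc0 sumr_ge0.
  have dJ : (absz (p.1 - j0 + J%:Z)%R < J.*2.+1)%N by lia.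
  rewrite (bigD1 (Ordinal dJ))/=; last by rewrite /e; apply/eqP; lia.
  by rewrite lerDl sumr_ge0.
rewrite (exchange_big_dep xpredT)//=; apply: ler_sum => d _.
rewrite -big_filter; set G := [seq _ <- _ | _].
have uG : uniq [seq p.2 | p <- G].
  rewrite map_inj_in_uniq ?filter_uniq// => -[p1 p2] [q1 q2].
  by rewrite !mem_filter/= => /andP[/eqP-> _] /andP[/eqP-> _] ->.
have := sum_normc_ip_affine_le (j0 + e d) j0 k0 uG.
rewrite aD [a j0 * _]mulrC mulfK ?gt_eqF// -/B big_map; apply: le_trans.
rewrite le_eqVlt; apply/orP; left; apply/eqP; apply: eq_big_seq => p.
by rewrite mem_filter => /andP[/eqP pj _]; rewrite /t pj.
Qed.

End AffineSystem.

(** * The frame operator *)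

Section L2Functions.
Context (R : realType) (n : nat).
Implicit Types f g : 'cV[R]_n -> R[i].
Local Notation T := (measurableTypeR R).
Local Notation leb := (lebesgue R n).

Lemma L2normE f :
  L2norm f = ((\int[leb]_t (normc (f (vec t)) ^+ 2)%:E) `^ 2^-1)%E.
Proof.
rewrite /L2norm unlock; congr (_ `^ _)%E; apply: eq_integral => t _.
by rewrite gee0_abs ?lee_fin ?normc_ge0// poweR_EFin powR_mulrn ?normc_ge0.
Qed.

Lemma L2P f : L2 f <-> cL2 leb (fun t => f (vec t)).
Proof.
rewrite /L2 L2normE; split=> [[f1 f2 f3]|[[f1 f2] /integrableP[f3 f4]]].
  split => //; apply/integrableP; split.
    by apply/measurable_EFinP/measurable_funX/measurable_normc.
  have /lty_poweRy : (2^-1 : R) != 0 by [].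
  move=> /(_ _ f3); under [X in (_ -> X < _)%E]eq_integral => t _.
    rewrite /= ger0_norm ?sqr_ge0//; over.
  by [].
split => //; apply: poweR_lty; move: f4; under eq_integral => t _.
  rewrite /= ger0_norm ?sqr_ge0//; over.
by [].
Qed.

Lemma L2norm_sqnorm f : L2 f ->
  L2norm f = (Num.sqrt (sqnorm leb (fun t => f (vec t))))%:E.
Proof.
move=> /L2P[_ f2]; rewrite L2normE -powR12_sqrt ?sqnorm_ge0// -poweR_EFin.
by rewrite /sqnorm /Rintegral fineK//; exact: integrable_fin_num.
Qed.

Definition unvec (x : 'cV[R]_n) : n.-tuple T := [tuple (x i 0 : T) | i < n].

Lemma vecK : cancel (@vec R n) unvec.
Proof. by move=> t; apply: eq_from_tnth => i; rewrite tnth_mktuple mxE. Qed.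

End L2Functions.

Section FrameOperator.
Context (R : realType) (n : nat).
Variables (A : 'M[R]_n.+1) (Delta : set 'cV[R]_n.+1).
Variables (psi : 'cV[R]_n.+1 -> R[i]) (r s : R).
Hypothesis AD : dilation_ellipsoid A Delta.
Hypothesis spsi : schwartz psi.
Hypothesis r0 : 0 < r.
Hypothesis psi_supp : supported_in (fourier psi) (@round_annulus R n.+1 r s).

Implicit Types f g : 'cV[R]_n.+1 -> R[i].
Local Notation T := (measurableTypeR R).
Local Notation leb := (lebesgue R n.+1).
Local Notation atom := (affine A psi).

Let uA := dilation_unitmx AD.

Let cL2_atom j k : cL2 leb (fun t => atom j k (vec t)).
Proof.
have [cRe cIm] := schwartz_continuous spsi; have [C [C0 psiC]] := schwartz_decay spsi.
exact: (cL2_affine uA cRe cIm C0 psiC).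
Qed.

Let residual f g (F : {fset int * 'cV[int]_n.+1}) x : R[i] :=
  g x - \sum_(p <- F) inner f (atom p.1 p.2) * atom p.1 p.2 x.

Let cL2_residual f g F : L2 g -> cL2 leb (fun t => residual f g F (vec t)).
Proof.
move=> /L2P Lg; apply: cL2B => //; apply: cL2_sum => p.
exact/cL2Z/cL2_atom.
Qed.

Lemma ex_frame_image f : L2 f -> exists g, is_frame_image A psi f g.
Proof.
have [cRe cIm] := schwartz_continuous spsi; have [C [C0 psiC]] := schwartz_decay spsi.
have [D [D0 schur]] := schur_affine uA cRe cIm C0 psiC r0 psi_supp AD.
move=> /L2P Lf.
have [g Lg gP] := frame_series_cvg D0 (fun p => cL2_atom p.1 p.2) schur Lf.
have L2g : L2 (g \o @unvec R n.+1).
  by apply/L2P; rewrite /=; under eq_fun do rewrite vecK.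
exists (g \o @unvec R n.+1); split => // e e0.
(* The series bound is a weak inequality on squared norms, whereas [has_L2_sum] asks for a strict
   one on norms; hence the square of e / 2. *)
have [|F0 F0P] := gP ((e / 2) ^+ 2); first by rewrite exprn_gt0// divr_gt0.
exists F0 => F /F0P FP; have Lr := cL2_residual f F L2g.
rewrite (L2norm_sqnorm ((L2P _).2 Lr)) lte_fin.
apply: (@le_lt_trans _ _ (e / 2)); last by lra.
rewrite (@le_trans _ _ (Num.sqrt ((e / 2) ^+ 2)))//; last first.
  by rewrite sqrtr_sqr ger0_norm// divr_ge0// ltW.
rewrite ler_wsqrtr//; move: FP; congr (sqnorm _ _ <= _); apply/funext => t.
by rewrite /residual /= vecK.
Qed.

(** Convergence rules out the dummy value of [frame_op] on L^2. *)
Lemma frame_op_image f : L2 f -> is_frame_image A psi f (frame_op A psi f).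
Proof. by move=> Lf; have /xgetPex := ex_frame_image Lf; apply. Qed.

(** The difference is the inner product of the residual with f, small by Cauchy-Schwarz. Both the
    sign of <U f, f> and its vanishing on functions orthogonal to all atoms are read off from
    this. *)
Lemma inner_frame_approx f g (e : R) : L2 f -> is_frame_image A psi f g -> 0 < e ->
  exists F : {fset int * 'cV[int]_n.+1},
    normc (inner g f - (\sum_(p <- F) normc (inner f (atom p.1 p.2)) ^+ 2)%:C) <= e.
Proof.
move=> L2f [L2g gP] e0; have Lf := (L2P _).1 L2f; have Lg := (L2P _).1 L2g.
set N := sqnorm leb (fun t => f (vec t)).
have N0 : 0 <= N by exact: sqnorm_ge0.
(* Makes N / a at most e / 2, with N + 1 guarding against N = 0; the residual is then taken below e
   / (2 a) in squared norm. *)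
pose a := 2 * (N + 1) / e.
have a0 : 0 < a by rewrite divr_gt0// mulr_gt0// ltr_wpDl.
have ea0 : 0 < e / 2 / a by apply: divr_gt0 => //; exact: divr_gt0.
have eta0 : 0 < Num.sqrt (e / 2 / a) by rewrite sqrtr_gt0.
have [F0 /(_ F0 (fsubset_refl _))] := gP _ eta0.
have Lr := cL2_residual f F0 L2g.
rewrite (L2norm_sqnorm ((L2P _).2 Lr)) lte_fin ltr_sqrt// => rF.
exists F0.
have -> : inner g f - (\sum_(p <- F0) normc (inner f (atom p.1 p.2)) ^+ 2)%:C =
    ip leb (fun t => residual f g F0 (vec t)) (fun t => f (vec t)).
  rewrite /residual ipBl//; last first.
    by apply: cL2_sum => p; exact: cL2Z.
  rewrite ip_suml//; congr (_ - _).
  rewrite rmorph_sum; apply: eq_bigr => p _.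
  by rewrite [ip _ _ _]ipC// mulrC; apply/esym; exact: mulJ_normc.
rewrite (le_trans (normc_ip a0 Lr Lf))// [leRHS](splitr e) lerD//.
  by rewrite mulrC -ler_pdivlMr// ltW.
rewrite -/N ler_pdivrMl// (_ : a * (e / 2) = N + 1) ?lerDl//.
by rewrite /a; field; rewrite gt_eqF.
Qed.

Lemma Re_inner_frame_ge0 f g : L2 f -> is_frame_image A psi f g ->
  0 <= complex.Re (inner g f).
Proof.
move=> Lf fg; apply/ler_addgt0Pr => e e0.
have [F] := inner_frame_approx Lf fg e0.
set S := \sum_(p <- F) _; set z := inner g f.
have S0 : 0 <= S by apply: sumr_ge0 => p _; rewrite sqr_ge0.
move=> /(le_trans (le_Re_normc _)); rewrite Re_sub ler_distl => /andP[h _].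
by move: h => /=; lra.
Qed.

Lemma inner_frame_eq0 f g : L2 f -> is_frame_image A psi f g ->
  (forall j k, inner f (atom j k) = 0) -> complex.Re (inner g f) = 0.
Proof.
move=> Lf fg f0; apply/eqP; rewrite eq_le Re_inner_frame_ge0// andbT.
apply/ler_addgt0Pr => e e0; have [F] := inner_frame_approx Lf fg e0.
rewrite big1 => [|p _]; last by rewrite f0 normc0 expr0n.
rewrite subr0 => h; rewrite add0r (le_trans _ h)// (le_trans _ (le_Re_normc _))//.
exact: ler_norm.
Qed.

Lemma ex_orthogonal_unit (lambda : R) (v : 'cV[R]_n.+1) : v != 0 ->
  A^T *m v = lambda *: v -> r < s -> s / r < `|lambda| ->
  exists f, [/\ L2 f, L2norm f = 1%E & forall j k, inner f (atom j k) = 0].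
Proof.
move=> v0 Av rs sr.
have [cRe cIm] := schwartz_continuous spsi; have [C [C0 psiC]] := schwartz_decay spsi.
have [xi [delta [delta0 gap]]] := eigen_annulus_gap AD v0 Av r0 rs sr.
pose tau : R := 2 * pi.
have tau0 : 0 < tau by rewrite mulr_gt0 ?pi_gt0.
pose d := tau * delta.
have d0 : 0 < d by rewrite mulr_gt0.
(* Up to a constant, the inverse Fourier transform of the indicator of the cube xi + delta
   [0, 1]^(n+1); [d] = 2 pi delta because [dkern] has no 2 pi in its phase. *)
pose h (t : n.+1.-tuple T) : R[i] := dkern (d *: vec t) * cis (tau * dotv (vec t) xi).
have sc : scales_by leb (affm d%:M 0) `|\det (d%:M : 'M[R]_n.+1)|^-1.
  by apply: scales_by_affm; rewrite unitmxE det_scalar unitfE expf_neq0 ?gt_eqF.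
have vaff t : vec (affm d%:M 0 t) = d *: vec t by rewrite vec_affm mul_scalar_mx addr0.
have ccis (w : 'cV[R]_n.+1) (c : R) : cmeas (fun t : n.+1.-tuple T => cis (c * dotv (vec t) w)).
  by apply: cmeas_cis; apply: measurable_funM => //; exact: measurable_dotv.
have md : cmeas (fun t : n.+1.-tuple T => dkern (d *: vec t)).
  have := scales_by_cmeas sc (cmeas_dkern R n.+1).
  by congr cmeas; apply/funext => t /=; rewrite vaff.
have mh : cmeas h by exact: cmeasM.
have hE t : normc (h t) ^+ 2 = (fun t => normc (dkern (vec t)) ^+ 2) (affm d%:M 0 t).
  by rewrite /h normcM normc_cis mulr1 vaff.
have Lh : cL2 leb h.
  split => //; rewrite (_ : EFin \o _ = EFin \o ((fun t => normc (dkern (vec t)) ^+ 2) \o affm d%:M 0)).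
    exact: (scales_by_integrable sc (integrable_sqdkern R n.+1)).
  by apply/funext => t /=; rewrite hE.
pose N := sqnorm leb h.
have N0 : 0 < N.
  rewrite /N /sqnorm (_ : (fun t => _) = (fun t => normc (dkern (vec t)) ^+ 2) \o affm d%:M 0).
    rewrite (scales_by_Rintegral sc (integrable_sqdkern R n.+1)).
    rewrite mulr_gt0 ?Rintegral_sqdkern_gt0// invr_gt0 normr_gt0 det_scalar.
    by rewrite expf_neq0 ?gt_eqF.
  by apply/funext => t /=; rewrite hE.
pose c : R := (Num.sqrt N)^-1.
have c0 : 0 < c by rewrite invr_gt0 sqrtr_gt0.
pose f x := c%:C * h (unvec x).
have fE : (fun t => f (vec t)) = (fun t => c%:C * h t).
  by apply/funext => t; rewrite /f vecK.
have Lf : L2 f by apply/L2P; rewrite fE; exact: cL2Z.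
exists f; split => //.
  rewrite L2norm_sqnorm// fE (_ : sqnorm _ _ = 1) ?sqrtr1//.
  rewrite /sqnorm (_ : (fun t => _) = fun t => c ^+ 2 * normc (h t) ^+ 2); last first.
    by apply/funext => t; rewrite normcM normc_real gtr0_norm// exprMn.
  have [_ ih] := Lh; rewrite RintegralZl//.
  by rewrite -/(sqnorm leb h) -/N /c exprVn sqr_sqrtr ?mulVf ?gt_eqF// ltW.
move=> j k.
have -> : inner f (atom j k) = ip leb (fun t => c%:C * h t) (fun t => atom j k (vec t)).
  by rewrite -fE.
(* With the atom on the left, the conjugated kernel and phase have the sign of the Fourier
   integral. *)
rewrite ipC ?cL2_atom//; last exact: cL2Z.
have ia : cintegrable leb (fun t => atom j k (vec t)) := cintegrable_affine uA cRe cIm psiC j k.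
pose H (t : n.+1.-tuple T) := cis (- tau * dotv (vec t) xi) * atom j k (vec t).
have iH : cintegrable leb H.
  by apply: (cintegrableMl (M := 1)) => // t; rewrite normc_cis.
have -> : ip leb (fun t => atom j k (vec t)) (fun t => c%:C * h t) =
    c%:C * cint leb (fun t => H t * dkern (- d *: vec t)).
  rewrite -cintZ; last first.
    under eq_fun do rewrite mulrC scaleNr dkernN.
    apply: (cintegrableMl (M := 4 ^+ n.+1)) => //; first exact: cmeasJ.
    by move=> t; rewrite normc_conj normc_dkern_le.
  congr cint; apply/funext => t; rewrite !conjcM scaleNr dkernN /H mulNr cisN.
  rewrite (_ : conjc c%:C = c%:C); last by apply: complexP; rewrite //= oppr0.
  ring.
rewrite (cint_dkern_eq0 iH) ?mulr0 ?conjc0// => u u01.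
(* For fixed u the integral is the Fourier transform of the atom at xi + delta u, a point that [gap]
   keeps off the spectrum at every scale. *)
rewrite (_ : (fun t => _) = fun t => atom j k (vec t) * cis (dotv (vec t) (- tau *: (xi + delta *: u)))).
  rewrite cint_cis_fourier scalerA mulrNN mulVf ?gt_eqF// scale1r.
  apply: (fourier_affine_eq0 uA cRe cIm psiC).
  apply/eqP; apply: contraT => /psi_supp/andP[].
  have [h1|h1] := gap j u u01 => h2 h3.
    by have := lt_le_trans h1 h2; rewrite ltxx.
  by have := lt_le_trans h1 h3; rewrite ltxx.
apply/funext => t; rewrite /H mulrAC -cisD mulrC; congr (_ * cis _).
by rewrite dotvZr dotvDr dotvZr /d; ring.
Qed.

End FrameOperator.

Theorem corollary3 (R : realType) (n : nat) (A : 'M[R]_n.+1)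
    (Delta : set 'cV[R]_n.+1) (lambda : R) (v : 'cV[R]_n.+1)
    (psi : 'cV[R]_n.+1 -> R[i]) (r s : R) :
  expansive A ->
  dilation_ellipsoid A Delta ->
  v != 0 -> A^T *m v = lambda *: v ->
  radial psi ->
  admissible A Delta psi ->
  0 < r -> r < s ->
  supported_in (fourier psi) (@round_annulus R n.+1 r s) ->
  s / r < `|lambda| ->
  [/\ forall f, L2 f -> is_frame_image A psi f (frame_op A psi f),
      ereal_inf [set (complex.Re (inner (frame_op A psi f) f))%:E |
                 f in [set f | L2 f /\ L2norm f = 1%E]] = 0%E &
      ~ exists c : R, 0 < c /\ forall f, L2 f ->
          (c%:E * L2norm f ^+ 2 <=
           \esum_(j in [set: int]) \esum_(k in [set: 'cV[int]_n.+1])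
             (normc (inner f (affine A psi j k)) ^+ 2)%:E)%E].
Proof.
move=> _ AD v0 Av _ [spsi _ _] r0 rs psi_supp rl.
have [f [Lf f1 f0]] := ex_orthogonal_unit AD spsi r0 psi_supp v0 Av rs rl.
have image g : L2 g -> is_frame_image A psi g (frame_op A psi g).
  by move=> Lg; exact: (frame_op_image AD spsi r0 psi_supp).
split => //.
  apply/eqP; rewrite eq_le; apply/andP; split.
    (* The infimum is attained at the unit vector orthogonal to all atoms; the other inequality is
       the positivity of the frame operator. *)
    apply: ereal_inf_lbound; exists f => //.
    by rewrite (inner_frame_eq0 AD spsi Lf (image _ Lf) f0).
  apply: le_ereal_inf_tmp => _ [g [Lg _] <-]; rewrite lee_fin.
  exact: (Re_inner_frame_ge0 AD spsi Lg (image _ Lg)).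
(* At the same f a lower frame bound would read c <= 0. *)
move=> [c [c0 /(_ f Lf)]]; rewrite f1 expe2 mule1 mule1 esum1 => [|j _].
  by rewrite lee_fin leNgt c0.
by rewrite esum1// => k _; rewrite f0 normc0 expr0n.
Qed.
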